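(* Suppose $\mathfrak p=(p_d)_{d\ge1}$ and $\mathfrak q=(q_d)_{d\ge1}$, with $p_d,q_d\in\mathcal P_d(\mathbb R)$, are two sequences of polynomials with infinitesimal distributions $(\mu,\mu')$ and $(\nu,\nu')$, respectively. Then the finite-free additive convolution $\mathfrak p\boxplus\mathfrak q=(p_d\boxplus_d q_d)_{d\ge1}$ has infinitesimal distribution $(\rho,\rho')$, where $\rho=\mu\boxplus\nu$ and the infinitesimal moments $m_n(\rho')$ are given by $$m_n(\rho')=\sum_{\pi\in NC(n)}\sum_{V\in\pi}\bigl[\widehat r_{|V|}(\mathfrak p)+\widehat r_{|V|}(\mathfrak q)\bigr]\,r_{\pi\setminus V}(\mu\boxplus\nu)\;-\;\frac n2\sum_{\substack{s+t=n\\ \sigma\in S_{NC}(s,t)}}\frac{r_\sigma(\mu\boxplus\nu)}{st}\qquad\text{for every } n\ge1.$$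
   Context: $\mathcal P_d(\mathbb R)$ is the set of monic real polynomials of degree $d$ with only real roots. For $p_d\in\mathcal P_d(\mathbb R)$ with roots $\lambda_1,\dots,\lambda_d$ (with multiplicity), $m_n(p_d)=\frac1d\sum_k\lambda_k^n$. Write $p_d(x)=\sum_{k=0}^d x^{d-k}(-1)^k\binom dk\mathsf e_k(p_d)$. The finite-free additive convolution is $$[p_d\boxplus_d q_d](x)=\sum_{k=0}^d x^{d-k}(-1)^k\binom dk\Bigl[\sum_{i=0}^k\binom ki\mathsf e_i(p_d)\mathsf e_{k-i}(q_d)\Bigr]$$ (which again lies in $\mathcal P_d(\mathbb R)$). The finite-free cumulants are $\kappa_n(p_d)=\frac{(-d)^{n-1}}{(n-1)!}\sum_{\pi\in P(n)}(-1)^{|\pi|-1}(|\pi|-1)!\prod_{V\in\pi}\mathsf e_{|V|}(p_d)$, $1\le n\le d$, with $P(n)$ the set of partitions of $[n]=\{1,\dots,n\}$ and $|\pi|$ the number of blocks. A sequence $\mathfrak p$ has infinitesimal distribution $(\mu,\mu')$ if $\mu$ is a probability distribution on $\mathbb R$ with finite moments $m_n(\mu)$ of all orders, $m_n(p_d)\to m_n(\mu)$ as $d\to\infty$ for all $n\ge0$, the limits $m_n'(\mathfrak p)=\lim_{d\to\infty}d\,(m_n(p_d)-m_n(\mu))$ exist for all $n\ge1$, and $\mu':\mathbb R[x]\to\mathbb R$ is the linear functional with $\mu'(1)=0$, $\mu'(x^n)=m_n'(\mathfrak p)$. For a linear functional $\mu'$, $m_n(\mu'):=\mu'(x^n)$.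 The cumulant fluctuations of such a $\mathfrak p$ are the numbers $\widehat r_n(\mathfrak p)$ with $\kappa_n(p_d)=r_n(\mu)+\frac1d\widehat r_n(\mathfrak p)+o(1/d)$ as $d\to\infty$, for each $n\ge1$ (they always exist when $\mathfrak p$ has an infinitesimal distribution). $NC(n)$ is the set of non-crossing partitions of $[n]$. For a sequence $(u_n)$: $u_\pi=\prod_{V\in\pi}u_{|V|}$, $u_{\pi\setminus V}=\prod_{W\in\pi,W\neq V}u_{|W|}$, $u_\sigma=\prod_c u_{|c|}$ over cycles $c$ (fixed points included) of a permutation $\sigma$. Free cumulants $r_n(\mu)$ are defined recursively by $m_n(\mu)=\sum_{\pi\in NC(n)}r_\pi(\mu)$. Throughout, only distributions determined by their moments (equivalently, by their free cumulants) are considered; the free additive convolution $\mu\boxplus\nu$ is the probability measure with $r_n(\mu\boxplus\nu)=r_n(\mu)+r_n(\nu)$ for all $n\ge1$. For $t,s\ge1$ let $\gamma_{t,s}=(1,\dots,t)(t+1,\dots,t+s)\in S_{t+s}$; $S_{NC}(t,s)$ is the set of $\sigma\in S_{t+s}$ such that $\langle\sigma,\gamma_{t,s}\rangle$ acts transitively on $[t+s]$ and $|\sigma|+|\sigma^{-1}\gamma_{t,s}|=t+s$, $|\cdot|$ counting cycles including fixed points. Sums over $s+t=n$ run over ordered pairs of integers $s,t\ge1$. *)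

(* Defs.v *)
From HB Require Import structures.
From mathcomp Require Import all_boot all_order all_algebra all_fingroup.
From mathcomp Require Import all_classical all_reals all_analysis.

Set Implicit Arguments.
Unset Strict Implicit.
Unset Printing Implicit Defensive.

Import Order.TTheory GRing.Theory Num.Theory.
Import numFieldNormedType.Exports.

Local Open Scope ring_scope.

(** * Set partitions and annular non-crossing permutations *)

Definition set_partitions (n : nat) : {set {set {set 'I_n}}} :=
  [set P : {set {set 'I_n}} | finset.partition P [set: 'I_n]].

Definition noncrossing (n : nat) (P : {set {set 'I_n}}) : bool :=
  [forall V in P, forall W in P, (V != W) ==>
    ~~ [exists a in V, exists b in W, exists c in V, exists d in W,
          [&& a < b, b < c & c < d]%N]].

Definition NC (n : nat) : {set {set {set 'I_n}}} :=
  [set P in set_partitions n | noncrossing P].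

(* [gamma t s] is (1,...,t)(t+1,...,t+s), with [t + s] shifted to start at 0:
   [ordS] is the cyclic successor. *)
Definition gamma_fun (t s : nat) (i : 'I_(t + s)) : 'I_(t + s) :=
  unsplit (match fintype.split i with
           | inl j => inl (ordS j)
           | inr j => inr (ordS j)
           end).

Lemma gamma_fun_inj (t s : nat) : injective (@gamma_fun t s).
Proof.
move=> i j /(can_inj (@unsplitK _ _)) eq_ij; apply: (can_inj (@splitK _ _)).
case: (fintype.split i) (fintype.split j) eq_ij => [a|a] [b|b] // [eq_ab];
  by congr (_ _); apply: ordS_inj; apply: val_inj.
Qed.

Definition gamma (t s : nat) : 'S_(t + s) := perm (@gamma_fun_inj t s).

(* In MathComp [u * v] applies [u] first; the number of cycles of
   [sigma^-1 * gamma] is the same for either convention, since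
   [sigma^-1 * gamma] and [gamma * sigma^-1] are conjugate. *)
Definition SNC (t s : nat) : {set 'S_(t + s)} :=
  [set sigma : 'S_(t + s) |
     [transitive <<[set sigma; gamma t s]>>%g, on [set: 'I_(t + s)] | 'P]
  && (#|porbits sigma| + #|porbits (sigma^-1 * gamma t s)%g| == t + s)%N].

(** * Multiplicative extensions of a sequence [u] *)

Definition part_prod (R : comNzRingType) (u : nat -> R) (n : nat)
    (P : {set {set 'I_n}}) : R :=
  \prod_(V in P) u #|V|.

Definition perm_prod (R : comNzRingType) (u : nat -> R) (n : nat)
    (sigma : 'S_n) : R :=
  \prod_(c in porbits sigma) u #|c|.

(** * Real-rooted polynomials *)

Definition real_rooted (R : realType) (d : nat) (p : {poly R}) : Prop :=
  exists2 s : seq R, size s = d & p = \prod_(x <- s) ('X - x%:P).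

(* The multiset of roots of a product of monic linear factors, as a sequence
   determined up to permutation ([::] for any other polynomial). *)
Definition root_seq (R : realType) (p : {poly R}) : seq R :=
  xget [::] (fun s : seq R => p = \prod_(x <- s) ('X - x%:P)).

Definition poly_moment (R : realType) (d : nat) (p : {poly R}) (n : nat) : R :=
  d%:R^-1 * \sum_(x <- root_seq p) x ^+ n.

(* Only meaningful for [k <= d]. *)
Definition ecoef (R : realType) (d : nat) (p : {poly R}) (k : nat) : R :=
  (-1) ^+ k * p`_(d - k) / 'C(d, k)%:R.

Lemma ecoefE (R : realType) (d : nat) (p : {poly R}) : (size p <= d.+1)%N ->
  p = \sum_(k < d.+1) ((-1) ^+ k * 'C(d, k)%:R * ecoef d p k) *: 'X^(d - k).
Proof.
move=> sz_p; apply/polyP => i; rewrite coef_sum.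
under eq_bigr do rewrite coefZ coefXn.
have [lt_di|le_id] := ltnP d i.
  rewrite nth_default ?(leq_trans sz_p)// big1// => k _.
  by rewrite gtn_eqF ?mulr0// (leq_ltn_trans (leq_subr _ _)).
have lt_k : (d - i < d.+1)%N by rewrite ltnS leq_subr.
rewrite (bigD1 (Ordinal lt_k))//= big1 ?addr0 => [|k neq_k].
  rewrite subKn// eqxx mulr1 /ecoef subKn//.
  have nz : 'C(d, d - i)%:R != 0 :> R.
    by rewrite pnatr_eq0 -lt0n bin_gt0 leq_subr.
  by rewrite mulrACA divff// mulr1 mulrA -expr2 sqrr_sign mul1r.
case: eqP => [def_i|_]; last by rewrite mulr0.
case/eqP: neq_k; apply: val_inj; rewrite /= def_i subKn//.
by rewrite -ltnS.
Qed.

Definition boxplus (R : realType) (d : nat) (p q : {poly R}) : {poly R} :=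
  \sum_(k < d.+1)
    ((-1) ^+ k * 'C(d, k)%:R *
     \sum_(i < k.+1) 'C(k, i)%:R * ecoef d p i * ecoef d q (k - i))
    *: 'X^(d - k).

(* Only meaningful for [1 <= n <= d]. *)
Definition ff_cumulant (R : realType) (d : nat) (p : {poly R}) (n : nat) : R :=
  (- d%:R) ^+ n.-1 / (n.-1)`!%:R *
  \sum_(P in set_partitions n)
    (-1) ^+ #|P|.-1 * (#|P|.-1)`!%:R * part_prod (ecoef d p) P.

(** * Moments and free cumulants of a probability measure *)

Definition finite_moments (R : realType) (mu : probability (measurableTypeR R) R)
    : Prop :=
  forall n : nat, mu.-integrable setT (fun x : R => (x ^+ n)%:E).

Definition moment (R : realType) (mu : probability (measurableTypeR R) R)
    (n : nat) : R :=
  Rintegral mu setT (fun x : R => x ^+ n).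

(* The recursion m_n = sum over NC(n) of r_P, solved for the one-block term;
   [k] bounds the recursion depth. *)
Fixpoint free_cumulant_rec (R : comNzRingType) (m : nat -> R) (k n : nat) : R :=
  if k is k'.+1 then
    m n - \sum_(P in NC n | P != [set [set: 'I_n]])
            part_prod (free_cumulant_rec m k') P
  else 0.

Definition free_cumulant (R : comNzRingType) (m : nat -> R) (n : nat) : R :=
  free_cumulant_rec m n n.

Lemma one_block_NC (n : nat) : (1 <= n)%N -> [set [set: 'I_n]]%SET \in NC n.
Proof.
move=> n_gt0; rewrite !inE; apply/andP; split.
  apply/and3P; split; rewrite /finset.cover ?big_set1 ?eqxx//.
    by apply/finset.trivIsetP => A B /set1P-> /set1P->; rewrite eqxx.
  by rewrite inE eq_sym -card_gt0 cardsT card_ord.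
apply/forall_inP => V /set1P->; apply/forall_inP => W /set1P->.
by rewrite eqxx.
Qed.

Lemma NC_block_lt (n : nat) (P : {set {set 'I_n}}) (V : {set 'I_n}) :
  P \in NC n -> P != [set [set: 'I_n]]%SET -> V \in P -> (0 < #|V| < n)%N.
Proof.
rewrite !inE => /andP[/and3P[_ /finset.trivIsetP tI n0] _] neqP VP.
have V0 : V != finset.set0 by apply: contraNneq n0 => <-.
have leV : (#|V| <= n)%N by have := max_card (mem V); rewrite card_ord.
rewrite card_gt0 V0 /= ltn_neqAle leV andbT.
apply: contraNneq neqP => cV.
have VT : V = [set: 'I_n]%SET.
  by apply/eqP; rewrite eqEcard finset.subsetT cardsT card_ord cV leqnn.
rewrite finset.eqEsubset finset.sub1set -VT VP andbT; apply/fintype.subsetP => W WP.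
rewrite inE; apply: contraNT n0 => neqW.
have := tI _ _ WP VP neqW; rewrite VT -setI_eq0 finset.setIT => /eqP <-.
exact: WP.
Qed.

Lemma free_cumulant_recE (R : comNzRingType) (m : nat -> R) (k n : nat) :
  (1 <= n <= k)%N -> free_cumulant_rec m k n = free_cumulant m n.
Proof.
elim/ltn_ind: n k => n IHn k /andP[n_gt0]; rewrite /free_cumulant.
case: k n n_gt0 IHn => [|k] [|n] // _ IHn le_nk /=; congr (_ - _).
apply: eq_bigr => P /andP[PNC neqP]; apply: eq_bigr => V VP.
have /andP[V0 ltV] := NC_block_lt PNC neqP VP.
have leVn : (#|V| <= n)%N by [].
by rewrite !(IHn _ ltV) ?V0 //= (leq_trans leVn).
Qed.

Lemma free_cumulantE (R : comNzRingType) (m : nat -> R) (n : nat) :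
  (1 <= n)%N -> m n = \sum_(P in NC n) part_prod (free_cumulant m) P.
Proof.
move=> n_gt0; rewrite (bigD1 _ (one_block_NC n_gt0))/=.
rewrite {1}/part_prod big_set1 cardsT card_ord {1}/free_cumulant.
case: n n_gt0 => // n _ /=.
rewrite -[LHS]addr0 -addrA; congr (_ + _).
apply/esym/eqP; rewrite addrC subr_eq0; apply/eqP.
apply: eq_bigr => P /andP[PNC neqP]; apply: eq_bigr => V VP.
have /andP[V0 ltV] := NC_block_lt PNC neqP VP.
by rewrite free_cumulant_recE// V0.
Qed.

Definition r_ (R : realType) (mu : probability (measurableTypeR R) R) : nat -> R :=
  free_cumulant (moment mu).

Definition determined_by_moments (R : realType)
    (mu : probability (measurableTypeR R) R) : Prop :=
  finite_moments mu /\
  forall nu : probability (measurableTypeR R) R, finite_moments nu ->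
    (forall n, moment nu n = moment mu n) ->
    forall A : set (measurableTypeR R), measurable A -> nu A = mu A.

(* [rho] is the free additive convolution of [mu] and [nu]; it is unique, being
   determined by its moments. *)
Definition is_free_convolution (R : realType)
    (mu nu rho : probability (measurableTypeR R) R) : Prop :=
  determined_by_moments rho /\
  forall n, (1 <= n)%N -> r_ rho n = r_ mu n + r_ nu n.

(** * Infinitesimal distributions and cumulant fluctuations *)

Local Open Scope classical_set_scope.

(* A sequence indexed by [d >= 1] is a function on [nat] whose value at 0 is
   irrelevant. *)
Definition infinitesimal_distribution (R : realType) (p : nat -> {poly R})
    (mu : probability (measurableTypeR R) R) (mu' : {scalar {poly R}}) : Prop :=
  [/\ forall d, (1 <= d)%N -> real_rooted d (p d),
      finite_moments mu,
      forall n, poly_moment d (p d) n @[d --> \oo] --> moment mu n,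
      mu' 1 = 0 &
      forall n, (1 <= n)%N ->
        d%:R * (poly_moment d (p d) n - moment mu n) @[d --> \oo] --> mu' 'X^n].

Definition is_cumulant_fluctuation (R : realType) (p : nat -> {poly R})
    (mu : probability (measurableTypeR R) R) (n : nat) (c : R) : Prop :=
  (fun d : nat => ff_cumulant d (p d) n : R^o) =
  (fun d : nat => r_ mu n + d%:R^-1 * c : R^o) +o_\oo
  (fun d : nat => d%:R^-1 : R^o).

(* The value is unique when it exists. *)
Definition r_hat (R : realType) (p : nat -> {poly R})
    (mu : probability (measurableTypeR R) R) (n : nat) : R :=
  xget 0 (is_cumulant_fluctuation p mu n).

(* Main.v *)
Require Import Defs.
From HB Require Import structures.
From mathcomp Require Import all_boot all_order all_algebra all_fingroup.
From mathcomp Require Import reals complex zify ring.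

Set Implicit Arguments.
Unset Strict Implicit.
Unset Printing Implicit Defensive.

Import Order.TTheory GRing.Theory Num.Theory.

Local Open Scope ring_scope.

(** The finite free cumulants linearize the finite free convolution, and moments
   are polynomials in cumulants whose coefficients have a topological expansion
   in powers of [1 / d].

   Write [e_k] for the normalized coefficients and [c_k] for the coefficients of
   [\prod_x (1 - x X)], the reciprocal of [p]. The cumulants are, up to scaling,
   the logarithm of the exponential generating function of the [e_k]
   ([set_partition_log], [part_log_set_log]), and the convolution multiplies
   these generating functions; so cumulants of order at most [d] add up
   ([ff_cumulant_boxplus]). Newton's identities ([newton]) express the moments
   as the logarithm of the sequence [k! c_k], and this is, up to scaling, the
   pointwise product of [(-d) ^+ k * e_k], the sum over permutations of products
   of cumulants over cycles, and of [(-d)(-d+1)...(-d+k-1)], the sum of [-d] to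
   the number of cycles. By the exponential formula for pairs of permutations
   ([exponential_formula], [CsumE]) one obtains [moment_cumulant]: the [n]-th
   moment is a sum over pairs [(s, t)] of permutations that generate a transitive
   group, with weight the cumulants over the cycles of [s] times
   [(-1 / d) ^+ (n + 1 - #s - #t)].

   The genus inequality [genus_le] bounds the number of cycles of [s], [t] and
   [s t] by [n + 2]. Thus order 0 comes from factorizations of long cycles; up to
   conjugation these are the geodesic permutations, which correspond to
   non-crossing partitions ([sum_NC]), so that the leading term is the usual
   moment-cumulant relation ([sum_pairs_planar]). Order 1 comes from
   factorizations of permutations with two cycles, up to conjugation of the
   [gamma t s], and gives the sum over annular non-crossing permutations
   ([sum_pairs_annular]); counting conjugates accounts for the factor
   [n / (2 s t)].

   Expanding to first order, moments with an expansion give cumulants with an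
   expansion, by induction on the order ([cumulant_fluctuation_ex]). The
   expansions of the cumulants of [p] and [q] are added, and
   [moment_expansion] turns the result into the expansion of the moments of the
   convolution: the planar term is differentiated by the product rule, and the
   annular term appears with its leading value.

   The convolution is real-rooted by the theorem of Grace and Walsh, proved here
   with polar derivatives ([polar_neq0], [walsh], [boxplus_real_rooted]). *)

(** * Cycles and the genus inequality *)

Definition stable (T : finType) (s : {perm T}) (S : {set T}) : bool :=
  [forall x, (s x \in S) == (x \in S)].

Definition ncyc (T : finType) (s : {perm T}) : nat := #|porbits s|.

Section Cycles.
Local Open Scope nat_scope.
Local Open Scope group_scope.
Variable T : finType.
Implicit Types (s t g : {perm T}) (S A B : {set T}) (x y : T).

Lemma stableP s S : reflect (forall x, (s x \in S) = (x \in S)) (stable s S).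
Proof. exact: 'forall_eqP. Qed.

Lemma stable_porbit s S x y : stable s S -> y \in porbit s x ->
  (y \in S) = (x \in S).
Proof.
move=> /stableP sS /porbitP[i ->]; elim: i => [|i IHi]; first by rewrite perm1.
by rewrite expgSr permM sS.
Qed.

Lemma porbit_stable s x : stable s (porbit s x).
Proof.
apply/stableP => y; rewrite -!eq_porbit_mem.
by have := porbit_perm s 1 y; rewrite expg1 => ->.
Qed.

Lemma stableM s t S : stable s S -> stable t S -> stable (s * t) S.
Proof. by move=> /stableP sS /stableP tS; apply/stableP => x; rewrite permM tS sS. Qed.

Lemma stableV s S : stable s^-1 S = stable s S.
Proof.
suff imp t : stable t S -> stable t^-1 S.
  by apply/idP/idP => /imp //; rewrite invgK.
by move=> /stableP tS; apply/stableP => x; rewrite -{2}[x](permKV t) tS.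
Qed.

Lemma stable_tperm x y S : (x \in S) = (y \in S) -> stable (tperm x y) S.
Proof. by move=> xyS; apply/stableP => z; case: tpermP => [->|->|]. Qed.

Lemma porbitJ s g x : porbit (s ^ g) (g x) = g @: porbit s x.
Proof.
apply/setP => y; apply/porbitP/imsetP => [[i ->]|[_ /porbitP[i ->] ->]].
  by exists ((s ^+ i) x); rewrite ?mem_porbit// -conjXg permJ.
by exists i; rewrite -conjXg permJ.
Qed.

Lemma porbitsJ s g : porbits (s ^ g) = [set g @: C | C : {set T} in porbits s].
Proof.
rewrite /porbits -imset_comp; apply/setP => C; apply/imsetP/imsetP => -[x _ ->].
  by exists (g^-1 x) => //=; rewrite -porbitJ permKV.
by exists (g x) => //=; rewrite porbitJ.
Qed.

Lemma ncycJ s g : ncyc (s ^ g) = ncyc s.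
Proof. by rewrite /ncyc porbitsJ card_imset//; apply: imset_inj; apply: perm_inj. Qed.

Lemma ncyc_tpermM x y s :
  ncyc (tperm x y * s) + (x \notin porbit s y).*2 = ncyc s + (x != y).
Proof. exact: porbits_mul_tperm. Qed.

Lemma ncyc_le s : ncyc s <= #|T|.
Proof. exact: (leq_imset_card (porbit s) T). Qed.

Lemma ncycMC s t : ncyc (s * t) = ncyc (t * s).
Proof. by rewrite -(ncycJ (t * s) t) conjgE !mulgA mulVg mul1g. Qed.

Lemma porbits_partition_setT s : partition (porbits s) setT.
Proof.
apply/and3P; split.
- apply/eqP/setP => x; rewrite inE; apply/bigcupP.
  by exists (porbit s x); [exact: imset_f|exact: porbit_id].
- apply/trivIsetP => _ _ /imsetP[x _ ->] /imsetP[y _ ->]; apply: contraR.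
  move=> /pred0Pn[z /andP[/= zx zy]]; rewrite -!eq_porbit_mem in zx zy.
  by rewrite -(eqP zx) (eqP zy).
- apply/negP => /imsetP[x _ x0]; by have := porbit_id s x; rewrite -x0 inE.
Qed.

(** Transitivity on [A] of the group generated by [s] and [t], for [s] and [t]
   leaving [A] invariant: testing invariant subsets makes it easy to change [s]
   and [t] by transpositions. *)
Definition conn A s t : bool :=
  [forall S : {set T}, [&& S \subset A, stable s S & stable t S] ==>
     ((S == set0) || (S == A))].

Lemma connP A s t :
  reflect (forall S, S \subset A -> stable s S -> stable t S -> S = set0 \/ S = A)
          (conn A s t).
Proof.
apply: (iffP forallP) => [cst S SA sS tS|cst S].
  by have := cst S; rewrite SA sS tS => /orP[/eqP|/eqP]; [left|right].
apply/implyP => /and3P[SA sS tS]; apply/orP.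
by case: (cst S SA sS tS) => ->; [left|right].
Qed.

(** Adding to [s] and [t] finitely many pairs of points that have to lie in the
   same component measures how far [s] and [t] are from being transitive. *)
Definition linked s t (l : seq (T * T)) : Prop :=
  forall S, stable s S -> stable t S ->
    all (fun ab => (ab.1 \in S) == (ab.2 \in S)) l -> S = set0 \/ S = setT.

(** A pair joining two cycles of [t] can be used up by multiplying [t] with the
   transposition that merges them; a pair inside a cycle is superfluous. *)
Lemma linked1_card t l : linked 1 t l -> ncyc t <= (size l).+1.
Proof.
elim: l t => [|[a b] l IHl] t lt /=.
  apply/card_le1P => _ /imsetP[x _ ->] C.
  rewrite inE; apply/idP/eqP => [/imsetP[y _ ->]|->]; last exact: imset_f.
  have [|p0|pT] := lt (porbit t x) _ (porbit_stable t x) isT.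
  - by apply/stableP => z; rewrite perm1.
  - by have := porbit_id t x; rewrite p0 inE.
  - by apply/eqP; rewrite eq_porbit_mem pT inE.
have st1 S : stable 1 S by apply/stableP => z; rewrite perm1.
have [bt|nbt] := boolP (a \in porbit t b).
  have leq1 : ncyc t <= (size l).+1.
    apply: IHl => S _ tS lS; apply: lt => //=.
    by rewrite lS (stable_porbit tS bt) eqxx.
  by rewrite (leq_trans leq1).
have neq_ab : a != b by apply: contraNneq nbt => ->; exact: porbit_id.
have := ncyc_tpermM a b t; rewrite nbt neq_ab /=.
have := ncyc_tpermM a b (tperm a b * t); rewrite mulgA tperm2 mul1g neq_ab.
set t' := tperm a b * t.
have [bt'|nbt'] := boolP (a \in porbit t' b); last by rewrite /=; lia.
suff : ncyc t' <= (size l).+1 by rewrite /=; lia.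
apply: IHl => S _ tS lS.
have abS := stable_porbit tS bt'.
apply: lt => //=; last by rewrite abS eqxx.
rewrite -[t](mulKg (tperm a b)) tpermV; apply: stableM => //.
exact: stable_tperm.
Qed.

(** The genus of the bipartite map encoded by [s] and [t] is nonnegative. By
   induction [s] is reduced to the identity by splitting off fixed points
   [s = tperm x y * s']: either [s' * t] already connects [x] to [y] and the
   number of its cycles changes by one, or [x] and [y] have to be linked by an
   additional pair, but then two cycles of [s' * t] are merged. *)
Lemma genus_linked s t l : linked s t l ->
  ncyc s + ncyc t + ncyc (s * t) <= #|T| + 2 + (size l).*2.
Proof.
have [m le_m] : exists m, #|T| - ncyc s <= m by exists (#|T| - ncyc s).
elim: m s l le_m => [|m IHm] s l le_m lst.
all: have [s1|] := eqVneq s 1;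
  first by move: lst; rewrite s1 mul1g => /linked1_card;
    have := ncyc_le 1; set k := ncyc t; lia.
all: move=> /eqP/permP/eqfunP; rewrite negb_forall => /existsP[x].
all: rewrite perm1 => sx.
all: have xsx : x \in porbit s (s x) by
       rewrite porbit_sym; have := mem_porbit s 1 x; rewrite expg1.
all: have := ncyc_tpermM x (s x) s; rewrite xsx eq_sym sx /=.
all: set y := s x.
all: have [s' def_s'] : exists s' : {perm T}, s' = tperm x y * s by exists (tperm x y * s).
all: have def_s : s = tperm x y * s' by rewrite def_s' mulgA tperm2 mul1g.
all: rewrite -def_s' double0 addn0 => ncs'; have ncTs' := ncyc_le s'.
  by lia.
have le' : #|T| - ncyc s' <= m by lia.
have := ncyc_tpermM x y (s' * t); rewrite mulgA -def_s eq_sym sx.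
have [xy|nxy] /= := boolP (x \in _); last first.
  have lk : linked s' t ((x, y) :: l).
    move=> S s'S tS /= /andP[/eqP xyS lS]; apply: lst => //.
    by rewrite def_s; apply: stableM => //; apply: stable_tperm.
  have := IHm s' _ le' lk; rewrite /=; move: (ncyc (s' * t)) (ncyc (s * t)); lia.
have lk : linked s' t l.
  move=> S s'S tS lS; apply: lst => //; rewrite def_s.
  by apply: stableM => //; apply: stable_tperm; apply: stable_porbit xy; exact: stableM.
have := IHm s' l le' lk; rewrite double0 addn0 ncs'.
by move: #|T| (ncyc (s' * t)) (ncyc (s * t)) => N a b; clear; lia.
Qed.

Lemma genus_le s t : conn setT s t ->
  ncyc s + ncyc t + ncyc (s * t) <= #|T| + 2.
Proof.
move=> /connP st; have /= := @genus_linked s t [::]; rewrite addn0; apply.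
by move=> S sS tS _; apply: st => //; apply: subsetT.
Qed.

End Cycles.

(** * The exponential formula for pairs of permutations *)

Section Restriction.
Variable T : finType.
Implicit Types (s t : {perm T}) (S A B : {set T}) (x y : T).

Lemma sub_stable s S : {in S, forall x, s x \in S} -> stable s S.
Proof.
move=> sS; have imS : s @: S = S.
  apply/eqP; rewrite eqEcard card_imset ?leqnn ?andbT; last exact: perm_inj.
  by apply/subsetP => _ /imsetP[x xS ->]; apply: sS.
by apply/stableP => x; rewrite -{1}imS mem_imset//; apply: perm_inj.
Qed.

Lemma eq_stable s t B S : {in B, s =1 t} -> S \subset B -> stable s S = stable t S.
Proof.
move=> eq_st /subsetP SB; apply/idP/idP => /stableP h; apply: sub_stable => x xS.
  by rewrite -eq_st ?h// SB.
by rewrite eq_st ?h// SB.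
Qed.

Lemma eq_porbit s t B x : {in B, s =1 t} -> stable s B -> x \in B ->
  porbit s x = porbit t x.
Proof.
move=> eq_st /stableP sB xB.
suff eq_i i : (s ^+ i)%g x = (t ^+ i)%g x /\ (s ^+ i)%g x \in B.
  apply/setP => y.
  by apply/porbitP/porbitP => -[i ->]; exists i; have [] := eq_i i.
elim: i => [|i [IHi iB]]; first by rewrite !perm1.
by rewrite !expgSr !permM -IHi sB -eq_st.
Qed.

Lemma eq_conn B s1 t1 s2 t2 : {in B, s1 =1 s2} -> {in B, t1 =1 t2} ->
  conn B s1 t1 = conn B s2 t2.
Proof.
move=> eq_s eq_t; apply: eq_forallb => S.
have [SB|//] := boolP (S \subset B).
by rewrite (eq_stable eq_s SB) (eq_stable eq_t SB).
Qed.

Lemma restr_perm_stable s S : stable s S -> {in S, restr_perm S s =1 s}.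
Proof.
move=> /stableP sS x xS; rewrite restr_permE//.
by apply/astabsP => y; rewrite /= apermE sS.
Qed.

Lemma permM_disjoint A B s t : B \subset A -> perm_on B s -> perm_on (A :\: B) t ->
  {in B, (s * t)%g =1 s} /\ {in A :\: B, (s * t)%g =1 t}.
Proof.
move=> BA sB tAB; split=> x xB; rewrite permM.
  by rewrite (out_perm tAB)// inE perm_closed ?xB.
by rewrite (out_perm sB)//; move: xB; rewrite inE => /andP[].
Qed.

Lemma perm_on_sub A B s : B \subset A -> perm_on B s -> perm_on A s.
Proof. by move=> BA sB; apply: subset_trans BA. Qed.

Lemma perm_on_stable A s : perm_on A s -> stable s A.
Proof. by move=> sA; apply/stableP => x; rewrite perm_closed. Qed.

Lemma stable_permM A B s t : B \subset A -> perm_on B s -> perm_on (A :\: B) t ->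
  stable (s * t) B.
Proof.
move=> BA sB tAB; rewrite (eq_stable (permM_disjoint BA sB tAB).1)//.
exact: perm_on_stable.
Qed.

(** Such an [s] is the product of its restrictions to [B] and [A :\: B]. *)
Lemma sum_perm_on_split (R : nmodType) A B (F : {perm T} -> R) : B \subset A ->
  \sum_(s | perm_on A s && stable s B) F s =
  \sum_(s | perm_on B s) \sum_(t | perm_on (A :\: B) t) F (s * t)%g.
Proof.
move=> BA; rewrite pair_big_dep/=.
rewrite (reindex_onto (fun st : {perm T} * {perm T} => (st.1 * st.2)%g)
  (fun s => (restr_perm B s, restr_perm (A :\: B) s))) /=.
  apply: eq_bigl => -[s t] /=; apply/andP/andP => [[/andP[_ _] /eqP[<- <-]]|[sB tAB]].
    by rewrite !restr_perm_on.
  have [eqB eqAB] := permM_disjoint BA sB tAB.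
  have stB := stable_permM BA sB tAB.
  have stA : perm_on A (s * t)%g.
    by apply: perm_onM; [exact: perm_on_sub sB|apply: perm_on_sub tAB; exact: subsetDl].
  have stAB : stable (s * t) (A :\: B).
    by apply/stableP => x; rewrite !inE (stableP _ _ stB) perm_closed.
  rewrite stA stB; split=> //; apply/eqP; congr (_, _); apply/permP => x.
    have [xB|xB] := boolP (x \in B); first by rewrite restr_perm_stable// eqB.
    by rewrite (out_perm (restr_perm_on _ _) xB) (out_perm sB).
  have [xB|xB] := boolP (x \in A :\: B); first by rewrite restr_perm_stable// eqAB.
  by rewrite (out_perm (restr_perm_on _ _) xB) (out_perm tAB).
move=> s /andP[sA sB]; apply/permP => x.
have sAB : stable s (A :\: B).
  by apply/stableP => z; rewrite !inE (stableP _ _ sB) perm_closed.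
have [eqB eqAB] := permM_disjoint BA (restr_perm_on B s) (restr_perm_on (A :\: B) s).
have [xB|xB] := boolP (x \in B); first by rewrite eqB// restr_perm_stable.
have [xAB|xAB] := boolP (x \in A :\: B); first by rewrite eqAB// restr_perm_stable.
rewrite permM (out_perm (restr_perm_on _ _) xB) (out_perm (restr_perm_on _ _) xAB).
by rewrite (out_perm sA)//; move: xAB; rewrite inE xB.
Qed.

(** The orbit of [x] under the group generated by [s] and [t]. *)
Definition component s t x : {set T} :=
  \bigcap_(S : {set T} | [&& stable s S, stable t S & x \in S]) S.

Lemma component_min s t x S : stable s S -> stable t S -> x \in S -> component s t x \subset S.
Proof. by move=> sS tS xS; apply: bigcap_inf; rewrite sS tS. Qed.

Lemma mem_component s t x : x \in component s t x.
Proof. by apply/bigcapP => S /and3P[]. Qed.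

Lemma stable_component s t x : stable s (component s t x) /\ stable t (component s t x).
Proof.
by split; apply: sub_stable => y /bigcapP yS; apply/bigcapP => S PS;
  have := yS S PS; move: PS => /and3P[/stableP sS /stableP tS _]; rewrite ?sS ?tS.
Qed.

Lemma component_eq s t x B : x \in B ->
  (component s t x == B) = [&& stable s B, stable t B & conn B s t].
Proof.
move=> xB; have [sK tK] := stable_component s t x.
apply/eqP/and3P => [<-|[sB tB /connP cB]].
  split=> //; apply/connP => S SK sS tS.
  have [xS|xS] := boolP (x \in S).
    by right; apply/eqP; rewrite eqEsubset SK component_min.
  left; have sub : component s t x \subset component s t x :\: S.
    apply: component_min; last by rewrite inE xS mem_component.
      by apply/stableP => y; rewrite !inE (stableP _ _ sS) (stableP _ _ sK).
    by apply/stableP => y; rewrite !inE (stableP _ _ tS) (stableP _ _ tK).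
  apply/eqP; rewrite -subset0; apply/subsetP => y yS.
  by have := subsetP sub y (subsetP SK _ yS); rewrite inE yS.
have [K0|//] := cB _ (component_min sB tB xB) sK tK.
by have := mem_component s t x; rewrite K0 inE.
Qed.
End Restriction.

Section ExponentialFormula.
Variables (R : comNzRingType) (T : finType).
Implicit Types (s t : {perm T}) (A B : {set T}) (f g : nat -> R).

Definition wt f A s : R := \prod_(C in porbit s @: A) f #|C|.

Lemma wtM f A B s t : B \subset A -> perm_on B s -> perm_on (A :\: B) t ->
  wt f A (s * t)%g = wt f B s * wt f (A :\: B) t.
Proof.
move=> BA sB tAB; have [eqB eqAB] := permM_disjoint BA sB tAB.
have stB := stable_permM BA sB tAB.
have imB : porbit (s * t) @: B = porbit s @: B.
  by apply: eq_in_imset => x xB; apply: (eq_porbit eqB).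
have imAB : porbit (s * t) @: (A :\: B) = porbit t @: (A :\: B).
  apply: eq_in_imset => x xB; apply: (eq_porbit eqAB) => //.
  by rewrite (eq_stable eqAB)// perm_on_stable.
have AE : A = B :|: (A :\: B) by rewrite -{1}(setID A B) (setIidPr BA).
have dis : [disjoint porbit (s * t) @: B & porbit (s * t) @: (A :\: B)].
  apply/pred0P => C /=; apply/negP => /andP[].
  move=> /imsetP[x xB ->] /imsetP[y]; rewrite inE => /andP[yB _] xy.
  by move: yB; rewrite (stable_porbit stB (x := x)) ?xB// xy porbit_id.
rewrite /wt -imB -imAB -bigU//.
rewrite {1}AE imsetU; apply: eq_bigl => C; exact: in_setU.
Qed.

Definition Wsum f g A : R :=
  \sum_(s | perm_on A s) \sum_(t | perm_on A t) wt f A s * wt g A t.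

Definition Csum f g A : R :=
  \sum_(s | perm_on A s) \sum_(t | perm_on A t)
    (conn A s t)%:R * (wt f A s * wt g A t).

(** Sorting the pairs by the orbit [B] of [x]: a pair of permutations of [A] with
   orbit [B] is a transitive pair on [B] and an arbitrary pair on the rest. *)
Lemma exponential_formula f g A x : x \in A ->
  Wsum f g A = \sum_(B : {set T} | (x \in B) && (B \subset A))
    Csum f g B * Wsum f g (A :\: B).
Proof.
move=> xA; pose good B s t := [&& stable s B, stable t B & conn B s t].
transitivity (\sum_(B : {set T} | (x \in B) && (B \subset A))
  \sum_(s | perm_on A s) \sum_(t | perm_on A t)
     (good B s t)%:R * (wt f A s * wt g A t)).
  rewrite [RHS]exchange_big/=; apply: eq_bigr => s sA.
  rewrite [RHS]exchange_big/=; apply: eq_bigr => t tA.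
  have subA : component s t x \subset A by apply: component_min; rewrite ?perm_on_stable.
  rewrite (bigD1 (component s t x)) ?mem_component//= /good -(@component_eq _ s t x)
    ?mem_component// eqxx mul1r.
  rewrite big1 ?addr0// => B /andP[/andP[xB _] nB].
  by rewrite -(@component_eq _ s t x)// eq_sym (negPf nB) mul0r.
apply: eq_bigr => B /andP[xB BA].
transitivity (\sum_(s | perm_on A s && stable s B)
  \sum_(t | perm_on A t && stable t B)
     (conn B s t)%:R * (wt f A s * wt g A t)).
  rewrite big_mkcondr; apply: eq_bigr => s sA; rewrite /good.
  case: (stable s B); last by rewrite big1// => t _; rewrite mul0r.
  rewrite big_mkcondr; apply: eq_bigr => t tA.
  by case: (stable t B); rewrite // mul0r.
rewrite sum_perm_on_split//.
rewrite /Csum /Wsum big_distrlr/=; apply: eq_bigr => s1 s1B.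
apply: eq_bigr => s2 s2B; rewrite sum_perm_on_split// big_distrlr/=.
apply: eq_bigr => t1 t1B; apply: eq_bigr => t2 t2B.
rewrite (wtM _ BA s1B s2B) (wtM _ BA t1B t2B).
rewrite (eq_conn (permM_disjoint BA s1B s2B).1 (permM_disjoint BA t1B t2B).1).
ring.
Qed.

Lemma sum_subsets (F : nat -> R) A :
  \sum_(B : {set T} | B \subset A) F #|B| = \sum_(k < #|A|.+1) 'C(#|A|, k)%:R * F k.
Proof.
have leA (B : {set T}) : B \subset A -> (#|B| < #|A|.+1)%N by rewrite ltnS; apply: subset_leq_card.
rewrite (partition_big (fun B : {set T} => inord #|B| : 'I_(#|A|.+1)) xpredT)//=.
apply: eq_bigr => k _.
have -> : 'C(#|A|, k)%:R = \sum_(B in [set B : {set T} | B \subset A & #|B| == k]) 1 :> R.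
  by rewrite sumr_const cards_draws.
rewrite mulr_suml.
apply: eq_big => [B|B /andP[BA /eqP <-]].
  rewrite !inE; apply/andP/andP => -[BA /eqP Bk]; split=> //; apply/eqP.
    by rewrite -Bk inordK ?leA.
  by rewrite Bk inord_val.
by rewrite mul1r inordK ?leA.
Qed.

Lemma sum_subsets_pointed (F : nat -> R) A x : x \in A ->
  \sum_(B : {set T} | (x \in B) && (B \subset A)) F #|B| =
  \sum_(k < #|A|) 'C(#|A|.-1, k)%:R * F k.+1.
Proof.
move=> xA; rewrite (cardsD1 x A) xA /= -(sum_subsets (fun k => F k.+1)).
rewrite (reindex_onto (fun B => x |: B) (fun B => B :\ x)) => [|B /andP[xB _]]; last first.
  by rewrite setD1K.
apply: eq_big => [B|B].
  rewrite setU11 /= subUset sub1set xA /= subsetD1; congr (_ && _).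
  by apply/eqP/idP => [<-|xB]; rewrite ?setD11// setU1K.
move=> /andP[_ /eqP eqB]; rewrite cardsU1.
by have -> : x \notin B by rewrite -eqB setD11.
Qed.
End ExponentialFormula.

(** [w n / n`!] and [c n / n`!] are the coefficients of two power series [W]
   and [C] with [W' = C' W], that is, [W = exp C] when [w 0 = 1]. *)
Definition is_log (R : comNzRingType) (w c : nat -> R) : Prop :=
  forall n, w n.+1 = \sum_(k < n.+1) 'C(n, k)%:R * c k.+1 * w (n - k)%N.

Section SetFunctions.
Variables (R : comNzRingType) (T : finType).
Implicit Types (A B : {set T}) (w c : nat -> R) (W C : {set T} -> R).

(** The analogue of [is_log] for functions on finite sets; when they depend only on
   cardinalities both notions agree, which allows one to evaluate either of [W]
   and [C] from the other by induction. *)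
Definition set_log W C : Prop := forall A x, x \in A ->
  W A = \sum_(B : {set T} | (x \in B) && (B \subset A)) C B * W (A :\: B).

Lemma cardsDsub A B : B \subset A -> #|A :\: B| = (#|A| - #|B|)%N.
Proof. by move=> BA; rewrite cardsD (setIidPr BA). Qed.

Lemma sum_log w c A x : x \in A ->
  \sum_(B : {set T} | (x \in B) && (B \subset A)) c #|B| * w #|A :\: B|
  = \sum_(k < #|A|) 'C(#|A|.-1, k)%:R * c k.+1 * w (#|A|.-1 - k)%N.
Proof.
move=> xA; transitivity (\sum_(B : {set T} | (x \in B) && (B \subset A))
    (fun k => c k * w (#|A| - k)%N) #|B|).
  by apply: eq_bigr => B /andP[_ BA]; rewrite cardsDsub.
rewrite (sum_subsets_pointed (fun k => c k * w (#|A| - k)%N) xA).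
apply: eq_bigr => k _.
by rewrite mulrA; congr (_ * w _); lia.
Qed.

Lemma set_log_logE W C w c : w 0 = 1 -> (forall A, W A = w #|A|) -> set_log W C ->
  is_log w c -> forall A, A != set0 -> C A = c #|A|.
Proof.
move=> w0 Ww WC wc A; have [n leA] := ubnP #|A|.
elim: n A leA => // n IHn A; rewrite ltnS => leA /set0Pn[x xA].
have lt0A : (0 < #|A|)%N by rewrite card_gt0; apply/set0Pn; exists x.
have := WC A x xA; rewrite Ww -(prednK lt0A) wc prednK// -(sum_log w c xA).
rewrite (bigD1 A) ?xA//= [in RHS](bigD1 A) ?xA//= setDv cards0 w0 Ww cards0 w0 !mulr1.
rewrite [X in _ + X = _](eq_bigr (fun B => C B * W (A :\: B))).
  by move/addIr => ->.
move=> B /andP[/andP[xB BA] neqB]; rewrite Ww IHn//; last first.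
  by apply/set0Pn; exists x.
by apply: leq_trans leA; apply: proper_card; rewrite properEneq neqB.
Qed.

Lemma set_log_expE W C w c : W set0 = w 0 -> (forall A, A != set0 -> C A = c #|A|) ->
  set_log W C -> is_log w c -> forall A, W A = w #|A|.
Proof.
move=> W0 Cc WC wc A; have [n leA] := ubnP #|A|.
elim: n A leA => // n IHn A; rewrite ltnS => leA.
have [->|/set0Pn[x xA]] := eqVneq A set0; first by rewrite cards0.
have lt0A : (0 < #|A|)%N by rewrite card_gt0; apply/set0Pn; exists x.
rewrite (WC A x xA) -(prednK lt0A) wc prednK// -(sum_log w c xA).
apply: eq_bigr => B /andP[xB BA]; rewrite Cc; last by apply/set0Pn; exists x.
congr (_ * _); apply: IHn; apply: leq_trans leA; apply: proper_card.
rewrite properEneq subsetDl andbT; apply: contraTneq xA => <-.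
by rewrite inE xB.
Qed.
End SetFunctions.

Section PermutationSums.
Variables (R : comNzRingType) (T : finType).
Implicit Types (s t : {perm T}) (A B : {set T}) (f g w c : nat -> R).

Definition Tsum f A : R := \sum_(s : {perm T} | perm_on A s) wt f A s.

Lemma WsumE f g A : Wsum f g A = Tsum f A * Tsum g A.
Proof. by rewrite /Wsum /Tsum big_distrlr. Qed.

Lemma conn_log f g : set_log (@Wsum R T f g) (Csum f g).
Proof. by move=> A x; apply: exponential_formula. Qed.

(** The weight that forces a permutation to be trivial; it specializes statements
   about pairs to single permutations. *)
Definition delta1 (k : nat) : R := (k == 1)%:R.

Lemma wt_delta1 A s : perm_on A s -> wt delta1 A s = (s == 1%g)%:R.
Proof.
move=> sA; have [->|s1] := eqVneq s 1%g.
  rewrite /wt big1// => _ /imsetP[x xA ->].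
  have -> : porbit 1 x = [set x].
    apply/setP => y; rewrite inE; apply/porbitP/eqP => [[i ->]|->].
      by rewrite expg1n perm1.
    by exists 0%N; rewrite perm1.
  by rewrite cards1 /delta1.
have [x sx] : exists x, s x != x.
  apply/existsP; rewrite -negb_forall; apply: contra s1 => /eqfunP s1.
  by apply/eqP/permP => x; rewrite s1 perm1.
have xA : x \in A by apply: contraR sx => xA; rewrite (out_perm sA).
rewrite /wt (bigD1 (porbit s x)) ?imset_f//= /delta1.
case: eqP => [/eqP/cards1P[y pxy]|_]; last by rewrite mul0r.
have := porbit_id s x; have := mem_porbit s 1 x; rewrite expg1 pxy !inE.
by move=> /eqP sxy /eqP xy; rewrite sxy xy eqxx in sx.
Qed.

Lemma sum_delta1 A (F : {perm T} -> R) :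
  \sum_(t | perm_on A t) F t * wt delta1 A t = F 1%g.
Proof.
rewrite (bigD1 1%g) ?perm_on1//= wt_delta1 ?perm_on1// eqxx mulr1.
by rewrite big1 ?addr0// => t /andP[tA t1]; rewrite wt_delta1// (negPf t1) mulr0.
Qed.

Lemma Wsum_delta1 f A : Wsum f delta1 A = Tsum f A.
Proof. by apply: eq_bigr => s sA; rewrite sum_delta1. Qed.

Lemma wt_conn1 f A s : A != set0 -> perm_on A s -> conn A s 1 -> wt f A s = f #|A|.
Proof.
move=> /set0Pn[x xA] sA /connP cA; rewrite /wt.
suff -> : porbit s @: A = [set A] by rewrite big_set1.
have pA y : y \in A -> porbit s y = A.
  move=> yA; have [||p0|//] := cA (porbit s y) _ (porbit_stable s y).
  - apply/subsetP => z zy; rewrite (stable_porbit _ zy)//; exact: perm_on_stable.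
  - by apply/stableP => z; rewrite perm1.
  - by have := porbit_id s y; rewrite p0 inE.
apply/setP => C; rewrite inE; apply/imsetP/eqP => [[y yA ->]|->]; first exact: pA.
by exists x; rewrite ?pA.
Qed.

Definition ncycles A : R := \sum_(s | perm_on A s) (conn A s 1)%:R.

Lemma Csum_delta1 f A : A != set0 -> Csum f delta1 A = f #|A| * ncycles A.
Proof.
move=> A0; rewrite mulr_sumr; apply: eq_bigr => s sA.
under eq_bigr do rewrite mulrA.
rewrite sum_delta1; have [cA|_] := boolP (conn A s 1); last by rewrite mul0r mulr0.
by rewrite wt_conn1// mul1r mulr1.
Qed.

Lemma is_log_fact : is_log (fun n => n`!%:R : R) (fun n => n.-1`!%:R).
Proof.
move=> n; rewrite (eq_bigr (fun=> n`!%:R)) => [|k _].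
  by rewrite sumr_const card_ord factS natrM mulr_natl.
have lekn : (k <= n)%N by rewrite -ltnS.
by rewrite -(bin_fact lekn) -!natrM mulnA.
Qed.

(** The factorials are the exponential of the numbers of long cycles, and they
   determine their logarithm. *)
Lemma ncyclesE A : A != set0 -> ncycles A = #|A|.-1`!%:R.
Proof.
move=> A0; have -> : ncycles A = Csum (fun=> 1) delta1 A.
  by rewrite Csum_delta1// mul1r.
apply: (set_log_logE _ _ (conn_log (fun=> 1) delta1) is_log_fact A0) => // B.
rewrite Wsum_delta1 /Tsum -card_perm -sum1_card natr_sum.
by apply: eq_bigr => s _; rewrite /wt big1.
Qed.

Lemma Tsum0 f : Tsum f set0 = 1.
Proof.
rewrite /Tsum (big_pred1 1%g) => [|s].
  by rewrite /wt big1// => C /imsetP[x]; rewrite inE.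
apply/idP/eqP => [/(perm_on_id)|->]; last exact: perm_on1.
by rewrite cards0; apply.
Qed.

(** The exponential formula for a single permutation: the transitive ones are the
   [n.-1`!] long cycles. *)
Lemma TsumE f w A : w 0 = 1 -> is_log w (fun n => f n * n.-1`!%:R) ->
  Tsum f A = w #|A|.
Proof.
move=> w0 wf; rewrite -Wsum_delta1.
apply: (set_log_expE _ _ (conn_log f delta1) wf).
  by rewrite Wsum_delta1 Tsum0 w0.
by move=> B B0; rewrite Csum_delta1// ncyclesE.
Qed.

Lemma CsumE f g wf wg c A : wf 0 = 1 -> wg 0 = 1 ->
  is_log wf (fun n => f n * n.-1`!%:R) -> is_log wg (fun n => g n * n.-1`!%:R) ->
  is_log (fun n => wf n * wg n) c -> A != set0 -> Csum f g A = c #|A|.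
Proof.
move=> wf0 wg0 lf lg lc; apply: (set_log_logE _ _ (conn_log f g) lc).
  by rewrite wf0 wg0 mulr1.
by move=> B; rewrite WsumE (TsumE _ wf0 lf) (TsumE _ wg0 lg).
Qed.
End PermutationSums.

(** * The exponential formula for set partitions *)

Section PartitionLog.
Variables (R : comNzRingType) (T : finType) (e : nat -> R).
Implicit Types (A B D : {set T}) (P Q : {set {set T}}).

(** The Moebius function of the lattice of partitions between a partition with [k]
   blocks and the one-block partition. *)
Definition mobius_coef (k : nat) : R := (-1) ^+ k.-1 * k.-1`!%:R.

Definition part_log A : R := \sum_(P | partition P A) mobius_coef #|P| * \prod_(V in P) e #|V|.

Lemma partition_cons A D (F : {set {set T}} -> R) : D != set0 -> D \subset A ->
  \sum_(P | partition P (A :\: D)) F (D |: P) =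
  \sum_(Q | partition Q A && (D \in Q)) F Q.
Proof.
move=> D0 DA; rewrite [RHS](reindex_onto (fun P => D |: P) (fun Q => Q :\ D)); last first.
  by move=> Q /andP[_ DQ]; rewrite setD1K.
apply: eq_bigl => P; apply/idP/andP => [pP|[/andP[pQ DQ] /eqP <-]]; last first.
  exact: partitionD1.
have nDP : D \notin P.
  apply/negP => DP; have /subsetP sub := partitionS pP DP.
  by have /set0Pn[y yD] := D0; have := sub y yD; rewrite inE yD.
have dis : [disjoint D & A :\: D].
  by rewrite -setI_eq0; apply/eqP/setP => y; rewrite !inE; case: (y \in D).
have pU := partitionU1 pP D0 dis.
have UDA : D :|: (A :\: D) = A by rewrite -{1}(setIidPr DA) setID.
by rewrite -{1}UDA pU setU11 setU1K.
Qed.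

Lemma card_blocks_avoiding A Q x : partition Q A -> x \in A ->
  #|[set D in Q | x \notin D]| = #|Q|.-1.
Proof.
move=> pQ xA; have cQ := cover_partition pQ; have tQ := partition_trivIset pQ.
have xcQ : x \in cover Q by rewrite cQ.
rewrite (cardsD1 (pblock Q x) Q) pblock_mem//=; apply: eq_card => D; rewrite !inE andbC.
have [DQ|] := boolP (D \in Q); rewrite ?andbF// !andbT.
congr (~~ _); apply/idP/eqP => [xD|->]; last by rewrite mem_pblock.
by rewrite (def_pblock tQ DQ xD).
Qed.

(** In the sum over [B] and over partitions of [B], adjoining [A :\: B] as a new
   block gives the partitions [Q] of [A] with a marked block avoiding [x]; the
   [#|Q|.-1] marks of [Q] turn the coefficient of [#|Q|.-1] blocks into the
   opposite of that of [#|Q|] blocks, and everything cancels but [Q = {A}]. *)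
Lemma part_log_set_log : e 0 = 1 -> set_log (fun A => e #|A|) part_log.
Proof.
move=> e0 A x xA; have A0 : A != set0 by apply/set0Pn; exists x.
rewrite (bigD1 A) ?xA//= setDv cards0 e0 mulr1.
have -> : \sum_(B : {set T} | (x \in B) && (B \subset A) && (B != A))
     part_log B * e #|A :\: B| =
   \sum_(D : {set T} | [&& x \notin D, D != set0 & D \subset A])
     \sum_(Q | partition Q A && (D \in Q)) mobius_coef #|Q|.-1 * \prod_(V in Q) e #|V|.
  rewrite (reindex_onto (fun D => A :\: D) (fun B => A :\: B)) /=; last first.
    by move=> B /andP[/andP[_ BA] _]; rewrite setDDr setDv set0U (setIidPr BA).
  have DDA D : D \subset A -> A :\: (A :\: D) = D.
    by move=> DA; rewrite setDDr setDv set0U (setIidPr DA).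
  apply: eq_big => [D|D /andP[/andP[/andP[xD _] nD] /eqP eqD]].
    rewrite !inE xA subsetDl !andbT /=; apply/andP/and3P.
      move=> [/andP[xD nD] /eqP eqD]; rewrite xD -[in D \subset A]eqD subsetDl; split=> //.
      by apply: contraNneq nD => ->; rewrite setD0.
    move=> [xD nD DA]; rewrite xD DDA//; split=> //.
    by apply: contraNneq nD => eqA; rewrite -(DDA _ DA) eqA setDv.
  rewrite eqD; have DA : D \subset A by rewrite -eqD subsetDl.
  have D0 : D != set0 by apply: contraNneq nD => ->; rewrite setD0.
  rewrite -(partition_cons _ D0 DA) mulr_suml; apply: eq_bigr => P pP.
  have nDP : D \notin P.
    apply/negP => DP; have /subsetP sub := partitionS pP DP.
    by have /set0Pn[y yD] := D0; have := sub y yD; rewrite inE yD.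
  by rewrite cardsU1 nDP /= big_setU1//= mulrAC -mulrA.
rewrite (exchange_big_dep (fun Q => partition Q A))/=; last by move=> D Q _ /andP[].
rewrite -big_split/= (bigD1 [set A]) /=; last first.
  apply/and3P; split; rewrite ?inE /cover ?big_set1 ?eqxx 1?eq_sym//.
  by apply/trivIsetP => B C /set1P-> /set1P->; rewrite eqxx.
rewrite [X in _ = _ + X]big1 => [|Q /andP[pQ nQ]].
  rewrite addr0 cards1 big_set1 /mobius_coef expr0 mul1r big1 ?addr0 ?mul1r// => D.
  by rewrite inE => /andP[/and3P[xD _ _] /andP[_ /eqP DA]]; rewrite DA xA in xD.
transitivity (mobius_coef #|Q| * \prod_(V in Q) e #|V| +
   #|Q|.-1%:R * (mobius_coef #|Q|.-1 * \prod_(V in Q) e #|V|)).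
  congr (_ + _); rewrite (eq_bigl (fun D => D \in [set D in Q | x \notin D])) => [|D].
    by rewrite sumr_const (card_blocks_avoiding pQ xA) mulr_natl.
  rewrite !inE pQ /= andbC; have [DQ|//] := boolP (D \in Q).
  by rewrite (partition_neq0 pQ DQ) (partitionS pQ DQ) !andbT.
have : (1 < #|Q|)%N.
  have : (0 < #|Q|)%N.
    rewrite card_gt0; apply: contraNneq A0 => Q0.
    by rewrite -(cover_partition pQ) Q0 /cover big_set0.
  rewrite leq_eqVlt => /orP[|//]; rewrite eq_sym => /cards1P[C QC].
  by case/eqP: nQ; rewrite QC -(cover_partition pQ) QC /cover big_set1.
case: #|Q| => [|[|k]]// _; rewrite /mobius_coef /= exprS factS natrM; ring.
Qed.
End PartitionLog.

(** * Non-crossing partitions and geodesic permutations *)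

Section OneCycle.
Local Open Scope nat_scope.
Local Open Scope group_scope.
Variable T : finType.
Implicit Types (s t u : {perm T}) (S : {set T}) (x y : T).

Lemma ncyc_le1P s : reflect (forall S, stable s S -> S = set0 \/ S = setT) (ncyc s <= 1).
Proof.
apply: (iffP idP) => [/card_le1_eqP s1 S sS|s1].
  have [->|/set0Pn[x xS]] := eqVneq S set0; [by left|right].
  apply/setP => y; rewrite inE (@stable_porbit _ s S x y sS) ?xS//.
  by rewrite -eq_porbit_mem; apply/eqP; apply: s1; apply: imset_f.
apply/card_le1_eqP => _ _ /imsetP[x _ ->] /imsetP[y _ ->].
apply/eqP; rewrite eq_porbit_mem.
have [p0|->] := s1 _ (porbit_stable s x); last by rewrite inE.
by have := porbit_id s x; rewrite p0 inE.
Qed.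

(** The genus bound for the pair [s], [s^-1 * u], which is transitive because [u]
   is a single cycle. *)
Lemma geodesic_le s u : ncyc u <= 1 -> ncyc s + ncyc (s^-1 * u) <= #|T|.+1.
Proof.
move=> u1; have [x _|T0] := pickP (@predT T); last first.
  have nc0 (v : {perm T}) : ncyc v <= 0 by rewrite -(eq_card0 T0); exact: ncyc_le.
  by have := nc0 s; have := nc0 (s^-1 * u); lia.
have u0 : 0 < ncyc u.
  by rewrite card_gt0; apply/set0Pn; exists (porbit u x); apply: imset_f.
have : conn setT s (s^-1 * u).
  apply/connP => S _ sS uS; move/ncyc_le1P: u1; apply.
  by rewrite -[u](mulKVg s); apply: stableM.
by move=> /genus_le; rewrite mulKVg; move: u1 u0; clear; lia.
Qed.

Lemma porbits_eq s t : porbits s = porbits t -> forall x, porbit s x = porbit t x.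
Proof.
move=> eq_st x; have : porbit s x \in porbits t by rewrite -eq_st imset_f.
by move=> /imsetP[y _ def_sx]; rewrite def_sx; apply/eqP;
  rewrite eq_porbit_mem porbit_sym -def_sx porbit_id.
Qed.

(** Each block is a union of cycles, so that there are at least as many cycles as
   blocks, and in case of equality each block is one cycle. *)
Lemma porbits_partition s (P : {set {set T}}) : partition P setT ->
  (forall V, V \in P -> stable s V) -> ncyc s <= #|P| -> porbits s = P.
Proof.
move=> pP sP lePs; have cP x : x \in cover P by rewrite (cover_partition pP) inE.
have tP := partition_trivIset pP.
pose F (C : {set T}) := \bigcup_(x in C) pblock P x.
have sub x y : y \in porbit s x -> pblock P y = pblock P x.
  move=> yx; apply: def_pblock => //; first exact: pblock_mem.
  by rewrite (stable_porbit (sP _ (pblock_mem (cP x))) yx) mem_pblock.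
have Fp x : F (porbit s x) = pblock P x.
  apply/setP => z; apply/bigcupP/idP => [[y yx]|zx]; first by rewrite (sub x y).
  by exists x => //; exact: porbit_id.
have PF V : V \in P -> exists2 x, x \in V & V = pblock P x.
  move=> VP; have /set0Pn[x xV] := partition_neq0 pP VP.
  by exists x => //; rewrite (def_pblock tP VP xV).
have FP : F @: porbits s = P.
  apply/setP => V; apply/imsetP/idP => [[_ /imsetP[x _ ->] ->]|/PF[x xV ->]].
    by rewrite Fp pblock_mem.
  by exists (porbit s x); [exact: imset_f|rewrite Fp].
have injF : {in porbits s &, injective F}.
  apply/imset_injP; rewrite eqn_leq leq_imset_card /= FP; exact: lePs.
have pE x : porbit s x = pblock P x.
  apply/setP => y; apply/idP/idP => [/sub <-|yx]; first by rewrite mem_pblock.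
  rewrite -eq_porbit_mem; apply/eqP; apply: injF; rewrite ?imset_f// !Fp.
  exact: def_pblock (pblock_mem _) yx.
rewrite -FP; apply/setP => V; apply/imsetP/imsetP => -[].
  by move=> x _ ->; exists (porbit s x); rewrite ?imset_f// Fp.
by move=> _ /imsetP[x _ ->] ->; exists x; rewrite // Fp pE.
Qed.
End OneCycle.

Section NonCrossing.
Local Open Scope nat_scope.
Local Open Scope group_scope.
Variable n : nat.
Local Notation T := 'I_n.+1.
Implicit Types (s t : {perm T}) (S U V W : {set T}) (P : {set {set T}}) (a b c d i j x y : T).

Definition rot1 : {perm T} := perm (@ordS_inj n.+1).

Lemma rot1E i : rot1 i = (if i < n then i.+1 else 0) :> nat.
Proof.
rewrite permE /= ; case: ltnP => [lt_in|le_ni]; first by rewrite modn_small.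
have -> : nat_of_ord i = n by have := ltn_ord i; lia.
by rewrite modnn.
Qed.

Lemma rot1_ncyc : ncyc rot1 <= 1.
Proof.
apply/ncyc_le1P => S /stableP rS.
have S0 k (lt_k : k < n.+1) : (Ordinal lt_k \in S) = (ord0 \in S).
  elim: k lt_k => [|k IHk] lt_k; first by congr (_ \in S); apply: val_inj.
  have lt_k' : k < n.+1 by lia.
  rewrite -(IHk lt_k') -(rS (Ordinal lt_k')); congr (_ \in S); apply: val_inj.
  by rewrite /= rot1E /=; case: ifP => //; lia.
have [S0T|S0F] := boolP (ord0 \in S); [right|left]; apply/setP => -[k lt_k].
  by rewrite S0 S0T inE.
by rewrite S0 inE; apply/negbTE.
Qed.

Lemma ncyc_gt0 s : 0 < ncyc s.
Proof. by rewrite card_gt0; apply/set0Pn; exists (porbit s ord0); apply: imset_f. Qed.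

Lemma rot1_ncycE : ncyc rot1 = 1%N.
Proof. by apply/eqP; rewrite eqn_leq rot1_ncyc ncyc_gt0. Qed.

Lemma mem_porbit_rot1 x y : x \in porbit rot1 y.
Proof.
have /ncyc_le1P/(_ _ (porbit_stable rot1 y))[p0|->] := rot1_ncyc; last by rewrite inE.
by have := porbit_id rot1 y; rewrite p0 inE.
Qed.

(** Equality in [geodesic_le]: [s] lies on a geodesic from the identity to the
   rotation in the Cayley graph generated by the transpositions. *)
Definition geodesic s : bool := ncyc s + ncyc (s^-1 * rot1) == n.+2.

(** Transpositions splitting two cycles of [s] but altogether leaving [rot1] a
   single cycle would violate the genus bound. *)
Lemma geodesic_split s t : geodesic s -> ncyc (t * rot1) <= 1 -> ncyc (t * s) <= (ncyc s).+1.
Proof.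
move=> /eqP gs /(geodesic_le (t * s)).
have -> : (t * s)^-1 * (t * rot1) = s^-1 * rot1 by rewrite invMg -mulgA mulKg.
by move: gs; rewrite card_ord; clear; lia.
Qed.

(** The transposition of [a] and [c] cuts the rotation into two cycles that are
   cyclic intervals; this is how cyclic order enters. *)
Lemma interval_stable a c : a < c -> stable (tperm a c * rot1) [set x : T | a < x <= c].
Proof.
move=> lt_ac; apply: sub_stable => x; rewrite !inE permM => /andP[ax xc].
have := ltn_ord c; case: tpermP => [xa|_|_ /eqP xc'].
- by rewrite xa ltnn in ax.
- by rewrite rot1E; case: ifP; lia.
have {}xc' : nat_of_ord x <> c by move=> /val_inj /eqP; rewrite (negPf xc').
by rewrite rot1E; case: ifP; lia.
Qed.

Lemma ncyc_tperm_split s x y : x != y -> x \in porbit s y -> ncyc (tperm x y * s) = (ncyc s).+1.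
Proof. by move=> nxy xy; have := ncyc_tpermM x y s; rewrite xy nxy addn0 addn1. Qed.

Lemma ncyc_tperm_merge s x y : x \notin porbit s y -> (ncyc (tperm x y * s)).+1 = ncyc s.
Proof.
move=> nxy; have := ncyc_tpermM x y s; rewrite nxy.
have -> : x != y by apply: contraNneq nxy => ->; exact: porbit_id.
by rewrite /= addn1 addn2 => -[].
Qed.

Lemma rot1_tperm2 a c b d : a != c -> b \notin porbit (tperm a c * rot1) d ->
  ncyc (tperm b d * tperm a c * rot1) <= 1.
Proof.
move=> nac nbd; rewrite -mulgA -ltnS ncyc_tperm_merge//.
by rewrite ncyc_tperm_split ?mem_porbit_rot1// rot1_ncycE.
Qed.

Lemma notin_porbit_stable s S x y : stable s S -> (x \in S) != (y \in S) -> x \notin porbit s y.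
Proof. by move=> sS; apply: contraNN => xy; rewrite (stable_porbit sS xy). Qed.

(** If the cycles through [a], [c] and through [b], [d] were distinct and crossed,
   then multiplying by [tperm a c] and [tperm b d] would split both cycles of
   [s], but would split and merge again the rotation. *)
Lemma geodesic_nc s a b c d : geodesic s -> a < b -> b < c -> c < d ->
  c \in porbit s a -> d \in porbit s b -> b \in porbit s a.
Proof.
move=> gs ab bc cd ca db; apply/negPn/negP => nba.
have nac : a != c by apply/eqP => ac; rewrite ac in ab; lia.
have nbd : b != d by apply/eqP => bd; rewrite bd in bc; lia.
(* [b] lies in the interval from [a] to [c], and [d] does not. *)
have nbdp : b \notin porbit (tperm a c * rot1) d.
  apply: notin_porbit_stable (interval_stable (ltn_trans ab bc)) _.
  by rewrite !inE; move: ab bc cd; clear; lia.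
have := geodesic_split gs (rot1_tperm2 nac nbdp).
rewrite -mulgA ncyc_tperm_split// => [|].
  by rewrite ncyc_tperm_split ?ltnn// porbit_sym.
rewrite porbit_sym.
have -> : porbit (tperm a c * s) b = porbit s b; last by [].
apply/esym; apply: (@eq_porbit _ _ _ (porbit s b)); rewrite ?porbit_stable ?porbit_id//.
move=> x xb; rewrite permM tpermD//; apply: contraNneq nba => ax.
  by rewrite porbit_sym ax.
have : porbit s b = porbit s a; last by rewrite -eq_porbit_mem => ->.
by apply/eqP; rewrite eq_porbit_mem; move: xb; rewrite -ax porbit_sym -!eq_porbit_mem => /eqP->;
   rewrite eq_porbit_mem.
Qed.

(** The strict cyclic order. *)
Definition between a b c : bool := [|| a < b < c, c < a < b | b < c < a].

(** A point [b] of the cycle of [a] that is skipped by [s] gives the transpositions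
   of [a], [s a] and of [a], [b], which split the cycle of [s] into three but
   leave the rotation a single cycle. *)
Lemma geodesic_next s a b : geodesic s -> b \in porbit s a -> ~~ between a b (s a).
Proof.
move=> gs ba; apply/negP => btw; set c := s a in btw.
have nac : a != c by apply/eqP => ac; rewrite -ac in btw; move: btw; rewrite /between; clear; lia.
have nab : a != b by apply/eqP => ac; rewrite -ac in btw; move: btw; rewrite /between; clear; lia.
have nbc : b != c by apply/eqP => ac; rewrite -ac in btw; move: btw; rewrite /between; clear; lia.
have nabp : a \notin porbit (tperm a c * rot1) b.
  have [lt_ac|le_ca] := ltnP a c.
    apply: notin_porbit_stable (interval_stable lt_ac) _.
    by rewrite !inE; move: btw lt_ac; rewrite /between; clear; lia.
  have lt_ca : c < a by rewrite ltn_neqAle le_ca andbT eq_sym.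
  rewrite tpermC; apply: notin_porbit_stable (interval_stable lt_ca) _.
  by rewrite !inE; move: btw lt_ca; rewrite /between; clear; lia.
have ca : c \in porbit s a by have := mem_porbit s 1 a; rewrite expg1.
have := geodesic_split gs (rot1_tperm2 nac nabp).
rewrite -mulgA ncyc_tperm_split// => [|].
  by rewrite ncyc_tperm_split ?ltnn// porbit_sym.
set s' := tperm a c * s; rewrite porbit_sym.
have s'c : s' c = c by rewrite permM tpermR.
(* [c] is a fixed point of [s'], and [b] stays in the cycle of [a]. *)
suff /stable_porbit/(_ ba) : stable s (c |: porbit s' a).
  by rewrite !inE porbit_id orbT (negPf nbc).
have -> : s = tperm a c * s' by rewrite mulgA tperm2 mul1g.
apply: stableM; first by apply: stable_tperm; rewrite !inE eqxx porbit_id orbT.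
apply: sub_stable => x; rewrite !inE => /orP[/eqP->|xa]; first by rewrite s'c eqxx.
by rewrite (stableP _ _ (porbit_stable s' a)) xa orbT.
Qed.

(** By [geodesic_next], [s a] is the element of the cycle of [a] that follows [a]
   cyclically, so the cycles as sets determine [s]. *)
Lemma geodesic_inj : {in geodesic &, injective (@porbits T)}.
Proof.
move=> s t gs gt /porbits_eq eq_st; apply/permP => a.
have fixp (u v : {perm T}) : porbit u a = porbit v a -> u a = a -> v a = a.
  move=> eq_uv ua; have : v a \in porbit u a.
    by rewrite eq_uv; have := mem_porbit v 1 a; rewrite expg1.
  move=> /porbitP[k ->]; elim: k => [|k IHk]; first by rewrite perm1.
  by rewrite expgSr permM IHk.
have [sa|nsa] := eqVneq (s a) a; first by rewrite sa (fixp s t).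
have [ta|nta] := eqVneq (t a) a; first by rewrite ta (fixp t s).
have := geodesic_next gs (b := t a) (a := a); rewrite eq_st.
have := geodesic_next gt (b := s a) (a := a); rewrite -eq_st.
have := mem_porbit s 1 a; have := mem_porbit t 1 a; rewrite !expg1 -eq_st => -> -> /(_ isT) b1 /(_ isT) b2.
apply: val_inj => /=; move: b1 b2; rewrite /between.
by move: nsa nta; rewrite -!(inj_eq val_inj) /=; clear; lia.
Qed.
(** Non-crossing in a form without strict alternation, which can be chained: no
   block separates two elements of another block. *)
Lemma noncrossingP P :
  reflect (forall V U x y a b, V \in P -> U \in P -> V != U -> x \in V -> y \in V ->
             a \in U -> b \in U -> a < x < b -> a <= y <= b)
          (noncrossing P).
Proof.
apply: (iffP idP) => [ncP V U x y a b VP UP nVU xV yV aU bU /andP[ax xb]|ncP].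
  have nc V1 U1 : V1 \in P -> U1 \in P -> V1 != U1 -> forall i j k l,
      i \in V1 -> j \in U1 -> k \in V1 -> l \in U1 -> ~~ [&& i < j, j < k & k < l].
    move=> V1P U1P nVU1 i j k l iV jU kV lU.
    move/forall_inP: ncP => /(_ _ V1P)/forall_inP/(_ _ U1P); rewrite nVU1 /=.
    apply: contraNN => ijkl; apply/exists_inP; exists i => //.
    by apply/exists_inP; exists j => //; apply/exists_inP; exists k => //;
      apply/exists_inP; exists l.
  have := nc V U VP UP nVU y a x b yV aU xV bU.
  have := nc U V UP VP _ a x b y aU xV bU yV; rewrite eq_sym nVU => /(_ isT).
  by move: ax xb; clear; lia.
apply/forall_inP => V VP; apply/forall_inP => W WP; apply/implyP => nVW.
apply/negP => /exists_inP[a aV /exists_inP[b bW /exists_inP[c cV /exists_inP[d dW]]]].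
have := ncP V W c a b d VP WP nVW cV aV bW dW; clear; lia.
Qed.

Lemma geodesic_NC s : geodesic s -> porbits s \in NC n.+1.
Proof.
move=> gs; rewrite !inE porbits_partition_setT /=.
apply/forall_inP => _ /imsetP[x _ ->]; apply/forall_inP => _ /imsetP[y _ ->].
apply/implyP; apply: contraNN.
move=> /exists_inP[a ax /exists_inP[b yb /exists_inP[c cx /exists_inP[d dy]]]].
move=> /and3P[ab bc cd]; move: ax yb cx dy.
rewrite -!eq_porbit_mem => /eqP <- /eqP <-; rewrite !eq_porbit_mem => ca db.
by rewrite porbit_sym; apply: geodesic_nc gs ab bc cd ca db.
Qed.

Lemma rot1_geodesic : geodesic rot1.
Proof.
rewrite /geodesic rot1_ncycE mulVg /ncyc.
suff -> : porbits (1 : {perm T}) = [set [set x] | x in T].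
  by rewrite card_imset ?card_ord//; exact: set1_inj.
apply: eq_imset => x; apply/setP => y; rewrite inE; apply/porbitP/eqP => [[k ->]|->].
  by rewrite expg1n perm1.
by exists 0%N; rewrite perm1.
Qed.

(** A geodesic permutation moves a point to the next one of its cycle, so two
   jumps from [V] to [W] within one cycle would make [V] and [W] alternate. *)
Lemma merged_cross s P V W x y : geodesic s -> noncrossing P -> V \in P -> W \in P ->
  [disjoint V & W] -> x \in V -> y \in V -> y \in porbit s x ->
  s x \in W -> s y \in W -> x = y.
Proof.
move=> gs /noncrossingP ncP VP WP dVW xV yV yx sxW syW; apply/eqP/negPn/negP => nxy.
have nVW : V != W.
  by apply/eqP => eqVW; move: dVW; rewrite eqVW -setI_eq0 setIid => /eqP W0;
    rewrite W0 inE in sxW.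
have nVWe a b : a \in V -> b \in W -> nat_of_ord a <> b.
  move=> aV bW /val_inj ab; move/pred0P: dVW => /(_ a) /=.
  by rewrite aV ab bW.
have sx_x : s x \in porbit s x by have := mem_porbit s 1 x; rewrite expg1.
have sy_y : s y \in porbit s y by have := mem_porbit s 1 y; rewrite expg1.
have pxy : porbit s y = porbit s x by apply/eqP; rewrite eq_porbit_mem.
have xy : x \in porbit s y by rewrite pxy porbit_id.
have sy_x : s y \in porbit s x by rewrite -pxy.
have sx_y : s x \in porbit s y by rewrite pxy.
have := geodesic_next gs yx; have := geodesic_next gs sy_x.
have := geodesic_next gs xy; have := geodesic_next gs sx_y.
have := nVWe _ _ xV sxW; have := nVWe _ _ xV syW.
have := nVWe _ _ yV sxW; have := nVWe _ _ yV syW.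
have : nat_of_ord x <> y by move=> /val_inj /eqP; rewrite (negPf nxy).
have : nat_of_ord (s x) <> s y by move=> /val_inj/perm_inj /eqP; rewrite (negPf nxy).
have nWV : W != V by rewrite eq_sym.
have := ncP V W _ _ _ _ VP WP nVW xV yV sxW syW.
have := ncP V W _ _ _ _ VP WP nVW xV yV syW sxW.
have := ncP V W _ _ _ _ VP WP nVW yV xV sxW syW.
have := ncP V W _ _ _ _ VP WP nVW yV xV syW sxW.
have := ncP W V _ _ _ _ WP VP nWV sxW syW xV yV.
have := ncP W V _ _ _ _ WP VP nWV sxW syW yV xV.
rewrite /between; clear; move: (nat_of_ord (s x)) (nat_of_ord (s y)); lia.
Qed.

(** As [i] and [rot1 i] are cyclically adjacent, no other block separates them; so
   a block crossing [V :|: W] would cross [V] or [W]. *)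
Lemma merge_noncrossing P V W i : partition P setT -> noncrossing P ->
  V \in P -> W \in P -> V != W -> i \in V -> rot1 i \in W ->
  let Q := (V :|: W) |: (P :\ V :\ W) in
  [/\ partition Q setT, noncrossing Q & #|P| = #|Q|.+1].
Proof.
move=> pP /noncrossingP ncP VP WP nVW iV riW Q.
have tP := partition_trivIset pP; have tIP := trivIsetP tP.
have WPV : W \in P :\ V by rewrite !inE eq_sym nVW.
have pPVW := partitionD1 (partitionD1 pP VP) WPV.
have VW0 : V :|: W != set0 by apply/set0Pn; exists i; rewrite inE iV.
have dis : [disjoint V :|: W & setT :\: V :\: W].
  by rewrite -setI_eq0; apply/eqP/setP => x; rewrite !inE; case: (x \in V); case: (x \in W).
have nVWP : V :|: W \notin P :\ V :\ W.
  apply/negP => /(partitionS pPVW)/subsetP/(_ i).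
  by rewrite !inE iV /= andbF => /(_ isT).
split.
- have -> : [set: T] = (V :|: W) :|: (setT :\: V :\: W).
    by apply/setP => x; rewrite !inE; case: (x \in V); case: (x \in W).
  exact: partitionU1.
- have adj U a b : U \in P -> U != V -> U != W -> a \in U -> b \in U ->
      (a <= i <= b -> a < rot1 i < b) /\ (a <= rot1 i <= b -> a < i < b).
    move=> UP nUV nUW aU bU.
    have nU j X : X \in P -> U != X -> j \in X -> j \notin U.
      move=> XP nUX jX; have := tIP _ _ XP UP; rewrite eq_sym => /(_ nUX)/pred0P/(_ j) /=.
      by rewrite jX /= => ->.
    have := nU _ _ VP nUV iV; have := nU _ _ WP nUW riW => niU nrU.
    have ne x y : x \in U -> y \notin U -> nat_of_ord x <> y.
      by move=> xU yU /val_inj xy; rewrite -xy xU in yU.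
    have := ne _ _ aU niU; have := ne _ _ aU nrU; have := ne _ _ bU niU; have := ne _ _ bU nrU.
    have := ltn_ord a; have := ltn_ord b; have := ltn_ord i.
    by rewrite rot1E; clear; case: ifP; lia.
  have key U x y a b : U \in P -> U != V -> U != W -> x \in V :|: W -> y \in V :|: W ->
      a \in U -> b \in U -> a < x < b -> a <= y <= b.
    move=> UP nUV nUW xVW yVW aU bU axb.
    have nVU : V != U by rewrite eq_sym.
    have nWU : W != U by rewrite eq_sym.
    have [adj1 adj2] := adj _ _ _ UP nUV nUW aU bU.
    have CV u v (uV : u \in V) (vV : v \in V) := ncP V U u v a b VP UP nVU uV vV aU bU.
    have CW u v (uW : u \in W) (vW : v \in W) := ncP W U u v a b WP UP nWU uW vW aU bU.
    case/setUP: xVW => xX; case/setUP: yVW => yX.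
    + exact: (CV _ _ xX yX axb).
    + exact: (CW _ _ riW yX) (adj1 (CV _ _ xX iV axb)).
    + exact: (CV _ _ iV yX) (adj2 (CW _ _ xX riW axb)).
    + exact: (CW _ _ xX yX axb).
  apply/noncrossingP => V1 U1 x y a b; rewrite !inE.
  case/orP => [/eqP->|/and3P[nV1W nV1V V1P]]; case/orP => [/eqP->|/and3P[nU1W nU1V U1P]].
  + by rewrite eqxx.
  + by move=> _ xV1 yV1; apply: key.
  + move=> _ xV yV aU bU axb.
    have k1 := key _ _ _ _ _ V1P nV1V nV1W aU bU yV xV.
    have k2 := key _ _ _ _ _ V1P nV1V nV1W bU aU xV yV.
    move: axb k1 k2; clear.
    move: (nat_of_ord a) (nat_of_ord b) (nat_of_ord x) (nat_of_ord y) => a' b' x' y'; lia.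
  + exact: ncP.
- by rewrite (cardsD1 V P) VP (cardsD1 W (P :\ V)) WPV /Q cardsU1 nVWP !add1n.
Qed.

Lemma rot1_crossing P : partition P setT -> 1 < #|P| ->
  exists i, pblock P i != pblock P (rot1 i).
Proof.
move=> pP ltP; apply/existsP; rewrite -[X in is_true X]negbK; apply/negP.
rewrite negb_exists => /forallP allP.
have /set0Pn[V VP] : P != set0 by rewrite -card_gt0; lia.
have /set0Pn[i iV] := partition_neq0 pP VP.
have cP x : x \in cover P by rewrite (cover_partition pP) inE.
have tP := partition_trivIset pP.
have sV : stable rot1 V.
  apply: sub_stable => x xV.
  have /= := allP x; rewrite negbK (def_pblock tP VP xV) => /eqP ->.
  by rewrite mem_pblock.
have [V0|VT] : V = set0 \/ V = setT by apply/ncyc_le1P: sV; exact: rot1_ncyc.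
  by rewrite V0 inE in iV.
move: ltP; rewrite ltnNge => /negP; apply; apply/card_le1_eqP => U1 U2.
suff all U : U \in P -> U = V by move=> /all -> /all ->.
move=> UP; have /set0Pn[x xU] := partition_neq0 pP UP.
by rewrite -(def_pblock tP UP xU); apply: def_pblock; rewrite ?VT ?inE// -VT.
Qed.

(** Induction on the number of blocks: merge the blocks [V] and [W] of cyclically
   adjacent points [i] and [rot1 i], take the geodesic permutation [s] of the
   coarser partition, and cut the cycle [V :|: W] again by a transposition. This
   adds a cycle to [s] and, as [s i = rot1 i], takes one from [s^-1 * rot1]. *)
Lemma NC_geodesic P : P \in NC n.+1 -> exists2 s, geodesic s & porbits s = P.
Proof.
have [k leP] := ubnP #|P|; elim: k P leP => // k IHk P.
rewrite ltnS => leP; rewrite !inE => /andP[pP ncP].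
have cP x : x \in cover P by rewrite (cover_partition pP) inE.
have tP := partition_trivIset pP; have tIP := trivIsetP tP.
have [leP1|ltP] := leqP #|P| 1.
  exists rot1; first exact: rot1_geodesic.
  apply: porbits_partition => // [V VP|].
    have /set0Pn[x xV] := partition_neq0 pP VP.
    suff -> : V = setT by apply/stableP => y; rewrite !inE.
    apply/setP => y; rewrite inE -(def_pblock tP VP xV).
    have -> : pblock P x = pblock P y.
      by move/card_le1_eqP: leP1; apply; apply: pblock_mem.
    by rewrite mem_pblock cP.
  apply: leq_trans rot1_ncyc _; rewrite card_gt0; apply/set0Pn.
  by exists (pblock P ord0); apply: pblock_mem.
have [i nVW] := rot1_crossing pP ltP.
set V := pblock P i in nVW; set W := pblock P (rot1 i) in nVW.
have VP : V \in P by apply: pblock_mem.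
have WP : W \in P by apply: pblock_mem.
have iV : i \in V by rewrite mem_pblock cP.
have riW : rot1 i \in W by rewrite mem_pblock cP.
have dVW := tIP _ _ VP WP nVW.
have notVW x : x \in V -> x \notin W.
  by move=> xV; have := pred0P dVW x; rewrite /= xV /= => ->.
have [pQ ncQ cQ] := merge_noncrossing pP ncP VP WP nVW iV riW.
set Q := _ |: _ in pQ ncQ cQ.
have [||s gs sQ] := IHk Q; first by rewrite -ltnS -cQ.
  by rewrite !inE pQ ncQ.
have sporb U : U \in Q -> stable s U.
  by rewrite -sQ => /imsetP[x _ ->]; exact: porbit_stable.
have VWQ : V :|: W \in porbits s by rewrite sQ !inE eqxx.
have sVW : stable s (V :|: W) by apply: sporb; rewrite -sQ.
have same x y : x \in V :|: W -> y \in V :|: W -> y \in porbit s x.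
  by case/imsetP: VWQ => z _ ->; rewrite -!eq_porbit_mem => /eqP-> /eqP->.
have s_i : s i = rot1 i.
  have ri_i : rot1 i \in porbit s i by apply: same; rewrite inE ?iV ?riW ?orbT.
  have nri : rot1 i != i by apply: contraTneq riW => ->; exact: notVW.
  have nsi : s i != i.
    apply: contraNneq nri => si; move: ri_i => /porbitP[k' ->]; apply/eqP.
    by elim: k' => [|k' IHk']; rewrite ?perm1// expgSr permM IHk'.
  have := geodesic_next gs ri_i; apply: contraNeq => nsr.
  move: nri nsi nsr; rewrite /between -!(inj_eq val_inj) /= rot1E.
  have := ltn_ord i; have := ltn_ord (s i); clear.
  by case: ifP; move: (nat_of_ord (s i)); lia.
(* The last point of [W] on the way from [rot1 i] back to [i]. *)
have [j jW sjW] : exists2 j, j \in W & s j \notin W.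
  apply/exists_inP; rewrite -[X in is_true X]negbK; apply/negP.
  rewrite negb_exists_in => /forall_inP allW.
  have sW : stable s W by apply: sub_stable => x /allW; rewrite negbK.
  have : i \in W by rewrite -(stableP _ _ sW) s_i.
  by apply/negP; exact: notVW.
have sjV : s j \in V.
  have : s j \in V :|: W by rewrite (stableP _ _ sVW) inE jW orbT.
  by rewrite inE (negPf sjW) orbF.
have nij : i != j by apply: contraTneq jW => <-; exact: notVW.
set t := tperm i j * s.
have dWV : [disjoint W & V] by rewrite disjoint_sym.
have tV : stable t V.
  apply: sub_stable => x xV; rewrite permM.
  have nxj : x != j by apply: contraTneq jW => <-; exact: notVW.
  have [->|nxi] := eqVneq x i; first by rewrite tpermL.
  rewrite tpermD 1?eq_sym//.
  have : s x \in V :|: W by rewrite (stableP _ _ sVW) inE xV.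
  rewrite inE => /orP[//|sxW]; case/eqP: nxi.
  apply: (merged_cross gs ncP VP WP dVW) => //; rewrite ?s_i//.
  by apply: same; rewrite inE ?xV ?iV.
have tW : stable t W.
  apply: sub_stable => x xW; rewrite permM.
  have nxi : x != i by apply: contraTneq xW => ->; exact: notVW.
  have [->|nxj] := eqVneq x j; first by rewrite tpermR s_i.
  rewrite tpermD 1?eq_sym//.
  have : s x \in V :|: W by rewrite (stableP _ _ sVW) inE xW orbT.
  rewrite inE => /orP[sxV|//]; case/eqP: nxj.
  apply: (merged_cross gs ncP WP VP dWV) => //.
  by apply: same; rewrite inE ?xW ?jW orbT.
have cs : ncyc s = #|Q| by rewrite /ncyc sQ.
have ct : ncyc t = (ncyc s).+1.
  by apply: ncyc_tperm_split => //; apply: same; rewrite inE ?iV ?jW ?orbT.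
exists t; last first.
  apply: porbits_partition => // [U UP|]; last by rewrite ct cs cQ.
  have [->//|nUV] := eqVneq U V; have [->//|nUW] := eqVneq U W.
  apply: stableM; last by apply: sporb; rewrite !inE nUV nUW UP orbT.
  have nU x X : X \in P -> U != X -> x \in X -> x \notin U.
    move=> XP nUX xX; have := pred0P (tIP _ _ UP XP nUX) x.
    by rewrite /= xX andbT => ->.
  apply: stable_tperm.
  by rewrite (negPf (nU _ _ VP nUV iV)) (negPf (nU _ _ WP nUW jW)).
(* [rot1 * s^-1] fixes [i], so the transposition merges two of its cycles. *)
have fixi : i \notin porbit (rot1 * s^-1) j.
  apply: contra nij; rewrite porbit_sym => /porbitP[k' ->].
  elim: k' => [|k' IHk']; first by rewrite perm1.
  by rewrite expgSr !permM -(eqP IHk') -s_i permK.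
have eq_t : ncyc (t^-1 * rot1) = ncyc (tperm i j * (rot1 * s^-1)).
  by rewrite /t invMg tpermV -mulgA [LHS]ncycMC -mulgA.
have eq_s : ncyc (rot1 * s^-1) = ncyc (s^-1 * rot1) by apply: ncycMC.
move: gs; rewrite /geodesic ct eq_t -eq_s -(ncyc_tperm_merge fixi).
by rewrite addSnnS.
Qed.

Lemma NC_porbits : NC n.+1 = [set porbits s | s : {perm T} & geodesic s].
Proof.
apply/setP => P; apply/idP/imsetP => [/NC_geodesic[s gs <-]|[s gs ->]].
  by exists s; rewrite ?inE.
by apply: geodesic_NC; move: gs; rewrite inE.
Qed.

Lemma sum_NC (R : comNzRingType) (u : nat -> R) :
  (\sum_(P in NC n.+1) part_prod u P = \sum_(s : {perm T} | geodesic s) perm_prod u s)%R.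
Proof.
rewrite NC_porbits big_imset => [|s t]; last first.
  by rewrite !inE; apply: geodesic_inj.
by apply: eq_bigl => s; rewrite inE.
Qed.
End NonCrossing.

(** * Conjugates of permutations with one or two cycles *)

Lemma conj_permP (T : finType) (r s g : {perm T}) :
  reflect (forall i, s (g i) = g (r i)) (r ^ g == s)%g.
Proof.
apply: (iffP eqP) => [<- i|sg]; first by rewrite permJ.
by apply/permP => i; rewrite -(permKV g i) permJ sg.
Qed.

(** Both sides sum [G] over all conjugates of [r], counted with multiplicity. *)
Lemma sum_conj (R : pzSemiRingType) (T : finType) (r : {perm T}) (G : {perm T} -> R) :
  (forall s g, G (s ^ g)%g = G s) ->
  \sum_(s : {perm T}) #|[set g | (r ^ g == s)%g]|%:R * G s = (#|T|`!)%:R * G r.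
Proof.
move=> GJ; transitivity (\sum_(g : {perm T}) G (r ^ g)%g); last first.
  under eq_bigr do rewrite GJ.
  rewrite sumr_const mulr_natl -cardsT -card_perm; congr (_ *+ _).
  by apply: eq_card => g; apply/esym/idP/subsetP => x _; rewrite inE.
rewrite [RHS](partition_big (fun g => r ^ g)%g xpredT)//; apply: eq_bigr => s _.
rewrite (eq_bigr (fun=> G s)) => [|g /andP[_ /eqP <-]//].
by rewrite sumr_const mulr_natl; congr (_ *+ _); apply: eq_card => g; rewrite inE.
Qed.

(** Each cycle contributes 1. *)
Lemma sum_inv_card_porbit (R : numFieldType) (T : finType) (s : {perm T}) :
  \sum_(x : T) (#|porbit s x|%:R^-1 : R) = (ncyc s)%:R.
Proof.
rewrite (eq_bigl (fun x => x \in [set: T])) => [|x]; last by rewrite inE.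
rewrite (set_partition_big _ (porbits_partition_setT s)).
rewrite /ncyc -sum1_card natr_sum; apply: eq_bigr => _ /imsetP[x _ ->].
rewrite (eq_bigr (fun=> #|porbit s x|%:R^-1)) => [|y]; last first.
  by rewrite -eq_porbit_mem => /eqP ->.
by rewrite sumr_const -[LHS]mulr_natl divff// pnatr_eq0 card_porbit_neq0.
Qed.

Lemma iter_mod_porbit (T : finType) (s : {perm T}) x k l :
  (k < #|porbit s x|)%N -> (l < #|porbit s x|)%N ->
  (s ^+ k)%g x = (s ^+ l)%g x -> k = l.
Proof.
move=> ltk ltl; rewrite !permX.
have /uniqP/(_ k l) := uniq_traject_porbit s x; rewrite !inE size_traject.
by move=> /(_ x ltk ltl); rewrite !nth_traject.
Qed.

Lemma expg_porbit (T : finType) (s : {perm T}) x : (s ^+ #|porbit s x|)%g x = x.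
Proof. by rewrite permX iter_porbit. Qed.

Section ConjugatesOfRotations.
Variable n : nat.
Local Notation T := 'I_n.+1.
Implicit Types (s g : {perm T}) (x y i : T) (t : nat).

Lemma rot1X k : (k <= n)%N -> (rot1 n ^+ k)%g ord0 = k :> nat.
Proof.
elim: k => [|k IHk] lekn; first by rewrite perm1.
by rewrite expgSr permM rot1E IHk ?(ltnW lekn)// lekn.
Qed.

(** A [g] conjugating the rotation to the cycle [s] is determined by the image of
   0, which is arbitrary. *)
Lemma card_conj_rot1 s : ncyc s = 1%N -> #|[set g | rot1 n ^ g == s]%g| = n.+1.
Proof.
move=> s1; pose f g := g ord0 : T.
have allp x y : x \in porbit s y.
  have := ncyc_le1P s; rewrite s1 => /elimT/(_ isT)/(_ _ (porbit_stable s y))[p0|->].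
    by have := porbit_id s y; rewrite p0 inE.
  by rewrite inE.
have cp x : #|porbit s x| = n.+1.
  by rewrite -[RHS]card_ord; apply: eq_card => y; rewrite allp.
rewrite -[RHS]card_ord -[RHS]cardsT.
have <- : f @: [set g | rot1 n ^ g == s]%g = setT.
  apply/setP => x; rewrite [RHS]inE; apply/imsetP.
  have inj_h : injective (fun i : T => (s ^+ i)%g x).
    move=> i j /iter_mod_porbit ij; apply: val_inj; apply: ij; rewrite cp; exact: ltn_ord.
  exists (perm inj_h); last by rewrite /f permE perm1.
  have hE i : perm inj_h i = (s ^+ i)%g x by rewrite permE.
  rewrite inE; apply/conj_permP => i; rewrite !hE rot1E.
  rewrite -permM -expgSr; case: ltnP => // leni.
  have -> : nat_of_ord i = n by have := ltn_ord i; lia.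
  by have := expg_porbit s x; rewrite (cp x) perm1.
rewrite card_in_imset// => g h; rewrite !inE => /conj_permP gs /conj_permP hs fgh.
apply/permP => i; have -> : i = (rot1 n ^+ i)%g ord0.
  by apply: val_inj; rewrite /= rot1X// -ltnS.
elim: (nat_of_ord i) => [|k IHk]; first by rewrite perm1.
by rewrite expgSr permM -gs -hs IHk.
Qed.

Lemma sum_one_cycle (R : numFieldType) (G : {perm T} -> R) :
  (forall s g, G (s ^ g)%g = G s) ->
  \sum_(s : {perm T} | ncyc s == 1%N) G s = (n`!)%:R * G (rot1 n).
Proof.
move=> GJ; apply: (mulfI (x := n.+1%:R)); first by rewrite pnatr_eq0.
rewrite mulrA -natrM -factS -[n.+1 in RHS]card_ord -(sum_conj _ GJ).
rewrite mulr_sumr big_mkcond; apply: eq_bigr => s _.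
case: eqP => [s1|ns1]; first by rewrite card_conj_rot1.
rewrite (_ : [set g | _] = finset.set0) ?cards0 ?mul0r//.
apply/setP => g; rewrite !inE; apply/negP => /eqP sg; case: ns1.
by rewrite -sg ncycJ rot1_ncycE.
Qed.

(** Splitting the rotation between [t.-1] and [t] gives the permutation
   (0, ..., t-1)(t, ..., n). *)
Definition rot2 t : {perm T} := (tperm (inord t.-1) ord_max * rot1 n)%g.

Lemma rot2E t i : (0 < t <= n)%N ->
  rot2 t i = (if (i < t)%N then if (i.+1 < t)%N then i.+1 else 0%N
              else if (i < n)%N then i.+1 else t) :> nat.
Proof.
move=> /andP[t0 len]; rewrite permM.
have val_t : (inord t.-1 : T) = t.-1 :> nat by rewrite inordK; lia.
have ltin := ltn_ord i.
have [->|/eqP ni] := eqVneq i (inord t.-1).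
  by rewrite tpermL rot1E val_t /= ltnn; do !case: ifP; lia.
have [->|/eqP nm] := eqVneq i ord_max.
  by rewrite tpermR rot1E val_t /= ltnn; do !case: ifP; lia.
have nit : nat_of_ord i <> t.-1 by rewrite -val_t => /val_inj.
have nin : nat_of_ord i <> n by move=> /(@val_inj _ _ _ i ord_max).
rewrite tpermD ?rot1E; [|by apply/eqP => ii; case: ni|by apply/eqP => ii; case: nm].
by do !case: ifP; lia.
Qed.

Lemma rot2X t k : (0 < t <= n)%N -> (k < t)%N -> (rot2 t ^+ k)%g ord0 = k :> nat.
Proof.
move=> tn; elim: k => [|k IHk] ltkt; first by rewrite perm1.
by rewrite expgSr permM rot2E// IHk ?(ltnW ltkt)// ltkt.
Qed.

Lemma rot2X' t k : (0 < t <= n)%N -> (t + k <= n)%N ->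
  (rot2 t ^+ k)%g (inord t) = (t + k)%N :> nat.
Proof.
move=> tn; elim: k => [|k IHk] le_tk; first by rewrite perm1 inordK; lia.
by rewrite expgSr permM rot2E// IHk; [do !case: ifP; lia|lia].
Qed.

Lemma porbit_rot2 t : (0 < t <= n)%N -> porbit (rot2 t) ord0 = [set i : T | (i < t)%N].
Proof.
move=> tn; apply/setP => i; rewrite inE; apply/idP/idP => [i0|lt_it]; last first.
  by apply/porbitP; exists i; apply: val_inj; rewrite /= rot2X.
have st : stable (rot2 t) [set i : T | (i < t)%N].
  by apply: sub_stable => j; rewrite !inE => ltj; rewrite rot2E// ltj; case: ifP; lia.
by have := stable_porbit st i0; rewrite !inE => ->; case/andP: tn.
Qed.

Lemma ncyc_rot2 t : (0 < t <= n)%N -> ncyc (rot2 t) = 2.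
Proof.
move=> tn; rewrite ncyc_tperm_split ?mem_porbit_rot1 ?rot1_ncycE//.
by apply/eqP => /(congr1 (@nat_of_ord _)) /=; rewrite inordK; lia.
Qed.

Lemma two_cycles s x y : ncyc s = 2 -> y \notin porbit s x ->
  (#|porbit s x| + #|porbit s y| = n.+1)%N.
Proof.
move=> s2 yx; rewrite -[RHS]card_ord -[RHS]cardsT (card_partition (porbits_partition_setT s)).
have nxy : porbit s x != porbit s y by rewrite eq_sym eq_porbit_mem.
have -> : porbits s = [set porbit s x; porbit s y].
  apply/esym/eqP; rewrite eqEcard subUset !finset.sub1set !imset_f//= cards2 nxy.
  by rewrite -[X in (X <= _)%N]/(ncyc s) s2.
by rewrite big_setU1 ?inE// big_set1.
Qed.

Lemma card_initial t : (t <= n.+1)%N -> #|[set i : T | (i < t)%N]| = t.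
Proof.
move=> le_t; have inj_w : injective (widen_ord le_t) by move=> i j [/val_inj].
rewrite -[RHS]card_ord -[RHS](card_imset _ inj_w); apply: eq_card => i; rewrite inE.
apply/idP/imsetP => [lt_it|[j _ ->]]; last exact: (ltn_ord j).
by exists (Ordinal lt_it) => //; apply: val_inj.
Qed.

Definition bases s t : {set T * T} := 
  [set xy | (#|porbit s xy.1| == t) && (xy.2 \notin porbit s xy.1)].

(** A [g] conjugating [rot2 t] to [s] is determined by the images of 0 and [t],
   which can be any points of two different cycles of [s], the first one of
   length [t]. *)
Lemma card_conj_rot2 s t : (0 < t <= n)%N -> ncyc s = 2 ->
  #|[set g | rot2 t ^ g == s]%g| = #|bases s t|.
Proof.
move=> tn s2; pose f g := (g ord0, g (inord t)) : T * T.
have val_t : (inord t : T) = t :> nat by rewrite inordK; lia.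
have <- : f @: [set g | rot2 t ^ g == s]%g = bases s t.
  apply/setP => -[x y]; apply/imsetP/idP => [[g + [-> ->]]|].
    rewrite !inE => /eqP <- /=; rewrite porbitJ porbit_rot2// mem_imset ?inE; last exact: perm_inj.
    rewrite val_t ltnn andbT card_imset; last exact: perm_inj.
    by rewrite card_initial//; lia.
  rewrite inE /= => /andP[/eqP px yx].
  have := two_cycles s2 yx; rewrite px => py'.
  have py : #|porbit s y| = (n.+1 - t)%N by lia.
  (* Follow the two cycles of [s] from the base points [x] and [y]. *)
  pose h (i : T) := if (i < t)%N then (s ^+ i)%g x else (s ^+ (i - t))%g y.
  have nxy k l : (s ^+ k)%g x <> (s ^+ l)%g y.
    move=> kl; move: yx; rewrite -eq_porbit_mem -(porbit_perm s l y) -kl porbit_perm eqxx //.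
  have inj_h : injective h.
    move=> i j; rewrite /h; have li := ltn_ord i; have lj := ltn_ord j.
    case: (ltnP i t) => it; case: (ltnP j t) => jt.
    - by move=> /iter_mod_porbit ij; apply: val_inj; apply: ij; rewrite px.
    - by move=> /nxy.
    - by move=> /esym/nxy.
    - move=> /iter_mod_porbit; rewrite py => ij; apply: val_inj => /=.
      by have := ij; lia.
  exists (perm inj_h); last first.
    rewrite /f !permE /h /= val_t ltnn subnn !perm1.
    by have -> : (0 < t)%N by lia.
  have hE i : perm inj_h i = h i by rewrite permE.
  rewrite inE; apply/conj_permP => i; rewrite !hE /h rot2E//.
  have li := ltn_ord i; case: (ltnP i t) => it.
    rewrite -permM -expgSr; case: (ltnP i.+1 t) => it'; first by rewrite it'.
    have -> : (0 < t)%N by lia.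
    have -> : i.+1 = t by lia.
    by have := expg_porbit s x; rewrite px perm1.
  rewrite -permM -expgSr; case: (ltnP i n) => lin.
    have -> : (i.+1 < t)%N = false by lia.
    by rewrite subSn.
  rewrite ltnn subnn perm1 -subSn//.
  have -> : (i.+1 - t)%N = #|porbit s y| by rewrite py; lia.
  exact: expg_porbit.
rewrite card_in_imset// => g h; rewrite !inE => /conj_permP gs /conj_permP hs [fgh0 fght].
apply/permP => i; have [lt_it|le_ti] := ltnP i t.
  have -> : i = (rot2 t ^+ i)%g ord0 by apply: val_inj; rewrite /= rot2X.
  elim: (nat_of_ord i) => [|k IHk]; first by rewrite perm1.
  by rewrite expgSr permM -gs -hs IHk.
have -> : i = (rot2 t ^+ (i - t))%g (inord t).
  by apply: val_inj; rewrite /= rot2X' ?subnKC// -ltnS.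
elim: (i - t)%N => [|k IHk]; first by rewrite perm1.
by rewrite expgSr permM -gs -hs IHk.
Qed.

Lemma sum_bases (R : numFieldType) s : ncyc s = 2 ->
  \sum_(1 <= t < n.+1) #|bases s t|%:R / (t%:R * (n.+1 - t)%:R) = 2 :> R.
Proof.
move=> s2; have := sum_inv_card_porbit R s; rewrite s2 => <-.
have px x : (0 < #|porbit s x| <= n)%N.
  rewrite lt0n card_porbit_neq0 /= -ltnS ltn_neqAle -[X in (_ <= X)%N]card_ord max_card andbT.
  apply/eqP => pxn; suff : (ncyc s <= 1)%N by rewrite s2.
  apply/card_le1_eqP => _ _ /imsetP[y _ ->] /imsetP[z _ ->].
  have px : porbit s x = setT by apply/eqP; rewrite eqEcard subsetT cardsT card_ord pxn leqnn.
  have pE u : porbit s u = porbit s x by apply/eqP; rewrite eq_porbit_mem px inE.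
  by rewrite !pE.
transitivity (\sum_(1 <= t < n.+1) \sum_(x : T | #|porbit s x| == t) (t%:R^-1 : R)).
  rewrite big_nat [RHS]big_nat; apply: eq_bigr => t tn.
  have nt0 : (n.+1 - t)%:R != 0 :> R by rewrite pnatr_eq0; lia.
  have -> : #|bases s t|%:R = \sum_(x : T | #|porbit s x| == t) (n.+1 - t)%:R :> R.
    transitivity (\sum_(x : T | #|porbit s x| == t) \sum_(y : T | y \notin porbit s x) (1 : R)).
      by rewrite pair_big_dep sumr_const; congr (_ *+ _); apply: eq_card => xy; rewrite inE.
    apply: eq_bigr => x /eqP <-; rewrite sumr_const; congr (_ *+ _).
    rewrite -[X in (X - _)%N]card_ord -(cardsC (porbit s x)) addKn.
    by apply: eq_card => y; rewrite inE.
  by rewrite mulr_suml; apply: eq_bigr => x _; rewrite [t%:R * _]mulrC invfM mulrA divff// mul1r.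
rewrite (exchange_big_dep xpredT)//=; apply: eq_bigr => x _.
rewrite big_mkcond (bigD1_seq #|porbit s x|) ?iota_uniq//=; last first.
  by rewrite mem_index_iota ltnS px.
rewrite eqxx big1 ?addr0// => t /negbTE nt; by rewrite eq_sym nt.
Qed.

(** Each [s] with two cycles is counted twice, as either cycle can play the role of
   the first cycle of [rot2 t]. *)
Lemma sum_two_cycles (R : numFieldType) (G : {perm T} -> R) :
  (forall s g, G (s ^ g)%g = G s) ->
  \sum_(s : {perm T} | ncyc s == 2) G s =
  (n.+1)`!%:R / 2 * \sum_(1 <= t < n.+1) G (rot2 t) / (t%:R * (n.+1 - t)%:R).
Proof.
move=> GJ; apply: (mulfI (x := 2)); first by rewrite pnatr_eq0.
rewrite mulrA mulrCA divff ?pnatr_eq0// mulr1 [RHS]mulr_sumr.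
transitivity (\sum_(1 <= t < n.+1) \sum_(s : {perm T} | ncyc s == 2)
    #|bases s t|%:R / (t%:R * (n.+1 - t)%:R) * G s).
  rewrite exchange_big /= mulr_sumr; apply: eq_bigr => s /eqP s2.
  by rewrite -mulr_suml sum_bases.
rewrite big_nat [RHS]big_nat; apply: eq_bigr => t tn.
have := sum_conj (rot2 t) GJ; rewrite card_ord mulrA => <-.
rewrite mulr_suml big_mkcond; apply: eq_bigr => s _.
case: eqP => [s2|ns2]; first by rewrite card_conj_rot2// mulrAC.
rewrite (_ : [set g | _] = finset.set0) ?cards0 ?mul0r//.
apply/setP => g; rewrite !inE; apply/negP => /eqP sg; case: ns2.
by rewrite -sg ncycJ ncyc_rot2.
Qed.
End ConjugatesOfRotations.

(** * Planar and annular pairs of permutations *)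

Lemma stableJ (T : finType) (s g : {perm T}) (S : {set T}) :
  stable (s ^ g)%g (g @: S) = stable s S.
Proof.
have mg x : (g x \in g @: S) = (x \in S) by rewrite mem_imset//; exact: perm_inj.
apply/stableP/stableP => sS x; first by rewrite -mg -permJ sS mg.
by rewrite -(permKV g x) permJ !mg sS.
Qed.

Lemma connJ (T : finType) (s t g : {perm T}) :
  conn setT (s ^ g)%g (t ^ g)%g = conn setT s t.
Proof.
suff imp (s' t' g' : {perm T}) : conn setT s' t' -> conn setT (s' ^ g')%g (t' ^ g')%g.
  apply/idP/idP => [/(imp _ _ (g^-1)%g)|]; last exact: imp.
  by rewrite -!conjgM mulgV !conjg1.
move=> /connP st; apply/connP => S _ sS tS.
have gS : g' @: (g'^-1%g @: S) = S.
  rewrite -imset_comp (eq_imset (g := id)) ?imset_id// => x /=; exact: permKV.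
have [||e|e] := st (g'^-1%g @: S) (subsetT _).
- by rewrite -(stableJ _ g') gS.
- by rewrite -(stableJ _ g') gS.
- by left; rewrite -gS e imset0.
- right; rewrite -gS e; apply/setP => x; rewrite inE; apply/imsetP.
  by exists (g'^-1%g x); rewrite ?permKV.
Qed.

Lemma atrans_conn n (s t : 'S_n.+1) :
  [transitive <<[set s; t]>>%g, on [set: 'I_n.+1] | 'P] = conn setT s t.
Proof.
have st_gen S : (stable s S && stable t S) = (<<[set s; t]>>%g \subset 'N(S | 'P)%g).
  have stN (u : 'S_n.+1) : stable u S = (u \in 'N(S | 'P)%g).
    by apply/stableP/astabsP => h x; have := h x; rewrite /= apermE.
  by rewrite gen_subG subUset !finset.sub1set !stN.
apply/idP/connP => [tr S _ sS tS|st].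
  have : <<[set s; t]>>%g \subset 'N(S | 'P)%g by rewrite -st_gen sS.
  move=> /subsetP NS; have [->|/set0Pn[x xS]] := eqVneq S set0; [by left|right].
  apply/setP => y; rewrite inE.
  have := atransP tr x (in_setT x) => /setP/(_ y).
  by rewrite inE => /orbitP[g gG <-]; rewrite (astabsP (NS _ gG)).
have orbx : orbit 'P <<[set s; t]>>%g ord0 = setT.
  have : <<[set s; t]>>%g \subset 'N(orbit 'P <<[set s; t]>>%g ord0 | 'P)%g.
    by apply: acts_orbit; rewrite subsetT.
  rewrite -st_gen => /andP[sO tO].
  have [O0|//] := st _ (subsetT _) sO tO.
  by have := orbit_refl 'P <<[set s; t]>>%G ord0; rewrite O0 inE.
by apply/imsetP; exists ord0; rewrite ?inE ?orbx.
Qed.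

Section TransitivePairs.
Variables (R : numFieldType) (u : nat -> R).

(** A class function of the product [r] of the pair [s], [s^-1 * r], so that its
   sum over [r] can be computed by counting conjugates. *)
Definition pair_sum n (m : nat) (r : 'S_n) : R :=
  \sum_(s | conn setT s r && (ncyc s + ncyc (s^-1 * r)%g == m)%N) perm_prod u s.

Lemma perm_prodJ n (s g : 'S_n) : perm_prod u (s ^ g)%g = perm_prod u s.
Proof.
rewrite /perm_prod porbitsJ big_imset => [|A B _ _]; last exact/imset_inj/perm_inj.
by apply: eq_bigr => C _; rewrite card_imset//; apply: perm_inj.
Qed.

Lemma pair_sumJ n m (r g : 'S_n) : pair_sum m (r ^ g)%g = pair_sum m r.
Proof.
rewrite /pair_sum (reindex_inj (@conjg_inj _ g)) /=; apply: eq_big => s.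
  by rewrite connJ -conjVg -conjMg !ncycJ.
by rewrite perm_prodJ.
Qed.

Lemma connMl (T : finType) (s r : {perm T}) : conn setT s (s^-1 * r)%g = conn setT s r.
Proof.
apply/connP/connP => h S _ sS rS; apply: h => //.
  by apply: stableM => //; rewrite stableV.
by rewrite -[r](mulKVg s); apply: stableM.
Qed.

Lemma sum_pairs n m :
  \sum_(s : 'S_n) \sum_(t : 'S_n | conn setT s t && (ncyc s + ncyc t == m)%N) perm_prod u s
  = \sum_(r : 'S_n) pair_sum m r.
Proof.
rewrite /pair_sum [RHS](exchange_big_dep xpredT)//=; apply: eq_bigr => s _.
rewrite (reindex_inj (mulgI s^-1%g)) /=; apply: eq_bigl => r.
by rewrite connMl.
Qed.

Lemma pair_sum_eq0 n m (r : 'S_n) :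
  (forall s, conn setT s r -> (ncyc s + ncyc (s^-1 * r)%g == m)%N = false) -> pair_sum m r = 0.
Proof. by move=> h; apply: big_pred0 => s; case: (boolP (conn _ _ _)) => [/h|]. Qed.

Lemma genus_le_quot (T : finType) (s r : {perm T}) : conn setT s r ->
  (ncyc s + ncyc (s^-1 * r)%g + ncyc r <= #|T| + 2)%N.
Proof. by rewrite -connMl => /genus_le; rewrite mulKVg. Qed.

(** By the genus inequality the product of such a pair is a single cycle, and for
   the rotation the first factors are the geodesic permutations. *)
Lemma sum_pairs_planar n :
  \sum_(s : 'S_n.+1) \sum_(t : 'S_n.+1 | conn setT s t && (ncyc s + ncyc t == n.+2)%N)
     perm_prod u s
  = n`!%:R * \sum_(P in NC n.+1) part_prod u P.
Proof.
rewrite sum_pairs (bigID (fun r => ncyc r == 1%N)) /= [X in _ + X]big1 => [|r nr1].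
  rewrite addr0 (sum_one_cycle (pair_sumJ n.+2)) sum_NC; congr (_ * _).
  apply: eq_bigl => s; rewrite /geodesic; case: connP => //= -[] S _ _ rS.
  by have /ncyc_le1P := rot1_ncyc n; apply.
apply: pair_sum_eq0 => s /genus_le_quot; rewrite card_ord.
have := ncyc_gt0 r; move: nr1; move: (ncyc s) (ncyc (_ * _)) (ncyc r) => a b c; lia.
Qed.

Lemma ncyc_even n (s r : 'S_n) : (ncyc s + ncyc (s^-1 * r)%g == n)%N -> ~~ odd (ncyc r).
Proof.
move=> /eqP e; have := odd_permM s (s^-1 * r)%g; rewrite mulKVg /odd_perm card_ord.
have {e} : odd (ncyc s) (+) odd (ncyc (s^-1 * r)%g) = odd n by rewrite -oddD e.
rewrite /ncyc.
by case: (odd #|porbits s|) (odd #|porbits (s^-1 * r)%g|) (odd n) (odd #|porbits r|) => -[] [] [].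
Qed.

Lemma gamma_rot2 t s : (0 < s)%N -> gamma t.+1 s = rot2 (t + s) t.+1.
Proof.
move=> s0; apply/permP => i; apply: val_inj.
have tn : (0 < t.+1 <= t + s)%N by lia.
apply: etrans (esym (@rot2E (t + s) t.+1 i tn)).
rewrite permE /gamma_fun; have [N defN] : exists N, N = (t + s)%N by exists (t + s)%N.
transitivity (if (i < t.+1)%N then if (i.+1 < t.+1)%N then i.+1 else 0%N
              else if (i < N)%N then i.+1 else t.+1); last by rewrite defN.
case: (fintype.splitP i) => j ij; rewrite /= ij.
  case: (ltnP j.+1 t.+1) => [lt|le]; first by rewrite modn_small.
  have -> : j.+1 = t.+1 by have := ltn_ord j; lia.
  by rewrite modnn.
have js := ltn_ord j; case: (ltnP (t.+1 + j) N) => [lt|le].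
  by rewrite modn_small; lia.
have -> : j.+1 = s by lia.
by rewrite modnn addn0.
Qed.

Lemma sum_SNC t s : (0 < s)%N ->
  \sum_(sigma in SNC t.+1 s) perm_prod u sigma = pair_sum (t + s).+1 (rot2 (t + s) t.+1).
Proof.
move=> s0; apply: eq_bigl => sigma; rewrite inE gamma_rot2//.
by rewrite (atrans_conn sigma).
Qed.

(** By the genus inequality and parity the product of such a pair has exactly two
   cycles; for [rot2 s] the first factors form [SNC s (n.+1 - s)]. *)
Lemma sum_pairs_annular n :
  \sum_(s : 'S_n.+1) \sum_(t : 'S_n.+1 | conn setT s t && (ncyc s + ncyc t == n.+1)%N)
     perm_prod u s
  = n.+1`!%:R / 2 * \sum_(1 <= s < n.+1) \sum_(sigma in SNC s (n.+1 - s))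
            perm_prod u sigma / (s%:R * (n.+1 - s)%:R).
Proof.
rewrite sum_pairs (bigID (fun r => ncyc r == 2)) /= [X in _ + X]big1 => [|r nr2].
  rewrite addr0 (sum_two_cycles (pair_sumJ n.+1)); congr (_ * _).
  apply: eq_big_nat => -[//|t] /= tn; rewrite -mulr_suml; congr (_ / _).
  rewrite sum_SNC ?subn_gt0//.
  suff: forall m, m = (n - t)%N ->
      pair_sum n.+1 (rot2 n t.+1) = pair_sum (t + m).+1 (rot2 (t + m) t.+1).
    by apply.
  by move=> m ->; have -> : (t + (n - t) = n)%N by rewrite subnKC// ltnW.
apply: pair_sum_eq0 => s /genus_le_quot; rewrite card_ord => le.
apply/negP => e; have := ncyc_even e; move/eqP: e le nr2.
have := ncyc_gt0 r; move: (ncyc s) (ncyc (_ * _)) (ncyc r) => a b c; lia.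
Qed.
End TransitivePairs.

(** * Logarithms of exponential generating functions *)

Section LogExists.
Variable R : comNzRingType.
Implicit Types (w c : nat -> R).

(** The recursion expressed by [is_log], solved for the last coefficient of [c];
   [k] bounds the depth of the recursion. *)
Fixpoint log_rec w (k n : nat) : R :=
  if k is k'.+1 then
    w n - \sum_(j < n.-1) 'C(n.-1, j)%:R * log_rec w k' j.+1 * w (n.-1 - j)%N
  else 0.

Lemma log_rec_stable w k n : (0 < n <= k)%N -> log_rec w k n = log_rec w n n.
Proof.
elim/ltn_ind: n k => -[//|n] IHn [//|k] /andP[_ lenk] /=; congr (_ - _).
apply: eq_bigr => j _; have ltjn := ltn_ord j.
by congr (_ * _ * _); rewrite [LHS]IHn ?[in RHS]IHn//; lia.
Qed.

Lemma log_exists w : w 0 = 1 -> exists c, is_log w c.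
Proof.
move=> w0; exists (fun n => log_rec w n n) => n.
rewrite big_ord_recr /= binn mul1r subnn w0 mulr1 addrC.
rewrite -[X in _ = X + _](_ :
  w n.+1 - \sum_(j < n) 'C(n, j)%:R * log_rec w j.+1 j.+1 * w (n - j)%N = _).
  by rewrite subrK.
congr (_ - _); apply: eq_bigr => j _; congr (_ * _ * _).
by rewrite [RHS]log_rec_stable//=.
Qed.

Lemma is_log_uniq w c w' c' N : w 0 = 1 -> is_log w c -> is_log w' c' ->
  (forall n, (n <= N)%N -> w n = w' n) -> forall n, (0 < n <= N)%N -> c n = c' n.
Proof.
move=> w0 wc wc' ww; elim/ltn_ind => -[//|n] IHn /andP[_ leN].
have := wc n; rewrite ww// (wc' n) !big_ord_recr /= !binn !mul1r subnn -ww// w0 !mulr1.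
rewrite (eq_bigr (fun k : 'I_n => 'C(n, k)%:R * c k.+1 * w (n - k)%N)) => [/addrI ->//|k _].
by have ltk := ltn_ord k; rewrite ww ?IHn//; lia.
Qed.

Lemma is_log_eq w c c' : is_log w c -> (forall n, (0 < n)%N -> c n = c' n) -> is_log w c'.
Proof. by move=> wc cc n; rewrite wc; apply: eq_bigr => k _; rewrite cc. Qed.

Lemma is_log_ext w w' c : (forall n, w n = w' n) -> is_log w c -> is_log w' c.
Proof. by move=> ww wc n; rewrite -ww wc; apply: eq_bigr => k _; rewrite ww. Qed.

Lemma is_log_scale w c (x : R) : is_log w c ->
  is_log (fun n => x ^+ n * w n) (fun n => x ^+ n * c n).
Proof.
move=> wc n; rewrite wc mulr_sumr; apply: eq_bigr => k _.
have kn : (k <= n)%N by rewrite -ltnS.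
have -> : x ^+ n.+1 = x ^+ k.+1 * x ^+ (n - k) by rewrite -exprD; congr (_ ^+ _); lia.
ring.
Qed.

(** The expansion of [(1 - X) ^- x]; the rising factorial is the sum of [x] to the
   number of cycles over all permutations. *)
Lemma is_log_rising (x : R) :
  is_log (fun n => \prod_(j < n) (x + j%:R)) (fun n => x * n.-1`!%:R).
Proof.
elim=> [|n IHn]; first by rewrite !big_ord1 /= big_ord0 addr0 mul1r !mulr1.
rewrite [RHS]big_ord_recl /= bin0 mul1r mulr1 subn0 [LHS]big_ord_recr /=.
set T := \prod_(_ < n.+1) _.
have -> : \sum_(i < n.+1) 'C(n.+1, bump 0 i)%:R * (x * (bump 0 i)`!%:R) *
     \prod_(j < n.+1 - bump 0 i) (x + j%:R) = n.+1%:R * T.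
  rewrite /T IHn mulr_sumr; apply: eq_bigr => i _.
  rewrite /bump /= add1n subSS factS.
  have e : 'C(n.+1, i.+1)%:R * i.+1%:R = n.+1%:R * 'C(n, i)%:R :> R.
    by rewrite -!natrM mulnC -mul_bin_diag.
  rewrite natrM; set P := \prod_(_ < _) _.
  transitivity (('C(n.+1, i.+1)%:R * i.+1%:R) * (x * i`!%:R * P)); first ring.
  by rewrite e; ring.
by rewrite mulrDr mulrC; congr (_ + _); rewrite mulrC.
Qed.
End LogExists.

Lemma set_partition_log (R : comNzRingType) (e : nat -> R) : e 0 = 1 ->
  is_log e (fun n => part_log e [set: 'I_n]).
Proof.
move=> e0; have [c ec] := log_exists e0; apply: (is_log_eq ec) => n n0.
have T0 : [set: 'I_n] != finset.set0 by rewrite -card_gt0 cardsT card_ord.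
have := set_log_logE (W := fun A : {set 'I_n} => e #|A|) e0 (fun=> erefl)
  (part_log_set_log (T := 'I_n) e0) ec T0.
by rewrite cardsT card_ord.
Qed.

Section BinomialConvolution.
Variable R : numFieldType.
Implicit Types (w c : nat -> R).

(** A truncation of the exponential generating function, so that the product rule
   for formal derivatives of polynomials applies. *)
Definition egf N w : {poly R} := \poly_(k < N) (w k / k`!%:R).

Definition bin_conv w1 w2 n : R := \sum_(i < n.+1) 'C(n, i)%:R * w1 i * w2 (n - i)%N.

Lemma fact_neq0 n : n`!%:R != 0 :> R.
Proof. by rewrite pnatr_eq0 -lt0n fact_gt0. Qed.

Lemma bin_factE n k : (k <= n)%N -> 'C(n, k)%:R = n`!%:R / (k`!%:R * (n - k)`!%:R) :> R.
Proof.
move=> kn; rewrite -(bin_fact kn) !natrM mulfK// mulf_neq0 ?fact_neq0//.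
Qed.

Lemma coef_egfM N w1 w2 n : (n < N)%N ->
  (egf N w1 * egf N w2)`_n = bin_conv w1 w2 n / n`!%:R.
Proof.
move=> nN; rewrite coefM mulr_suml; apply: eq_bigr => k _; rewrite !coef_poly.
have kn : (k <= n)%N by rewrite -ltnS.
rewrite (leq_ltn_trans kn nN) (leq_ltn_trans (leq_subr _ _) nN) bin_factE//.
have := fact_neq0 n; have := fact_neq0 k; have := fact_neq0 (n - k) => h1 h2 h3.
by field; rewrite ?h1 ?h2 ?h3.
Qed.

Lemma is_log_egf w c : is_log w c <-> forall N n, (n.+1 < N)%N ->
  (egf N w)^`()`_n = (egf N (fun k => c k.+1) * egf N w)`_n.
Proof.
have dE N n : (n.+1 < N)%N -> (egf N w)^`()`_n = w n.+1 / n`!%:R.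
  move=> nN; rewrite coef_deriv -[LHS]mulr_natr coef_poly nN factS natrM.
  have n0 : n.+1%:R != 0 :> R by rewrite pnatr_eq0.
  have h := fact_neq0 n; move: n.+1%:R n`!%:R n0 h => a b a0 b0; field; by rewrite a0 b0.
split=> [wc N n nN|wc n].
  rewrite dE// coef_egfM ?(ltnW nN)// wc /bin_conv; congr (_ / _).
have := wc n.+2 n (ltnSn _); rewrite dE// coef_egfM// => /(mulIf _) -> //.
by rewrite invr_eq0 fact_neq0.
Qed.

Lemma eq_coefM (A A' B : {poly R}) n : (forall k, (k <= n)%N -> A`_k = A'`_k) ->
  (A * B)`_n = (A' * B)`_n.
Proof. by move=> AA; rewrite !coefM; apply: eq_bigr => k _; rewrite AA// -ltnS. Qed.

(** The logarithm turns products into sums: [E1 E2] has the derivative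
   [(C1' + C2') E1 E2]. *)
Lemma is_log_conv w1 w2 c1 c2 : is_log w1 c1 -> is_log w2 c2 ->
  is_log (bin_conv w1 w2) (fun n => c1 n + c2 n).
Proof.
move=> /is_log_egf l1 /is_log_egf l2; apply/is_log_egf => N n nN.
have e12 k : (k < N)%N -> (egf N (bin_conv w1 w2))`_k = (egf N w1 * egf N w2)`_k.
  by move=> kN; rewrite coef_egfM// coef_poly kN.
have -> : (egf N (bin_conv w1 w2))^`()`_n = (egf N w1 * egf N w2)^`()`_n.
  by rewrite !coef_deriv e12.
have -> : egf N (fun k => c1 k.+1 + c2 k.+1) = egf N (fun k => c1 k.+1) + egf N (fun k => c2 k.+1).
  by apply/polyP => k; rewrite coefD !coef_poly; case: ifP; rewrite ?addr0// mulrDl.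
rewrite [_ * egf N (bin_conv w1 w2)]mulrC (eq_coefM (A' := egf N w1 * egf N w2)) => [|k kn]; last first.
  by rewrite e12//; lia.
rewrite derivM coefD (eq_coefM (A' := egf N (fun k => c1 k.+1) * egf N w1)) => [|k kn]; last first.
  by rewrite l1//; lia.
rewrite [egf N w1 * _^`()]mulrC
  (eq_coefM (A := (egf N w2)^`()) (A' := egf N (fun k => c2 k.+1) * egf N w2)) => [|k kn]; last first.
  by rewrite l2//; lia.
rewrite -coefD; apply: (congr1 (fun p : {poly R} => p`_n)); ring.
Qed.
End BinomialConvolution.

Section Newton.
Variable R : numFieldType.
Implicit Types (s : seq R) (x : R).

Definition rev_poly s : {poly R} := \prod_(x <- s) (1 - x *: 'X).

Lemma size_rev_poly s : (size (rev_poly s) <= (size s).+1)%N.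
Proof.
elim: s => [|x s IHs]; first by rewrite /rev_poly big_nil size_poly1.
rewrite /rev_poly big_cons; apply: leq_trans (size_polyMleq _ _) _.
have : (size (1 - x *: 'X)%R <= 2)%N.
  apply/leq_sizeP => -[|[|k]]//= _; rewrite coefB coef1 coefZ coefX /= mulr0 subrr//.
move: IHs; rewrite -/(rev_poly s) /=; move: (size (1 - x *: 'X)%R) (size (rev_poly s)) => a b; lia.
Qed.

Lemma coef_rev_poly_cons x s k :
  (rev_poly (x :: s))`_k = (rev_poly s)`_k - x * (if k is j.+1 then (rev_poly s)`_j else 0).
Proof.
rewrite /rev_poly big_cons mulrBl mul1r coefB -scalerAl coefZ coefXM.
by case: k.
Qed.

(** [rev_poly s] is the reciprocal polynomial of [\prod_(x <- s) ('X - x)]. *)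
Lemma coef_rev_poly s k : (k <= size s)%N ->
  (\prod_(x <- s) ('X - x%:P))`_(size s - k) = (rev_poly s)`_k.
Proof.
elim: s k => [|x s IHs] k; first by rewrite leqn0 => /eqP ->; rewrite /rev_poly !big_nil.
rewrite /= => kn; rewrite coef_rev_poly_cons big_cons mulrBl coefB coefXM coefCM.
case: k kn => [|k] kn.
  rewrite subn0 /= mulr0 -[in X in X - _](subn0 (size s)) IHs// [X in _ - _ * X]nth_default ?mulr0//.
  by rewrite size_prod_XsubC.
rewrite subSS IHs//; congr (_ - _).
case: (ltnP k (size s)) => ks; last first.
  have -> : k = size s by lia.
  by rewrite subnn /= nth_default// size_rev_poly.
have -> : (size s - k == 0)%N = false by lia.
have -> : (size s - k).-1 = (size s - k.+1)%N by lia.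
by rewrite IHs.
Qed.

(** Newton's identities: the logarithm of [\prod_x (1 - x X)] has coefficients
   [- \sum_x x ^+ n / n]. *)
Lemma newton s : is_log (fun n => n`!%:R * (rev_poly s)`_n)
                        (fun n => - (\sum_(x <- s) x ^+ n) * n.-1`!%:R).
Proof.
apply/is_log_egf => N n nN.
set P := egf N (fun k => - (\sum_(x <- s) x ^+ k.+1) * k.+1.-1`!%:R).
have PE t : egf N (fun k => - (\sum_(x <- t) x ^+ k.+1) * k.+1.-1`!%:R) =
    - \poly_(k < N) (\sum_(x <- t) x ^+ k.+1).
  apply/polyP => k; rewrite coefN !coef_poly; case: ifP => _; last by rewrite oppr0.
  by rewrite mulfK// fact_neq0.
have AE k : (k < N)%N -> (egf N (fun n => n`!%:R * (rev_poly s)`_n))`_k = (rev_poly s)`_k.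
  by move=> kN; rewrite coef_poly kN mulrAC divff ?mul1r// fact_neq0.
rewrite coef_deriv AE// -coef_deriv mulrC (eq_coefM (A' := rev_poly s)) => [|k kn]; last first.
  by rewrite AE//; lia.
rewrite mulrC /P PE {P PE AE}; have {}nN : (n < N)%N by lia.
suff all_n t k : (k < N)%N ->
    (rev_poly t)^`()`_k = (- (\poly_(k < N) (\sum_(x <- t) x ^+ k.+1)) * rev_poly t)`_k.
  exact: all_n.
elim: t k => [|x t IHt] k kN.
  rewrite /rev_poly big_nil (derivC 1) coef0 mulr1 coefN coef_poly.
  by rewrite big_nil if_same oppr0.
have -> : \poly_(k < N) (\sum_(y <- x :: t) y ^+ k.+1) =
    \poly_(k < N) (x ^+ k.+1) + \poly_(k < N) (\sum_(y <- t) y ^+ k.+1).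
  by apply/polyP => j; rewrite coefD !coef_poly; case: ifP => _; rewrite ?big_cons ?addr0.
set G := \poly_(k < N) (x ^+ k.+1); set S := \poly_(k < N) _.
have -> : rev_poly (x :: t) = (1 - x *: 'X) * rev_poly t by rewrite /rev_poly big_cons.
set A := rev_poly t; rewrite -/A -/S in IHt.
rewrite derivM derivB (derivC 1) derivZ derivX sub0r.
have -> : - (G + S) * ((1 - x *: 'X) * A) = - (G * (1 - x *: 'X)) * A + - S * A * (1 - x *: 'X).
  ring.
rewrite [LHS]coefD [RHS]coefD; congr (_ + _).
  apply: eq_coefM => j jk; rewrite !coefN coefZ coef1 mulrBr mulr1 coefB -scalerAr coefZ
    coefMX !coef_poly.
  have -> : (j < N)%N by lia.
  case: j jk => [|j] jk /=; first by rewrite mulr0 subr0 expr1 mulr1.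
  have -> : (j < N)%N by lia.
  by rewrite -exprS subrr mulr0.
by rewrite mulrC; apply: eq_coefM => j jk; rewrite IHt//; lia.
Qed.
End Newton.

(** * Moments and finite free cumulants *)

Section FiniteFreeCumulants.
Variable R : realType.
Implicit Types (p q : {poly R}) (d n k : nat).

Lemma real_rooted_monic d p : real_rooted d p -> p`_d = 1 /\ size p = d.+1.
Proof.
move=> [s <- ->]; rewrite size_prod_XsubC; split=> //.
have := monic_prod_XsubC s xpredT id; rewrite monicE lead_coefE size_prod_XsubC /=.
by move/eqP.
Qed.

Lemma root_seqP d p : real_rooted d p ->
  p = \prod_(x <- root_seq p) ('X - x%:P) /\ size (root_seq p) = d.
Proof.
move=> rp; have rs : p = \prod_(x <- root_seq p) ('X - x%:P).
  case: rp => s _ ps; pose P (s : seq R) := p = \prod_(x <- s) ('X - x%:P).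
  by apply: (@classical_sets.xgetPex _ [::] P); exists s.
split=> //; have [_] := real_rooted_monic rp.
by rewrite {1}rs size_prod_XsubC => -[].
Qed.

Lemma ecoef0 d p : real_rooted d p -> ecoef d p 0 = 1.
Proof. by move=> /real_rooted_monic[pd _]; rewrite /ecoef subn0 pd bin0 expr0 divr1 mulr1. Qed.

Lemma ecoef_rev_poly (s : seq R) n :
  (rev_poly s)`_n = (-1) ^+ n * 'C(size s, n)%:R * ecoef (size s) (\prod_(x <- s) ('X - x%:P)) n.
Proof.
rewrite /ecoef; case: (leqP n (size s)) => ns; last first.
  by rewrite bin_small// mulr0 mul0r nth_default// (leq_trans (size_rev_poly _)).
rewrite coef_rev_poly// [RHS]mulrACA.
have b0 : 'C(size s, n)%:R != 0 :> R by rewrite pnatr_eq0 -lt0n bin_gt0.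
have e : (-1) ^+ n * (-1) ^+ n = 1 :> R by rewrite -expr2 sqrr_sign.
transitivity (((-1) ^+ n * (-1) ^+ n) * (rev_poly s)`_n); first by rewrite e mul1r.
by field.
Qed.

Definition log_ecoef d p n : R := part_log (ecoef d p) [set: 'I_n].

Lemma ff_cumulantE d p n : ff_cumulant d p n = (- d%:R) ^+ n.-1 / (n.-1)`!%:R * log_ecoef d p n.
Proof.
congr (_ * _); apply: eq_big => P; first by rewrite inE.
by move=> _; rewrite /mobius_coef.
Qed.

Lemma log_ecoef_is_log d p : real_rooted d p -> is_log (ecoef d p) (log_ecoef d p).
Proof. by move=> rp; apply: set_partition_log; apply: ecoef0. Qed.

Lemma is_log_kappa d p : real_rooted d p ->
  is_log (fun n => (- d%:R) ^+ n * ecoef d p n)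
         (fun n => (- d%:R * ff_cumulant d p n) * n.-1`!%:R).
Proof.
move=> rp; apply: is_log_eq (is_log_scale (- d%:R) (log_ecoef_is_log rp)) _ => -[//|n] _.
rewrite ff_cumulantE exprS /=; have := fact_neq0 R n.
by move: (_ ^+ n) (log_ecoef _ _ _) (n`!%:R) => a b c c0; field.
Qed.

Lemma is_log_ncyc d :
  is_log (fun n => \prod_(j < n) (- d%:R + j%:R) : R) (fun n => - d%:R * n.-1`!%:R).
Proof. exact: is_log_rising. Qed.

Lemma prod_falling d n : \prod_(j < n) (- d%:R + j%:R) = (-1) ^+ n * n`!%:R * 'C(d, n)%:R :> R.
Proof.
rewrite -mulrA -natrM [(n`! * _)%N]mulnC bin_ffact.
elim: n => [|n IHn]; first by rewrite big_ord0 mulr1.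
rewrite big_ord_recr /= IHn ffactnSr natrM exprS; case: (leqP n d) => nd.
  by rewrite natrB//; ring.
by rewrite ffact_small// !(mul0r, mulr0).
Qed.

Lemma wt_setT (u : nat -> R) n (s : 'S_n) : wt u setT s = perm_prod u s.
Proof.
rewrite /wt /perm_prod (_ : porbit s @: setT = porbits s)//.
by apply/setP => C; apply/imsetP/imsetP => -[x _ ->]; exists x; rewrite ?inE.
Qed.

Lemma perm_prod_scale (u : nat -> R) x n (s : 'S_n) :
  perm_prod (fun k => x * u k) s = x ^+ ncyc s * perm_prod u s.
Proof. by rewrite /perm_prod big_split /= prodr_const. Qed.

Lemma perm_prod_const x n (s : 'S_n) : perm_prod (fun => x) s = x ^+ ncyc s :> R.
Proof. by rewrite /perm_prod prodr_const. Qed.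

(** By Newton's identities the moments are, up to scaling, the logarithm of the
   coefficients of [p]. Up to a factor [(-d) ^+ n], the latter are the products
   of [(-d) ^+ n * e_n] and [(-d)(-d+1)...(-d+n-1)], each of which is a sum over
   permutations weighted by their cycles; so the logarithm is the sum over
   transitive pairs of permutations. *)
Lemma moment_cumulant d p n : (0 < d)%N -> real_rooted d p ->
  n`!%:R * poly_moment d p n.+1 =
  \sum_(s : 'S_n.+1) \sum_(t : 'S_n.+1 | conn setT s t)
     (- d%:R^-1) ^+ (n.+2 - (ncyc s + ncyc t)) * perm_prod (ff_cumulant d p) s.
Proof.
move=> d0 rp; have nd0 : d%:R != 0 :> R by rewrite pnatr_eq0 -lt0n.
have [rs szs] := root_seqP rp.
pose f k := - d%:R * ff_cumulant d p k; pose g (k : nat) : R := - d%:R.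
have lc := is_log_scale (- d%:R) (newton (root_seq p)).
pose c k := (- d%:R) ^+ k * (- (\sum_(x <- root_seq p) x ^+ k) * k.-1`!%:R).
have lw : is_log (fun n => ((- d%:R) ^+ n * ecoef d p n) * \prod_(j < n) (- d%:R + j%:R)) c.
  apply: is_log_ext lc => k.
  by rewrite ecoef_rev_poly szs -rs prod_falling; ring.
have T0 : [set: 'I_n.+1] != finset.set0 by rewrite -card_gt0 cardsT card_ord.
have := CsumE (f := f) (g := g) _ _ (is_log_kappa rp) (is_log_ncyc d) lw T0.
rewrite /= big_ord0 expr0 mul1r ecoef0// cardsT card_ord => /(_ erefl erefl) Ec.
have -> : n`!%:R * poly_moment d p n.+1 = c n.+1 / (- d%:R) ^+ n.+2.
  rewrite /c /poly_moment /= [_ ^+ n.+2]exprS.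
  have : (- d%:R) ^+ n.+1 != 0 :> R by rewrite expf_neq0 ?oppr_eq0.
  by move: (_ ^+ n.+1) (\sum_(_ <- _) _) => a b a0; field; rewrite ?nd0 ?a0.
rewrite -Ec /Csum mulr_suml; apply: eq_big => s; first by apply/subsetP => x; rewrite inE.
move=> _; rewrite mulr_suml [RHS]big_mkcond; apply: eq_big => t; first by apply/subsetP => x; rewrite inE.
move=> _; case: ifP => cst; last by rewrite !mul0r.
rewrite mul1r !wt_setT /f /g perm_prod_scale perm_prod_const.
have le : (ncyc s + ncyc t <= n.+2)%N.
  have := genus_le cst; have := ncyc_gt0 (s * t)%g; rewrite card_ord.
  by move: (ncyc s) (ncyc t) (ncyc _) => *; lia.
have -> : (- d%:R) ^+ n.+2 = 
    (- d%:R) ^+ (n.+2 - (ncyc s + ncyc t)) * ((- d%:R) ^+ ncyc s * (- d%:R) ^+ ncyc t) :> R.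
  by rewrite -!exprD subnK.
rewrite -invrN exprVn.
have p0 k : (- d%:R) ^+ k != 0 :> R by rewrite expf_neq0 ?oppr_eq0.
have := p0 (n.+2 - (ncyc s + ncyc t))%N; have := p0 (ncyc s); have := p0 (ncyc t).
move: (_ ^+ _) (_ ^+ _) (_ ^+ _) => a b c' a0 b0 c0; field.
by rewrite ?a0 ?b0 ?c0.
Qed.

Lemma coef_boxplus d p q k : (k <= d)%N ->
  (boxplus d p q)`_(d - k) = (-1) ^+ k * 'C(d, k)%:R * bin_conv (ecoef d p) (ecoef d q) k.
Proof.
move=> kd; rewrite coef_sum (bigD1 (Ordinal (kd : (k < d.+1)%N))) //= coefZ coefXn eqxx mulr1.
rewrite [X in _ + X]big1 ?addr0// => j jk; rewrite coefZ coefXn.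
case: eqP => e; last by rewrite mulr0.
case/eqP: jk; apply: val_inj => /=; have := ltn_ord j; lia.
Qed.

Lemma ecoef_boxplus d p q k : (k <= d)%N ->
  ecoef d (boxplus d p q) k = bin_conv (ecoef d p) (ecoef d q) k.
Proof.
move=> kd; rewrite /ecoef coef_boxplus//.
have b0 : 'C(d, k)%:R != 0 :> R by rewrite pnatr_eq0 -lt0n bin_gt0.
have e : (-1) ^+ k * (-1) ^+ k = 1 :> R by rewrite -expr2 sqrr_sign.
by rewrite !mulrA e mul1r mulrAC divff// mul1r.
Qed.

(** In terms of the normalized coefficients the convolution is multiplication of
   exponential generating functions, of which the cumulants are the logarithm. *)
Lemma ff_cumulant_boxplus d p q n : real_rooted d p -> real_rooted d q ->
  real_rooted d (boxplus d p q) -> (0 < n <= d)%N ->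
  ff_cumulant d (boxplus d p q) n = ff_cumulant d p n + ff_cumulant d q n.
Proof.
move=> rp rq rpq nd; rewrite !ff_cumulantE -mulrDr; congr (_ * _).
have conv := is_log_conv (log_ecoef_is_log rp) (log_ecoef_is_log rq).
apply: (is_log_uniq (ecoef0 rpq) (log_ecoef_is_log rpq) conv) nd => k kd.
exact: ecoef_boxplus.
Qed.
End FiniteFreeCumulants.

(** * Polar derivatives and half-planes *)

Section HalfPlane.
Variable C : numClosedFieldType.
Implicit Types (f q : {poly C}) (w y z x c : C) (s ws : seq C) (d : nat).

Lemma norm_conj_sub y x : 0 < 'Im y -> (`|y^* - x| <= `|y - x|) = ('Im x <= 0).
Proof.
move=> y0; rewrite -(@ler_pXn2r _ 2)// ?nnegrE// !normC2_Re_Im !raddfB /= Re_conj Im_conj.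
rewrite -subr_ge0 (_ : _ - _ = (4 * 'Im y) * - 'Im x); last by ring.
by rewrite pmulr_rge0 ?oppr_ge0// mulr_gt0.
Qed.

Lemma Im_le0_gt0 x : ('Im x <= 0) = ~~ (0 < 'Im x).
Proof. by rewrite real_leNgt ?real0// Creal_Im. Qed.

Lemma deriv_prod_XsubC s y : (forall x, x \in s -> y != x) ->
  (\prod_(x <- s) ('X - x%:P))^`().[y] =
  (\prod_(x <- s) ('X - x%:P)).[y] * \sum_(x <- s) (y - x)^-1.
Proof.
elim: s => [|x s IHs] ys; first by rewrite !big_nil mulr0 (derivC 1) horner0.
have yx : y - x != 0 by rewrite subr_eq0 ys ?mem_head.
rewrite !big_cons derivM derivXsubC mul1r hornerD !hornerM IHs => [|z zs]; last first.
  by rewrite ys// inE zs orbT.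
rewrite hornerXsubC; set P := _.[y]; set S := \sum_(_ <- _) _.
by field.
Qed.

(** The polar derivative of [f], viewed as a polynomial of degree [d], at [w]. *)
Definition polar d w f : {poly C} := f + d%:R^-1 *: ((w%:P - 'X) * f^`()).

(** Laguerre: with [h x = (y^* - x) / (y - x)], which maps the closed lower
   half-plane to the unit disk, a zero [y] of the polar derivative would make
   [h w] the mean of the [h x] over the roots [x], but [h w] is outside the
   disk. *)
Lemma polar_neq0 c s w y : c != 0 -> (0 < size s)%N -> (forall x, x \in s -> 'Im x <= 0) ->
  0 < 'Im w -> 0 < 'Im y ->
  (polar (size s) w (c *: \prod_(x <- s) ('X - x%:P))).[y] != 0.
Proof.
move=> c0 s0 ss w0 y0; have ys x : x \in s -> y != x.
  by move=> /ss xs; apply: contraTneq y0 => ->; rewrite -Im_le0_gt0.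
have d0 : (size s)%:R != 0 :> C by rewrite pnatr_eq0 -lt0n.
rewrite /polar derivZ hornerD !hornerZ hornerM hornerZ hornerD hornerN hornerC hornerX deriv_prod_XsubC//.
set P := (\prod_(_ <- _) _).[y]; set S := \sum_(_ <- _) _; set d := (size s)%:R.
have P0 : P != 0.
  by rewrite /P -rootE root_prod_XsubC; apply/negP => /ys; rewrite eqxx.
rewrite (_ : _ + _ = c * P * (1 + d^-1 * ((w - y) * S))); last by ring.
rewrite !mulf_neq0//; apply/negP => /eqP eS.
have wy : w - y != 0.
  by apply: contra_eq_neq eS => ->; rewrite mul0r mulr0 addr0 oner_eq0.
have yw : y - w != 0 by rewrite -opprB oppr_eq0.
(* Now [d / (y - w)] equals [S], so that [h w] is the mean of the [h x]. *)
have ES : S = d / (y - w).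
  have dw : d^-1 * (w - y) != 0 by rewrite mulf_neq0 ?invr_eq0.
  apply: (mulfI dw).
  have -> : d^-1 * (w - y) * S = - 1 by apply/eqP; rewrite -addr_eq0 addrC -mulrA eS.
  by field; rewrite d0 yw.
have sum1 : \sum_(x <- s) 1 = d by rewrite /d big_const_seq count_predT iter_addr_0.
have : `|\sum_(x <- s) ((y^* - x) / (y - x))| <= d.
  rewrite -sum1 big_seq [X in _ <= X]big_seq; apply: le_trans (ler_norm_sum _ _ _) _.
  apply: ler_sum => x xs; have yx : y - x != 0 by rewrite subr_eq0 ys.
  by rewrite normrM normfV ler_pdivrMr ?normr_gt0// mul1r norm_conj_sub// ss.
rewrite big_seq (eq_bigr (fun x => 1 + (y^* - y) * (y - x)^-1)) => [|x xs]; last first.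
  have yx : y - x != 0 by rewrite subr_eq0 ys.
  by field.
rewrite -big_seq big_split /= sum1 -mulr_sumr -/S ES.
have -> : d + (y^* - y) * (d / (y - w)) = d * ((y^* - w) / (y - w)) by field.
rewrite normrM /d normr_nat -[X in _ <= X]mulr1 ler_pM2l ?ltr0n//.
rewrite normrM normfV ler_pdivrMr ?normr_gt0// mul1r norm_conj_sub//.
by rewrite Im_le0_gt0 w0.
Qed.

Lemma coef_polar d w f k : (polar d w f)`_k =
  f`_k + d%:R^-1 * (w * f`_k.+1 *+ k.+1 - f`_k *+ k).
Proof.
rewrite coefD coefZ mulrBl coefB coefCM coefXM !coef_deriv mulrnAr.
by case: k => [|k] /=; rewrite ?mulr0n// coef_deriv.
Qed.

(** The iterated polar derivative evaluates the symmetric multi-affine polarization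
   of [f] at [ws]; see [polarsE]. *)
Fixpoint polars ws f : {poly C} :=
  if ws is w :: ws' then polars ws' (polar (size ws) w f) else f.

(** By Laguerre's theorem the roots stay in the closed lower half-plane at each
   step. The degree drops by exactly one, because the coefficient in degree
   [size ws] is [c] times the difference of [w] and the mean of the roots. *)
Lemma polars_neq0 ws c s : c != 0 -> size s = size ws ->
  (forall x, x \in s -> 'Im x <= 0) -> (forall w, w \in ws -> 0 < 'Im w) ->
  (polars ws (c *: \prod_(x <- s) ('X - x%:P)))`_0 != 0.
Proof.
elim: ws c s => [|w ws IHws] c s c0 sz ss wws /=.
  by move: sz => /size0nil ->; rewrite big_nil coefZ coef1 mulr1.
set f := c *: _; set g := polar _ _ _.
have lf : f`_(size s) = c.
  have := monic_prod_XsubC s xpredT id; rewrite monicE lead_coefE size_prod_XsubC /=.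
  by rewrite /f coefZ => /eqP ->; rewrite mulr1.
have szf : size f = (size s).+1 by rewrite size_scale// size_prod_XsubC.
have w0 : 0 < 'Im w by rewrite wws ?mem_head.
have d0 : (size ws).+1%:R != 0 :> C by rewrite pnatr_eq0.
have lf' : f`_(size ws) = c * - \sum_(x <- s) x.
  by rewrite coefZ -coefPn_prod_XsubC ?sz.
have gE k : g`_k = _ := coef_polar _ _ _ _.
have gd : g`_(size ws) != 0.
  have lf1 : f`_(size ws).+1 = c by rewrite -lf sz.
  rewrite gE lf' lf1 (_ : _ + _ = c * (w - (size ws).+1%:R^-1 * \sum_(x <- s) x)).
    rewrite mulf_neq0//; apply: contraTneq w0 => /eqP; rewrite subr_eq0 => /eqP ->.
    rewrite -Im_le0_gt0 ImMl ?rpredV ?realn// raddf_sum big_seq.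
    by rewrite mulr_ge0_le0 ?invr_ge0 ?ler0n// sumr_le0.
  rewrite -[_ *+ _.+1]mulr_natr -[_ *+ size ws]mulr_natr.
  set S := \sum_(_ <- _) _; move: d0; rewrite -natr1; set n := (size ws)%:R => d0.
  by field.
have g0 k : (size ws < k)%N -> g`_k = 0.
  move=> ltk; rewrite gE [f`_k.+1]nth_default; last by rewrite szf sz.
  rewrite mulr0 mul0rn add0r; move: ltk; rewrite leq_eqVlt => /orP[/eqP <-|ltk].
    rewrite -[f`__ *+ _]mulr_natr; rewrite mulrN mulrCA mulVf// mulr1 subrr//.
  by rewrite nth_default ?szf ?sz// mul0rn oppr0 mulr0 addr0.
have szg : size g = (size ws).+1.
  apply/eqP; rewrite eqn_leq; apply/andP; split; first exact/leq_sizeP.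
  by rewrite ltnNge; apply: contra gd => szg; rewrite nth_default.
have [r gr] := closed_field_poly_normal g.
have lg0 : lead_coef g != 0 by rewrite lead_coef_eq0 -size_poly_eq0 szg.
rewrite gr; apply: IHws => //.
- by move: szg; rewrite gr size_scale// size_prod_XsubC => -[].
- move=> x xr; rewrite Im_le0_gt0; apply/negP => x0.
  have := polar_neq0 (s := s) c0 _ ss w0 x0; rewrite sz -/f -/g => /(_ isT).
  by rewrite gr -rootE rootZ// root_prod_XsubC xr.
- by move=> v vws; rewrite wws// inE vws orbT.
Qed.

(** The product over [ws] has the elementary symmetric functions of [ws] as
   coefficients, whose recursion matches [coef_polar]. *)
Lemma polarsE ws f : (size f <= (size ws).+1)%N ->
  (polars ws f)`_0 = \sum_(k < (size ws).+1)
    f`_k * (\prod_(w <- ws) ('X + w%:P))`_(size ws - k) / 'C(size ws, k)%:R.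
Proof.
elim: ws f => [|w ws IHws] f szf.
  by rewrite big_ord1 big_nil /= coef1 bin0 invr1 !mulr1.
rewrite /= IHws; last first.
  apply/leq_sizeP => k lek; rewrite coef_polar.
  rewrite [f`_k.+1]nth_default; last by apply: leq_trans szf _; rewrite /=; lia.
  rewrite mulr0 mul0rn add0r; move: lek; rewrite leq_eqVlt => /orP[/eqP <-|ltk].
    by rewrite -[f`__ *+ _]mulr_natr mulrN mulrCA mulVf ?pnatr_eq0// mulr1 subrr.
  by rewrite nth_default ?mul0rn ?oppr0 ?mulr0 ?addr0//; apply: leq_trans szf _.
rewrite big_cons; set Q := \prod_(_ <- _) _; set m := size ws.
have szQ : size Q = m.+1.
  rewrite /Q (eq_bigr (fun w => 'X - (- w)%:P)) => [|v _]; last by rewrite polyCN opprK.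
  by rewrite -(big_map -%R xpredT (fun w => 'X - w%:P)) size_prod_XsubC size_map.
have m0 : m.+1%:R != 0 :> C by rewrite pnatr_eq0.
have b0 k n : (k <= n)%N -> 'C(n, k)%:R != 0 :> C.
  by move=> kn; rewrite pnatr_eq0 -lt0n bin_gt0.
transitivity (\sum_(k < m.+1) f`_k * Q`_(m - k) / 'C(m.+1, k)%:R +
   \sum_(k < m.+1) f`_k.+1 * (w * Q`_(m - k)) / 'C(m.+1, k.+1)%:R).
  rewrite -big_split; apply: eq_bigr => k _ /=; rewrite coef_polar.
  have km : (k <= m)%N by rewrite -ltnS.
  have mk0 : m.+1%:R - k%:R != 0 :> C.
    by rewrite subr_eq0 eqr_nat; apply/eqP => mk; rewrite -mk ltnn in km.
  have e1 : 'C(m.+1, k)%:R = m.+1%:R * 'C(m, k)%:R / (m.+1%:R - k%:R) :> C.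
    apply: (mulIf mk0); rewrite divfK// -natrB ?(leq_trans km)// -!natrM.
    by rewrite mul_bin_down mulnC.
  have e2 : 'C(m.+1, k.+1)%:R = m.+1%:R * 'C(m, k)%:R / k.+1%:R :> C.
    apply: (mulIf (x := k.+1%:R)); rewrite ?pnatr_eq0// divfK ?pnatr_eq0// -!natrM.
    by rewrite mul_bin_diag mulnC.
  have k0 : k.+1%:R != 0 :> C by rewrite pnatr_eq0.
  rewrite e1 e2 -[_ *+ _.+1]mulr_natr -[_ *+ k]mulr_natr.
  by field; rewrite !nat1r k0 b0 ?m0 ?mk0.
transitivity (\sum_(k < m.+2) f`_k * (if (m.+1 - k)%N is j.+1 then Q`_j else 0) / 'C(m.+1, k)%:R +
   \sum_(k < m.+2) f`_k * (w * Q`_(m.+1 - k)) / 'C(m.+1, k)%:R); last first.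
  rewrite -big_split; apply: eq_bigr => k _ /=; rewrite mulrDl coefD coefXM coefCM.
  by case: (m.+1 - k)%N => [|j] /=; rewrite mulrDr mulrDl.
rewrite [in RHS]big_ord_recr /= subnn mulr0 mul0r addr0; congr (_ + _).
  apply: eq_bigr => k _; have km : (k <= m)%N by rewrite -ltnS.
  by rewrite subSn.
rewrite [RHS]big_ord_recl /= subn0 [Q`_m.+1]nth_default ?szQ// !mulr0 mul0r add0r.
by apply: eq_bigr => k _; rewrite /bump /= add1n subSS.
Qed.
End HalfPlane.

(** * The finite free convolution preserves real-rootedness *)

Section Walsh.
Variable C : numClosedFieldType.
Implicit Types (p q : {poly C}) (z x : C) (s : seq C).

(** [ecoef] over the complex numbers. *)
Definition acoef d p k : C := (-1) ^+ k * p`_(d - k) / 'C(d, k)%:R.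

Lemma coef_XaddC_exp z m i : (('X + z%:P) ^+ m)`_i = 'C(m, i)%:R * z ^+ (m - i).
Proof.
rewrite addrC exprDn coef_sum.
rewrite (eq_bigr (fun j : 'I_m.+1 => if i == j :> nat then 'C(m, i)%:R * z ^+ (m - i) else 0)).
  case: (ltnP i m.+1) => im; last first.
    rewrite bin_small// mul0r big1// => j _; by case: ifP.
  rewrite (bigD1 (Ordinal im)) //= eqxx big1 ?addr0// => j ji.
  by case: eqP => // e; case/eqP: ji; apply: val_inj.
move=> j _; rewrite -rmorphXn /= coefMn coefCM coefXn.
by case: eqP => [->|]; rewrite ?mulr1 ?mulr0 ?mul0rn// mulr_natl.
Qed.

Lemma coef_shift q z i :
  (q \Po ('X + z%:P))`_i = \sum_(m < size q) q`_m * ('C(m, i)%:R * z ^+ (m - i)).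
Proof.
rewrite comp_polyE coef_sum; apply: eq_bigr => m _.
by rewrite coefZ coef_XaddC_exp.
Qed.

Lemma prod_shift s z :
  \prod_(w <- [seq z - x | x <- s]) ('X + w%:P) = (\prod_(x <- s) ('X - x%:P)) \Po ('X + z%:P).
Proof.
rewrite big_map rmorph_prod /=; apply: eq_bigr => x _.
by rewrite comp_polyB comp_polyX comp_polyC polyCB addrA.
Qed.

Lemma sum_ord_shift d i (G : nat -> C) : (i <= d)%N ->
  \sum_(k < d.+1 | (i <= k)%N) G k = \sum_(l < d.+1 | (i + l <= d)%N) G (i + l)%N.
Proof.
move=> id; rewrite -(big_mkord (fun k => i <= k)%N G).
rewrite -(big_mkord (fun l => i + l <= d)%N (fun l => G (i + l)%N)).
rewrite (big_cat_nat (n := i)) ?(leqW id)//= big_nat_cond big_pred0 ?add0r => [|k]; last by lia.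
rewrite [RHS](big_cat_nat (n := (d.+1 - i)%N)) ?leq_subr//= [X in _ = _ + X]big_nat_cond.
rewrite [X in _ = _ + X]big_pred0 ?addr0 => [|k]; last by lia.
have -> : \sum_(i <= k < d.+1 | (i <= k)%N) G k = \sum_(0 + i <= k < d.+1 | (i <= k)%N) G k.
  by rewrite add0n.
rewrite big_addn big_nat_cond [RHS]big_nat_cond.
by apply: eq_big => [k|k _]; [lia|rewrite addnC].
Qed.

(** Up to signs and powers of [z], both sides are the sum over [i + l <= d] of the
   multinomial coefficient times [a i * b l]; on the right one recognizes Taylor
   coefficients at [z]. *)
Lemma bin_conv_eval d (a b : nat -> C) z :
  \sum_(k < d.+1) (-1) ^+ k * 'C(d, k)%:R * bin_conv a b k * z ^+ (d - k) =
  \sum_(i < d.+1) (-1) ^+ i * a i *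
     \sum_(l < d.+1) (-1) ^+ l * 'C(d, l)%:R * b l * ('C(d - l, i)%:R * z ^+ (d - l - i)).
Proof.
transitivity (\sum_(k < d.+1) \sum_(i < d.+1 | (i <= k)%N)
    (-1) ^+ k * 'C(d, k)%:R * ('C(k, i)%:R * a i * b (k - i)%N) * z ^+ (d - k)).
  apply: eq_bigr => k _; rewrite /bin_conv mulr_sumr mulr_suml.
  rewrite (big_ord_widen d.+1 (fun i => (-1) ^+ k * 'C(d, k)%:R *
     ('C(k, i)%:R * a i * b (k - i)%N) * z ^+ (d - k)) (ltn_ord k)).
  by apply: eq_bigl => i; rewrite ltnS.
rewrite (exchange_big_dep xpredT) //=; apply: eq_bigr => i _.
have id : (i <= d)%N by rewrite -ltnS.
rewrite (sum_ord_shift (fun k => (-1) ^+ k * 'C(d, k)%:R *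
   ('C(k, i)%:R * a i * b (k - i)%N) * z ^+ (d - k)) id) mulr_sumr big_mkcond.
apply: eq_bigr => l _; have ld : (l <= d)%N by rewrite -ltnS.
case: ifP => ild; last first.
  by rewrite [X in _ * (X%:R * _)]bin_small ?(mul0r, mulr0)//; lia.
have e : 'C(d, i + l)%:R * 'C(i + l, i)%:R = 'C(d, l)%:R * 'C(d - l, i)%:R :> C.
  rewrite !bin_factE//; try lia.
  have -> : (i + l - i = l)%N by lia.
  have -> : (d - (i + l) = d - l - i)%N by lia.
  have := fact_neq0 C d; have := fact_neq0 C i; have := fact_neq0 C l.
  have := fact_neq0 C (i + l); have := fact_neq0 C (d - l - i); have := fact_neq0 C (d - l).
  move=> h1 h2 h3 h4 h5 h6; field; by rewrite ?h1 ?h2 ?h3 ?h4 ?h5 ?h6.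
have -> : (i + l - i = l)%N by lia.
have -> : (d - (i + l) = d - l - i)%N by lia.
rewrite exprD; set Z := z ^+ _.
transitivity (('C(d, i + l)%:R * 'C(i + l, i)%:R) * ((-1) ^+ i * (-1) ^+ l * a i * b l * Z)); first ring.
rewrite e; ring.
Qed.

(** Grace's theorem: the value at [z] of the convolution is the polarization of one
   polynomial at the points [z - x], with [x] running over the roots of the
   other, and these points lie in the upper half-plane. *)
Lemma walsh s1 s2 z d : size s1 = d -> size s2 = d -> (forall x, x \in s1 -> 'Im x <= 0) ->
  (forall x, x \in s2 -> 'Im x <= 0) -> 0 < 'Im z ->
  \sum_(k < d.+1) (-1) ^+ k * 'C(d, k)%:R * bin_conv
     (acoef d (\prod_(x <- s1) ('X - x%:P))) (acoef d (\prod_(x <- s2) ('X - x%:P))) k * z ^+ (d - k)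
    != 0.
Proof.
move=> sz1 sz2 h1 h2 z0; rewrite bin_conv_eval.
set p := \prod_(x <- s1) _; set q := \prod_(x <- s2) _.
pose ws := [seq z - x | x <- s2].
have szw' : size ws = d by rewrite size_map.
have szw : size s1 = size ws by rewrite szw'.
have := polars_neq0 (oner_neq0 C) szw h1 _.
rewrite scale1r -/p polarsE; last by rewrite size_prod_XsubC szw.
rewrite prod_shift -/q szw'; set S := \sum_(k < d.+1) _.
have wpos w : w \in ws -> 0 < 'Im w.
  move=> /mapP[x xs ->]; rewrite raddfB /= subr_gt0; apply: le_lt_trans z0; exact: h2.
move=> /(_ wpos); congr (_ != 0); rewrite /S (reindex_inj rev_ord_inj) /=.
apply: eq_bigr => i _; rewrite subSS; have id : (i <= d)%N by rewrite -ltnS.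
have nz k : (k <= d)%N -> 'C(d, k)%:R != 0 :> C.
  by move=> kd; rewrite pnatr_eq0 -lt0n bin_gt0.
rewrite bin_sub// subKn// /acoef.
have szq : size q = d.+1 by rewrite size_prod_XsubC sz2.
have -> : (q \Po ('X + z%:P))`_i = \sum_(l < d.+1) (-1) ^+ l * 'C(d, l)%:R *
     ((-1) ^+ l * q`_(d - l) / 'C(d, l)%:R) * ('C(d - l, i)%:R * z ^+ (d - l - i)).
  rewrite coef_shift szq (reindex_inj rev_ord_inj) /=; apply: eq_bigr => l _; rewrite subSS.
  have ld : (l <= d)%N by rewrite -ltnS.
  have e : (-1) ^+ l * (-1) ^+ l = 1 :> C by rewrite -expr2 sqrr_sign.
  congr (_ * _); transitivity (((-1) ^+ l * (-1) ^+ l) * q`_(d - l)); first by rewrite e mul1r.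
  by have := nz l ld; move: ('C(_, _)%:R) => c c0; field.
have e : (-1) ^+ i * (-1) ^+ i = 1 :> C by rewrite -expr2 sqrr_sign.
set Q := \sum_(_ < _) _; rewrite !mulrA e mul1r; ring.
Qed.
End Walsh.

Section RealRooted.
Variable R : realType.

Lemma ecoef_map d (p : {poly R}) k :
  (ecoef d p k)%:C%C = acoef d (map_poly (real_complex R) p) k :> R[i].
Proof.
by rewrite /ecoef /acoef !rmorphM fmorphV rmorph_nat rmorphXn rmorphN1 coef_map.
Qed.

Lemma boxplus_horner d (p q : {poly R}) (z : R[i]) :
  (map_poly (real_complex R) (boxplus d p q)).[z] =
  \sum_(k < d.+1) (-1) ^+ k * 'C(d, k)%:R *
    bin_conv (acoef d (map_poly (real_complex R) p))
      (acoef d (map_poly (real_complex R) q)) k * z ^+ (d - k).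
Proof.
rewrite /boxplus rmorph_sum horner_sum; apply: eq_bigr => k _ /=.
rewrite map_polyZ hornerZ map_polyXn hornerXn; congr (_ * _).
rewrite !rmorphM rmorph_nat rmorphXn rmorphN1; congr (_ * _).
rewrite rmorph_sum; apply: eq_bigr => i _.
by rewrite rmorphM [X in X * _]rmorphM rmorph_nat; congr (_ * _ * _); exact: ecoef_map.
Qed.

Lemma Im_real_complex (x : R) : 'Im (x%:C%C : R[i]) = 0.
Proof. by apply/Creal_ImP/complex_realP; exists x. Qed.

(** By [walsh] there are no roots in the upper half-plane, and as the coefficients
   are real, none in the lower half-plane either. *)
Lemma boxplus_real_rooted d (p q : {poly R}) :
  real_rooted d p -> real_rooted d q -> real_rooted d (boxplus d p q).
Proof.
move=> rp rq; case: (rp) => s1 sz1 ps1; case: (rq) => s2 sz2 qs2.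
pose toC := real_complex R; set P := boxplus d p q; pose PC := map_poly toC P.
have mapE s : map_poly toC (\prod_(x <- s) ('X - x%:P)) = \prod_(x <- map toC s) ('X - x%:P).
  by rewrite rmorph_prod big_map; apply: eq_bigr => x _; rewrite rmorphB /= map_polyX map_polyC.
have nroot z : 0 < 'Im z -> PC.[z] != 0.
  move=> z0; rewrite boxplus_horner ps1 qs2 !mapE.
  apply: walsh; rewrite ?size_map// => x.
    by move=> /mapP[y _ ->]; rewrite Im_real_complex.
  by move=> /mapP[y _ ->]; rewrite Im_real_complex.
have rootIm z : root PC z -> 'Im z = 0.
  move=> rz; apply/eqP; rewrite eq_le Im_le0_gt0; apply/andP; split.
    by apply/negP => /nroot; rewrite -rootE rz.
  rewrite -oppr_le0 -Im_conj Im_le0_gt0; apply/negP => /nroot; rewrite -rootE.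
  have -> : PC = map_poly Num.conj PC.
    apply/polyP => i; rewrite [RHS]coef_map /PC coef_map /=; apply/esym/conj_Creal.
    by apply/complex_realP; exists P`_i.
  by rewrite fmorph_root rz.
have szP : (size P <= d.+1)%N.
  apply/leq_sizeP => j dj; rewrite coef_sum big1// => k _.
  by rewrite coefZ coefXn; case: eqP => [e|_]; [lia|rewrite mulr0].
have Pd : P`_d = 1.
  have := coef_boxplus p q (leq0n d); rewrite subn0 -/P => ->.
  by rewrite /bin_conv big_ord1 /= !ecoef0// bin0 expr0 !mulr1.
have szP' : size P = d.+1.
  apply/eqP; rewrite eqn_leq szP ltnNge; apply/negP => le.
  by move: Pd; rewrite nth_default// => /eqP; rewrite eq_sym oner_eq0.
have [r PCr] := closed_field_poly_normal PC.
have lP : lead_coef PC = 1.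
  by rewrite lead_coef_map lead_coefE szP' Pd rmorph1.
rewrite lP scale1r in PCr.
have rE : r = map toC (map (@complex.Re R) r).
  rewrite -map_comp -[LHS]map_id; apply/eq_in_map => z zr /=.
  have : root PC z by rewrite PCr root_prod_XsubC.
  by move=> /rootIm/Creal_ImP/RRe_real.
exists (map (@complex.Re R) r).
  have := congr1 (fun f : {poly R[i]} => size f) PCr.
  by rewrite size_map_poly szP' size_prod_XsubC size_map => -[].
apply: (map_poly_inj toC); by rewrite mapE -rE.
Qed.
End RealRooted.

From mathcomp Require Import all_classical all_reals all_analysis.

Import numFieldNormedType.Exports.

(** * First-order expansions *)

Section Expansion.
Local Open Scope classical_set_scope.
Variable R : realType.
Implicit Types (x y : nat -> R) (a b c : R).

(** [x d = a + b / d + o(1 / d)] as [d] goes to infinity. *)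
Definition expansion x a b : Prop := d%:R * (x d - a) @[d --> \oo] --> b.

Lemma cvg_eventually x y a N : (forall d, (N <= d)%N -> x d = y d) ->
  x d @[d --> \oo] --> a -> y d @[d --> \oo] --> a.
Proof.
move=> xy; apply: cvg_trans; apply: near_eq_cvg.
by near=> d; rewrite xy//; near: d; exact: nbhs_infty_ge.
Unshelve. all: by end_near. Qed.

Lemma expansion_eventually x y a b N : (forall d, (N <= d)%N -> x d = y d) ->
  expansion x a b -> expansion y a b.
Proof. by move=> xy; apply: (@cvg_eventually _ _ _ N) => d Nd; rewrite xy. Qed.

Lemma cvg_inv_nat : (d%:R^-1 : R) @[d --> \oo] --> (0 : R).
Proof.
rewrite -(cvg_shiftS (fun d => d%:R^-1 : R)).
exact: cvg_harmonic.
Qed.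

Lemma expansion_cvg x a b : expansion x a b -> x d @[d --> \oo] --> a.
Proof.
move=> xa; apply: (@cvg_eventually (fun d => a + d%:R^-1 * (d%:R * (x d - a))) _ _ 1).
  by move=> d d0; rewrite mulKf ?pnatr_eq0 -?lt0n// addrC subrK.
rewrite -[X in _ --> X]addr0; apply: cvgD; first exact: cvg_cst.
by rewrite -(mul0r b); apply: cvgM => //; exact: cvg_inv_nat.
Qed.

Lemma expansion_cst a : expansion (fun=> a) a 0.
Proof.
rewrite /expansion; under eq_fun do rewrite subrr mulr0.
exact: cvg_cst.
Qed.

Lemma expansion_inv_nat : expansion (fun d => d%:R^-1) 0 1.
Proof.
apply: (@cvg_eventually (fun=> 1) _ _ 1); last exact: cvg_cst.
by move=> d d0; rewrite subr0 divff// pnatr_eq0 -lt0n.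
Qed.

Lemma expansionD x y a b a' b' : expansion x a b -> expansion y a' b' ->
  expansion (fun d => x d + y d) (a + a') (b + b').
Proof.
move=> xa ya; rewrite /expansion.
rewrite (_ : (fun d => _) = (fun d => d%:R * (x d - a) + d%:R * (y d - a'))).
  exact: cvgD.
by apply/funext => d; ring.
Qed.

Lemma expansionM x y a b a' b' : expansion x a b -> expansion y a' b' ->
  expansion (fun d => x d * y d) (a * a') (b * a' + a * b').
Proof.
move=> xa ya; rewrite /expansion.
rewrite (_ : (fun d => _) = (fun d => d%:R * (x d - a) * y d + a * (d%:R * (y d - a')))).
  apply: cvgD; first by apply: cvgM => //; exact: expansion_cvg ya.
  by apply: cvgM => //; exact: cvg_cst.
by apply/funext => d; ring.
Qed.

Lemma expansionZ x a b c : expansion x a b -> expansion (fun d => c * x d) (c * a) (c * b).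
Proof.
by move=> xa; have := expansionM (expansion_cst c) xa; rewrite mul0r add0r.
Qed.

Lemma expansionV x a b : a != 0 -> expansion x a b ->
  expansion (fun d => (x d)^-1) a^-1 (- b / a ^+ 2).
Proof.
move=> a0 xa; have xd := expansion_cvg xa.
have x0 : \forall d \near \oo, x d != 0 by apply: cvgr_neq0 xd a0.
case: x0 => N _ x0.
apply: (@cvg_eventually (fun d => - (d%:R * (x d - a)) * ((x d)^-1 * a^-1)) _ _ N).
  by move=> d Nd; have := x0 d Nd; move=> xd0; field; rewrite xd0 a0.
apply: cvgM; first exact: cvgN.
by rewrite expr2 invfM; apply: cvgM; [exact: cvgV|exact: cvg_cst].
Qed.

Lemma expansion_sum (I : Type) (r : seq I) (P : pred I) (x : I -> nat -> R) (a b : I -> R) :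
  (forall i, P i -> expansion (x i) (a i) (b i)) ->
  expansion (fun d => \sum_(i <- r | P i) x i d) (\sum_(i <- r | P i) a i) (\sum_(i <- r | P i) b i).
Proof.
move=> xab; elim: r => [|i r IHr].
  rewrite !big_nil (_ : (fun d => _) = fun=> 0); first exact: expansion_cst.
  by apply/funext => d; rewrite big_nil.
rewrite !big_cons (_ : (fun d => _) = fun d => if P i then x i d + \sum_(j <- r | P j) x j d
    else \sum_(j <- r | P j) x j d).
  by case: ifP => Pi //; apply: expansionD => //; exact: xab.
by apply/funext => d; rewrite big_cons.
Qed.

Lemma expansion_prod (I : eqType) (r : seq I) (x : I -> nat -> R) (a b : I -> R) :
  uniq r -> (forall i, i \in r -> expansion (x i) (a i) (b i)) ->
  expansion (fun d => \prod_(i <- r) x i d) (\prod_(i <- r) a i)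
    (\sum_(i <- r) b i * \prod_(j <- r | j != i) a j).
Proof.
elim: r => [_ _|i r IHr /= /andP[ir ur] xab].
  rewrite !big_nil (_ : (fun d => _) = fun=> 1); first exact: expansion_cst.
  by apply/funext => d; rewrite big_nil.
rewrite !big_cons eqxx (_ : (fun d => _) = fun d => x i d * \prod_(j <- r) x j d); last first.
  by apply/funext => d; rewrite big_cons.
have -> : \sum_(j <- r) b j * \prod_(k <- i :: r | k != j) a k =
    a i * \sum_(j <- r) b j * \prod_(k <- r | k != j) a k.
  rewrite mulr_sumr big_seq [RHS]big_seq; apply: eq_bigr => j jr.
  rewrite big_cons; case: eqVneq => [ij|_ /=]; first by rewrite ij jr in ir.
  ring.
have -> : \prod_(j <- r | j != i) a j = \prod_(j <- r) a j.
  rewrite big_seq_cond [RHS]big_seq; apply: eq_bigl => j.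
  by case jr: (j \in r) => //=; apply: contraNneq ir => <-.
apply: expansionM; first by apply: xab; rewrite mem_head.
by apply: IHr => // j jr; apply: xab; rewrite inE jr orbT.
Qed.

Lemma expansion_unique x a b a' b' : expansion x a b -> expansion x a' b' -> a = a' /\ b = b'.
Proof.
move=> xa xa'; have aa : a = a'.
  by apply: (cvg_unique _ (expansion_cvg xa) (expansion_cvg xa')).
by split=> //; move: xa'; rewrite -aa => xa'; exact: (cvg_unique _ xa xa').
Qed.

Lemma expansion_small x a b j : expansion x a b ->
  expansion (fun d => (- d%:R^-1) ^+ j.+2 * x d) 0 0.
Proof.
move=> xa; have inv : expansion (fun d => - d%:R^-1) 0 (-1).
  have := expansionZ (c := -1) expansion_inv_nat; rewrite mulr0 mulr1.
  by apply: (@expansion_eventually _ _ _ _ 0) => d _; rewrite mulN1r.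
have step (y : nat -> R) a' b' : expansion y a' b' ->
    expansion (fun d => - d%:R^-1 * y d) 0 (- a').
  by move=> ya; have := expansionM inv ya; rewrite !mul0r addr0 mulN1r.
have [c small] : exists c, expansion (fun d => (- d%:R^-1) ^+ j.+1 * x d) 0 c.
  elim: j => [|j [c IHj]].
    by exists (- a); apply: (@expansion_eventually _ _ _ _ 0) (step _ _ _ xa) => d _; rewrite expr1.
  exists (- 0); apply: (@expansion_eventually _ _ _ _ 0) (step _ _ _ IHj) => d _.
  by rewrite mulrA -exprS.
rewrite -[X in expansion _ _ X]oppr0.
by apply: (@expansion_eventually _ _ _ _ 0) (step _ _ _ small) => d _; rewrite mulrA -exprS.
Qed.

Lemma expansion_part_prod n (k : nat -> nat -> R) (a b : nat -> R) (P : {set {set 'I_n}}) :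
  (forall V, V \in P -> expansion (k^~ #|V|) (a #|V|) (b #|V|)) ->
  expansion (fun d => part_prod (k d) P) (part_prod a P)
    (\sum_(V in P) b #|V| * part_prod a (P :\ V)).
Proof.
move=> kab; have ur : uniq (enum P) by exact: enum_uniq.
have := expansion_prod (x := fun (V : {set 'I_n}) d => k d #|V|)
  (a := fun V : {set 'I_n} => a #|V|) (b := fun V : {set 'I_n} => b #|V|) ur.
have enumE V : (V \in enum P) = (V \in P) by rewrite mem_enum.
have kabE V : V \in enum P -> expansion (k^~ #|V|) (a #|V|) (b #|V|).
  by rewrite enumE; exact: kab.
move=> /(_ kabE); rewrite !big_enum /=.
have -> : \sum_(V in P) b #|V| * \prod_(W <- enum P | W != V) a #|W| =
    \sum_(V in P) b #|V| * part_prod a (P :\ V).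
  apply: eq_bigr => V _; rewrite big_enum_cond /part_prod /=; congr (_ * _).
  by apply: eq_bigl => W; rewrite !inE andbC.
by apply: (@expansion_eventually _ _ _ _ 0) => d _; rewrite big_enum.
Qed.

Lemma is_cumulant_fluctuationP (p : nat -> {poly R}) mu n c :
  is_cumulant_fluctuation p mu n c <-> expansion (fun d => ff_cumulant d (p d) n) (r_ mu n) c.
Proof.
rewrite /is_cumulant_fluctuation; split => [/eqaddoP h|h].
  apply/cvgrPdist_le => e e0; near=> d.
  have d0 : (0 < d)%N by near: d; exact: nbhs_infty_gt.
  have dR : 0 < d%:R :> R by rewrite ltr0n.
  have : `|ff_cumulant d (p d) n - (r_ mu n + d%:R^-1 * c)| <= e * `|d%:R^-1 : R|.
    by near: d; exact: (h e e0).
  have nd : `|d%:R^-1 : R| = d%:R^-1 by rewrite ger0_norm ?invr_ge0 ?ltW.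
  rewrite nd ler_pdivlMr// => le.
  apply: le_trans le; rewrite distrC -[X in _ <= _ * X](gtr0_norm dR) -normrM.
  by rewrite le_eqVlt; apply/orP; left; apply/eqP; congr `|_|; field; rewrite gt_eqF.
apply/eqaddoP => e e0; near=> d.
have d0 : (0 < d)%N by near: d; exact: nbhs_infty_gt.
have dR : 0 < d%:R :> R by rewrite ltr0n.
have : `|c - d%:R * (ff_cumulant d (p d) n - r_ mu n)| <= e.
  by near: d; move/cvgrPdist_le: h; exact.
have nd : `|d%:R^-1 : R| = d%:R^-1 by rewrite ger0_norm ?invr_ge0 ?ltW.
rewrite nd ler_pdivlMr// => le.
apply: le_trans le; rewrite [X in _ <= X]distrC -[X in _ * X <= _](gtr0_norm dR) -normrM.
rewrite le_eqVlt; apply/orP; left; apply/eqP; congr `|_| => /=.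
rewrite fctE /= [X in _ + X](_ : _ = - (r_ mu n + d%:R^-1 * c))//.
by field; rewrite gt_eqF.
Unshelve. all: by end_near. Qed.
End Expansion.

Definition moment_functional (R : realType) (v : nat -> R) (p : {poly R}) : R :=
  \sum_(i < size p) p`_i * v i.

Lemma moment_functionalE (R : realType) (v : nat -> R) (p : {poly R}) N : (size p <= N)%N ->
  moment_functional v p = \sum_(i < N) p`_i * v i.
Proof.
move=> pN; rewrite /moment_functional (big_ord_widen N (fun i => p`_i * v i) pN) big_mkcond.
by apply: eq_bigr => i _; case: ltnP => // le; rewrite nth_default ?mul0r.
Qed.

Lemma moment_functional_is_scalar (R : realType) (v : nat -> R) : scalar (moment_functional v).
Proof.
move=> a p q; pose N := maxn (size (a *: p + q)) (maxn (size p) (size q)).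
rewrite !(@moment_functionalE _ _ _ N) ?leq_max ?leqnn ?orbT//.
rewrite mulr_sumr -big_split; apply: eq_bigr => i _ /=.
by rewrite coefD coefZ mulrDl mulrA.
Qed.

HB.instance Definition _ (R : realType) (v : nat -> R) :=
  GRing.isLinear.Build R {poly R} R _ (moment_functional v) (moment_functional_is_scalar v).

Lemma moment_functionalXn (R : realType) (v : nat -> R) n : moment_functional v 'X^n = v n.
Proof.
rewrite /moment_functional size_polyXn big_ord_recr /= coefXn eqxx mul1r big1 ?add0r// => i _.
by rewrite coefXn ltn_eqF ?mul0r.
Qed.

(** * Expansions of moments and cumulants *)

Section Asymptotics.
Local Open Scope classical_set_scope.
Variable R : realType.
Implicit Types (d n k : nat) (a b : nat -> R).

Lemma conn_card_le n (s t : 'S_n.+1) : conn finset.setT s t -> (ncyc s + ncyc t <= n.+2)%N.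
Proof.
move=> cst; have := genus_le cst; have := ncyc_gt0 (s * t)%g; rewrite card_ord.
by move: (ncyc s) (ncyc t) (ncyc _) => *; lia.
Qed.

Definition annular_sum (u : nat -> R) n : R :=
  \sum_(1 <= s < n) \sum_(sigma in SNC s (n - s)) perm_prod u sigma / (s%:R * (n - s)%:R).

(** The pairs of [moment_cumulant] sorted by the number of their cycles: planar
   pairs have order 0 in [d^-1], annular pairs order 1 and all others order at
   least 2. *)
Lemma moment_genus_expansion d (p : {poly R}) n : (0 < d)%N -> real_rooted d p ->
  poly_moment d p n.+1 =
    \sum_(P in NC n.+1) part_prod (ff_cumulant d p) P
    - d%:R^-1 * (n.+1%:R / 2 * annular_sum (ff_cumulant d p) n.+1)
    + n`!%:R^-1 * \sum_(s : 'S_n.+1)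
        \sum_(t : 'S_n.+1 | conn finset.setT s t && (ncyc s + ncyc t <= n)%N)
        (- d%:R^-1) ^+ (n.+2 - (ncyc s + ncyc t)) * perm_prod (ff_cumulant d p) s.
Proof.
move=> d0 rp; set u := ff_cumulant d p.
have n0 := fact_neq0 R n; apply: (mulfI n0).
rewrite moment_cumulant// -/u !mulrDr mulrN mulVKf//.
have -> : n`!%:R * (d%:R^-1 * (n.+1%:R / 2 * annular_sum u n.+1)) =
    d%:R^-1 * (n.+1`!%:R / 2 * annular_sum u n.+1) by rewrite factS natrM; ring.
rewrite -sum_pairs_planar /annular_sum -sum_pairs_annular -mulNr mulr_sumr -!big_split /=.
apply: eq_bigr => s _; rewrite mulr_sumr.
rewrite [LHS](bigID (fun t => ncyc s + ncyc t == n.+2)%N) /= -addrA; congr (_ + _).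
  by apply: eq_bigr => t /andP[_ /eqP ->]; rewrite subnn expr0 mul1r.
rewrite (bigID (fun t => ncyc s + ncyc t == n.+1)%N) /=; congr (_ + _).
  apply: eq_big => [t|t /andP[_ /eqP ->]]; last by rewrite subSnn expr1.
  by rewrite -andbA; congr (_ && _); lia.
apply: eq_bigl => t; rewrite -!andbA; case cst: (conn _ s t) => //=.
by have := conn_card_le cst; move: (ncyc s + ncyc t)%N; lia.
Qed.

Lemma card_porbit_bounds n (s : 'S_n) c : c \in porbits s -> (0 < #|c| <= n)%N.
Proof.
move=> /imsetP[x _ ->]; rewrite lt0n card_porbit_neq0 /=.
by have := max_card (mem (porbit s x)); rewrite card_ord.
Qed.

Lemma expansion_perm_prod n (k : nat -> nat -> R) a b (s : 'S_n) :
  (forall i, (0 < i <= n)%N -> expansion (k^~ i) (a i) (b i)) ->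
  exists c, expansion (fun d => perm_prod (k d) s) (perm_prod a s) c.
Proof.
move=> kab; eexists; apply: expansion_part_prod => V Vs.
by apply: kab; exact: card_porbit_bounds Vs.
Qed.

Lemma expansion_sum_ex (I : Type) (r : seq I) (P : pred I) (x : I -> nat -> R) (a : I -> R) :
  (forall i, P i -> exists c, expansion (x i) (a i) c) ->
  exists c, expansion (fun d => \sum_(i <- r | P i) x i d) (\sum_(i <- r | P i) a i) c.
Proof.
move=> xa; have /choice[c xac] : forall i, exists c, P i -> expansion (x i) (a i) c.
  by move=> i; case Pi: (P i); [have [c ?] := xa i Pi; exists c|exists 0].
by exists (\sum_(i <- r | P i) c i); apply: expansion_sum.
Qed.

Lemma expansion_annular_sum n (k : nat -> nat -> R) a b :
  (forall i, (0 < i <= n)%N -> expansion (k^~ i) (a i) (b i)) ->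
  exists c, expansion (fun d => annular_sum (k d) n) (annular_sum a n) c.
Proof.
move=> kab.
have [|c] := @expansion_sum_ex _ (index_iota 1 n) (fun s => 1 <= s < n)%N
    (fun s d => \sum_(sigma in SNC s (n - s)) perm_prod (k d) sigma / (s%:R * (n - s)%:R))
    (fun s => \sum_(sigma in SNC s (n - s)) perm_prod a sigma / (s%:R * (n - s)%:R)).
  move=> s /andP[s0 sn]; have e : (s + (n - s) = n)%N by rewrite subnKC// ltnW.
  apply: expansion_sum_ex => sigma _.
  have [|c kc] := @expansion_perm_prod _ k a b sigma; first by rewrite e.
  exists ((s%:R * (n - s)%:R)^-1 * c); rewrite [X in expansion _ X]mulrC.
  by apply: (@expansion_eventually _ _ _ _ _ 0) (expansionZ kc) => d _; rewrite mulrC.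
rewrite -big_nat => ac; exists c; apply: (@expansion_eventually _ _ _ _ _ 0) ac => d _.
by rewrite -big_nat.
Qed.

Lemma NC_block_bounds n (P : {set {set 'I_n}}) V : P \in NC n -> V \in P -> (0 < #|V| <= n)%N.
Proof.
rewrite !inE => /andP[pP _] VP; rewrite card_gt0 (partition_neq0 pP VP) /=.
by have := max_card (mem V); rewrite card_ord.
Qed.

Lemma moment_expansion (p : nat -> {poly R}) a b n :
  (forall d, (1 <= d)%N -> real_rooted d (p d)) ->
  (forall k, (0 < k <= n)%N -> expansion (fun d => ff_cumulant d (p d) k) (a k) (b k)) ->
  (0 < n)%N ->
  expansion (fun d => poly_moment d (p d) n) (\sum_(P in NC n) part_prod a P)
    (\sum_(P in NC n) \sum_(V in P) b #|V| * part_prod a (P :\ V)%SET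
     - n%:R / 2 * annular_sum a n).
Proof.
case: n => // n rp kab _.
pose k d := ff_cumulant d (p d).
have perm (s : 'S_n.+1) := expansion_perm_prod s kab.
have [ann annE] := expansion_annular_sum kab.
pose G d := n`!%:R^-1 * \sum_(s : 'S_n.+1)
        \sum_(t : 'S_n.+1 | conn finset.setT s t && (ncyc s + ncyc t <= n)%N)
        (- d%:R^-1) ^+ (n.+2 - (ncyc s + ncyc t)) * perm_prod (k d) s.
have GE : expansion G 0 0.
  rewrite -[X in expansion _ X](mulr0 n`!%:R^-1) -[X in expansion _ _ X](mulr0 n`!%:R^-1).
  apply: expansionZ; pose z (s t : 'S_n.+1) : R := 0.
  have z1 (s : 'S_n.+1) : \sum_(t : 'S_n.+1 | conn finset.setT s t && (ncyc s + ncyc t <= n)%N) z s t = 0.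
    by rewrite big1.
  have z2 : \sum_(s : 'S_n.+1)
      \sum_(t : 'S_n.+1 | conn finset.setT s t && (ncyc s + ncyc t <= n)%N) z s t = 0.
    by rewrite big1.
  rewrite -[X in expansion _ X]z2 -[X in expansion _ _ X]z2.
  apply: expansion_sum => s _; apply: expansion_sum => t /andP[_ le]; rewrite /z.
  have [c kc] := perm s.
  by rewrite -[n.+2]addn2 -addnBAC// addn2; apply: expansion_small kc.
pose x d := \sum_(P in NC n.+1) part_prod (k d) P
    - d%:R^-1 * (n.+1%:R / 2 * annular_sum (k d) n.+1) + G d.
apply: (@expansion_eventually _ x _ _ _ 1) => [d d0|].
  by rewrite moment_genus_expansion//; exact: rp.
have NCE : expansion (fun d => \sum_(P in NC n.+1) part_prod (k d) P)
    (\sum_(P in NC n.+1) part_prod a P)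
    (\sum_(P in NC n.+1) \sum_(V in P) b #|V| * part_prod a (P :\ V)%SET).
  apply: expansion_sum => P PNC; apply: expansion_part_prod => V VP; apply: kab.
  exact: NC_block_bounds PNC VP.
have := expansionD (expansionD NCE (expansionZ (c := -1)
  (expansionM (@expansion_inv_nat R) (expansionZ (c := n.+1%:R / 2) annE)))) GE.
rewrite !(mul0r, mul1r, mulr0, addr0, mulN1r, oppr0).
by apply: (@expansion_eventually _ _ _ _ _ 0) => d _; rewrite mulN1r.
Qed.

Lemma expansion_pow j : exists c, expansion (fun d => (- d%:R^-1) ^+ j : R) (j == 0)%:R c.
Proof.
have nz i : (i.+1 == 0)%:R = 0 :> R by [].
case: j => [|[|j]]; rewrite ?nz.
- by exists 0; exact: (expansion_cst (1 : R)).
- exists (- 1); have := expansionZ (c := -1) (@expansion_inv_nat R); rewrite mulr0 mulr1.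
  by apply: (@expansion_eventually _ _ _ _ _ 0) => d _; rewrite mulN1r expr1.
exists 0; apply: (@expansion_eventually _ _ _ _ _ 0) (expansion_small j (expansion_cst 1)) => d _.
by rewrite mulr1.
Qed.

Lemma perm_prod_one_cycle (u : nat -> R) n (s : 'S_n.+1) : ncyc s = 1%N -> perm_prod u s = u n.+1.
Proof.
move=> s1; have /cards1P[C sC] : #|porbits s| == 1%N by rewrite -/(ncyc s) s1.
rewrite /perm_prod sC big_set1; congr (u _).
have := card_partition (porbits_partition_setT s).
by rewrite cardsT card_ord sC big_set1.
Qed.

Lemma card_porbit_lt n (s : 'S_n.+1) C : ncyc s <> 1%N -> C \in porbits s -> (0 < #|C| <= n)%N.
Proof.
move=> s1 Cs; have /andP[-> leC] := card_porbit_bounds Cs.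
rewrite -ltnS ltn_neqAle leC andbT; apply/eqP => eC; apply: s1.
apply/eqP; rewrite eqn_leq ncyc_gt0 andbT; apply/card_le1_eqP.
suff all D : D \in porbits s -> D = C by move=> D E /all -> /all ->.
move=> Ds; have CT : C = finset.setT.
  by apply/eqP; rewrite eqEcard finset.subsetT cardsT card_ord eC leqnn.
case/imsetP: Cs CT => x _ -> xT; case/imsetP: Ds => y _ ->.
by apply/eqP; rewrite eq_porbit_mem xT inE.
Qed.

(** In the sum for the [n]-th moment, the [n]-th cumulant occurs exactly in the
   terms in which the first permutation is a cycle; their total coefficient
   tends to a positive limit, so that one can solve for the cumulant. *)
Lemma cumulant_expansion (p : nat -> {poly R}) a b m m' n :
  (forall d, (1 <= d)%N -> real_rooted d (p d)) ->
  (forall k, (0 < k <= n)%N -> expansion (fun d => ff_cumulant d (p d) k) (a k) (b k)) ->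
  expansion (fun d => poly_moment d (p d) n.+1) m m' ->
  exists c c', expansion (fun d => ff_cumulant d (p d) n.+1) c c'.
Proof.
move=> rp kab mm'; pose k d := ff_cumulant d (p d).
pose e (s t : 'S_n.+1) := (n.+2 - (ncyc s + ncyc t))%N.
pose L d : R := \sum_(s : 'S_n.+1 | ncyc s == 1%N) \sum_(t : 'S_n.+1 | conn finset.setT s t)
  (- d%:R^-1) ^+ e s t.
pose G d : R := \sum_(s : 'S_n.+1 | ncyc s != 1%N) \sum_(t : 'S_n.+1 | conn finset.setT s t)
  (- d%:R^-1) ^+ e s t * perm_prod (k d) s.
pose L0 : R := \sum_(s : 'S_n.+1 | ncyc s == 1%N) \sum_(t : 'S_n.+1 | conn finset.setT s t)
  (e s t == 0)%:R.
have [L' LE] : exists L', expansion L L0 L'.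
  by apply: expansion_sum_ex => s _; apply: expansion_sum_ex => t _; exact: expansion_pow.
have [G0 [G' GE]] : exists G0 G', expansion G G0 G'.
  eexists; apply: expansion_sum_ex => s /eqP s1; apply: expansion_sum_ex => t _.
  have [c ec] := expansion_pow (e s t); eexists; apply: (expansionM ec).
  by apply: expansion_part_prod => V /(card_porbit_lt s1); exact: kab.
(* A sum of natural numbers, in which the rotation and the identity give 1. *)
have L0_neq0 : L0 != 0.
  have r1 : conn finset.setT (rot1 n) 1%g.
    by apply/connP => S _ rS _; have /ncyc_le1P := rot1_ncyc n; apply.
  have e1 : e (rot1 n) 1%g = 0%N.
    have := rot1_geodesic n; rewrite /geodesic mulVg => /eqP; rewrite /e.
    by move=> ->; rewrite subnn.
  rewrite gt_eqF// /L0 (bigD1 (rot1 n)) ?rot1_ncycE//= (bigD1 1%g)//= e1 eqxx -addrA.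
  by rewrite ltr_pwDl ?ltr01// addr_ge0// !sumr_ge0// => s _; rewrite sumr_ge0.
have [N _ LN] : \forall d \near \oo, L d != 0 by apply: cvgr_neq0 (expansion_cvg LE) L0_neq0.
pose x d := (n`!%:R * poly_moment d (p d) n.+1 + -1 * G d) * (L d)^-1.
do 2 eexists; apply: (@expansion_eventually _ x _ _ _ (maxn 1 N)); last first.
  exact: expansionM (expansionD (expansionZ mm') (expansionZ GE)) (expansionV L0_neq0 LE).
move=> d; rewrite geq_max => /andP[d0 Nd]; rewrite /x moment_cumulant//; last exact: rp.
have -> : \sum_(s : 'S_n.+1) \sum_(t : 'S_n.+1 | conn finset.setT s t)
    (- d%:R^-1) ^+ (n.+2 - (ncyc s + ncyc t)) * perm_prod (k d) s = L d * k d n.+1 + G d.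
  rewrite (bigID (fun s => ncyc s == 1%N)) /=; congr (_ + _).
  rewrite /L mulr_suml; apply: eq_bigr => s /eqP s1; rewrite mulr_suml.
  by apply: eq_bigr => t _; rewrite perm_prod_one_cycle.
by rewrite mulN1r addrK mulrC mulKf//; exact: LN.
Qed.

(** The one-block partition contributes [u n], and all other blocks are smaller. *)
Lemma NC_sum_inj u v n : (0 < n)%N -> (forall k, (0 < k < n)%N -> u k = v k) ->
  \sum_(P in NC n) part_prod u P = \sum_(P in NC n) part_prod v P :> R -> u n = v n.
Proof.
move=> n0 uv; rewrite (bigD1 _ (one_block_NC n0)) [RHS](bigD1 _ (one_block_NC n0)) /=.
rewrite {1 3}/part_prod !big_set1 cardsT card_ord.
rewrite [X in _ + X](eq_bigr (fun P => part_prod v P)) => [/addIr//|P /andP[PNC nP]].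
by apply: eq_bigr => V VP; apply: uv; exact: NC_block_lt PNC nP VP.
Qed.

(** Existence of the expansion of cumulants follows inductively from that of the
   moments; its leading term satisfies the moment-cumulant relation that defines
   the free cumulants of [mu]. *)
Lemma cumulant_fluctuation_ex (p : nat -> {poly R}) mu mu' n :
  infinitesimal_distribution p mu mu' -> (0 < n)%N ->
  expansion (fun d => ff_cumulant d (p d) n) (r_ mu n) (r_hat p mu n).
Proof.
move=> [rp _ _ _ mE]; elim/ltn_ind: n => -[//|n] IHn _.
have IH k : (0 < k <= n)%N -> expansion (fun d => ff_cumulant d (p d) k) (r_ mu k) (r_hat p mu k).
  by move=> /andP[k0 kn]; apply: IHn.
have [a' [b' ab]] := cumulant_expansion rp IH (mE n.+1 isT).
pose a k := if k == n.+1 then a' else r_ mu k.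
pose b k := if k == n.+1 then b' else r_hat p mu k.
have kab k : (0 < k <= n.+1)%N -> expansion (fun d => ff_cumulant d (p d) k) (a k) (b k).
  rewrite /a /b => /andP[k0]; rewrite leq_eqVlt; case: eqP => [->//|_ /= kn].
  by apply: IH; rewrite k0.
have [aE _] := expansion_unique (moment_expansion rp kab isT) (mE n.+1 isT).
have a'E : a' = r_ mu n.+1.
  have -> : a' = a n.+1 by rewrite /a eqxx.
  apply: NC_sum_inj => // [k /andP[_ kn]|]; first by rewrite /a ltn_eqF.
  by rewrite aE -free_cumulantE.
have fl : is_cumulant_fluctuation p mu n.+1 b'.
  by apply/is_cumulant_fluctuationP; rewrite -a'E.
apply/is_cumulant_fluctuationP; rewrite /r_hat.
by apply: (@xgetPex _ 0 (is_cumulant_fluctuation p mu n.+1)); exists b'.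
Qed.
End Asymptotics.

(** * The infinitesimal distribution of the convolution *)

Lemma poly_moment0 (R : realType) d (p : {poly R}) : (0 < d)%N -> real_rooted d p ->
  poly_moment d p 0 = 1.
Proof.
move=> d0 rp; have [rs szs] := root_seqP rp.
rewrite /poly_moment (eq_bigr (fun=> 1)) => [|x _]; last by rewrite expr0.
by rewrite big_const_seq count_predT iter_addr_0 szs mulVf// pnatr_eq0 -lt0n.
Qed.

Lemma moment0 (R : realType) (mu : probability (measurableTypeR R) R) : moment mu 0 = 1.
Proof.
rewrite /moment (_ : (fun x : R => x ^+ 0) = fun=> 1); last by apply/funext => x; rewrite expr0.
rewrite Rintegral_cst// mul1r; exact: (congr1 fine (probability_setT mu)).
Qed.

Theorem theorem3p4 (R : realType) (p q : nat -> {poly R})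
    (mu nu rho : probability (measurableTypeR R) R)
    (mu' nu' : {scalar {poly R}})
    (mu_det : determined_by_moments mu)
    (nu_det : determined_by_moments nu)
    (hp : infinitesimal_distribution p mu mu')
    (hq : infinitesimal_distribution q nu nu')
    (hrho : is_free_convolution mu nu rho) :
  exists rho' : {scalar {poly R}},
    infinitesimal_distribution (fun d => boxplus d (p d) (q d)) rho rho' /\
    forall n : nat, (1 <= n)%N ->
      rho' 'X^n =
        \sum_(P in NC n) \sum_(V in P)
          (r_hat p mu #|V| + r_hat q nu #|V|) * part_prod (r_ rho) (P :\ V)
        - n%:R / 2 *
          \sum_(1 <= s < n) \sum_(sigma in SNC s (n - s))
            perm_prod (r_ rho) sigma / (s%:R * (n - s)%:R).
Proof.
have [[fin_rho _] r_rho] := hrho.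
have [rp _ _ _ _] := hp; have [rq _ _ _ _] := hq.
have rpq d : (1 <= d)%N -> real_rooted d (boxplus d (p d) (q d)).
  by move=> d1; apply: boxplus_real_rooted; [exact: rp|exact: rq].
pose b k := r_hat p mu k + r_hat q nu k.
(* Additivity of the [k]-th cumulant holds only from [d = k] on. *)
have kappaE k : (0 < k)%N ->
    expansion (fun d => ff_cumulant d (boxplus d (p d) (q d)) k) (r_ rho k) (b k).
  move=> k0; rewrite r_rho//.
  apply: (@expansion_eventually _ _ _ _ _ k)
    (expansionD (cumulant_fluctuation_ex hp k0) (cumulant_fluctuation_ex hq k0)) => d kd.
  have d1 : (1 <= d)%N by apply: leq_trans kd.
  by rewrite ff_cumulant_boxplus ?k0//; [exact: rp|exact: rq|exact: rpq].
pose v n := if n == 0%N then 0 else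
  \sum_(P in NC n) \sum_(V in P) b #|V| * part_prod (r_ rho) (P :\ V)
  - n%:R / 2 * annular_sum (r_ rho) n.
have momE n : (0 < n)%N ->
    expansion (fun d => poly_moment d (boxplus d (p d) (q d)) n) (moment rho n) (v n).
  move=> n0; rewrite (free_cumulantE (moment rho) n0) /v gtn_eqF//.
  by apply: moment_expansion => // k /andP[k0 _]; exact: kappaE.
exists (moment_functional v); split; last first.
  by move=> n n1; apply: etrans (moment_functionalXn v n) _; rewrite /v gtn_eqF.
split=> //.
- move=> [|n]; last exact: expansion_cvg (momE n.+1 isT).
  rewrite moment0; apply: (@cvg_eventually _ (fun=> 1) _ _ 1); last exact: cvg_cst.
  by move=> d d1; rewrite poly_moment0//; exact: rpq.
- exact: (moment_functionalXn v 0).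
- move=> n n1; have /esym vE := moment_functionalXn v n.
  by have := momE n n1; rewrite /expansion vE.
Qed.
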